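(* Let $k>0$ and let $f\in C^3(\mathbb{R},\mathbb{R})$ satisfy: (i) all critical points of $f$ are non-degenerate, i.e. $f'(x)=0$ implies $f''(x)\ne0$; (ii) there is a constant $C>0$ such that for all $x\in\mathbb{R}$ with $|x|\ge1$, $$\Bigl|\partial_x^\ell\Bigl(f(x)-\frac{1}{|x|^k}\Bigr)\Bigr|\le\frac{C}{|x|^{k+\ell+1}}\qquad\text{for }\ell=0,1,2,3.$$ Then there exists $M_4\ge1$ such that, for all $\epsilon\in(0,1]$, $$\frac{1}{M_4\,\epsilon^{\bar\nu}}\ \le\ \Psi(\epsilon)\ \le\ \frac{M_4}{\epsilon^{\bar\nu}},\qquad\text{where }\ \bar\nu=\frac{2}{k+4}.$$
   Context: For $\epsilon>0$, $H_\epsilon=-\partial_x^2+x^2+\frac{i}{\epsilon}f(x)$ is the operator on $L^2(\mathbb{R})$ (complex-valued functions) with domain $\mathcal{D}=\{u\in H^2(\mathbb{R}) : x^2u\in L^2(\mathbb{R})\}$, and $$\Psi(\epsilon)=\Bigl(\sup_{\lambda\in\mathbb{R}}\|(H_\epsilon-i\lambda)^{-1}\|\Bigr)^{-1},$$ where $\|\cdot\|$ is the operator norm on $L^2(\mathbb{R})$. The constant $M_4$ does not depend on $\epsilon$. *)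

(* Defs.v *)
From HB Require Import structures.
From mathcomp Require Import all_boot all_order all_algebra.
From mathcomp Require Import complex.
From mathcomp Require Import all_classical all_reals all_analysis.
Set Implicit Arguments.
Unset Strict Implicit.
Unset Printing Implicit Defensive.
Import Order.TTheory GRing.Theory Num.Theory.
Import numFieldNormedType.Exports.
Local Open Scope ring_scope.
Local Open Scope classical_set_scope.

Section Defs.
Variable R : realType.
Local Notation C := R[i].
Local Notation mu := (@lebesgue_measure R).

Definition Cn (n : nat) (f : R -> R) : Prop :=
  (forall l x, (l < n)%N -> derivable (f^`(l)) x 1) /\ continuous (f^`(n)).

Definition test_function (phi : R -> R) : Prop :=
  (forall n, Cn n phi) /\ exists M : R, forall x, M < `|x| -> phi x = 0.

(* Elements of L^2(R; C) are represented by functions R -> R[i] subject to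
   [L2]; they are compared with [ae_equal], the equality of classes. *)
Definition ae_equal (u v : R -> C) : Prop := {ae mu, forall x, u x = v x}.

Definition L2norm (u : R -> C) : \bar R :=
  Lnorm mu 2%:E (fun x => (Normc.normc (u x))%:E).

Definition L2 (u : R -> C) : Prop :=
  [/\ measurable_fun setT (fun x => complex.Re (u x)),
      measurable_fun setT (fun x => complex.Im (u x)) &
      (L2norm u < +oo)%E].

Definition cintegral (u : R -> C) : C :=
  ((\int[mu]_x complex.Re (u x))%R +i* (\int[mu]_x complex.Im (u x))%R)%C.

Definition is_weak_derivative (u v : R -> C) : Prop :=
  forall phi : R -> R, test_function phi ->
    cintegral (fun x => u x * (derive1 phi x)%:C%C) =
    - cintegral (fun x => v x * (phi x)%:C%C).

(* Some weak derivative of [u] in L^2, unique up to a.e. equality; it has no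
   meaning when there is none, a case which [H2] excludes. *)
Definition weakD (u : R -> C) : R -> C :=
  xget (cst 0) [set v | L2 v /\ is_weak_derivative u v].

Definition H1 (u : R -> C) : Prop :=
  L2 u /\ exists v, L2 v /\ is_weak_derivative u v.

Definition H2 (u : R -> C) : Prop := H1 u /\ H1 (weakD u).

Definition Hdom (u : R -> C) : Prop :=
  H2 u /\ L2 (fun x => (x ^+ 2)%:C%C * u x).

Definition Hop (f : R -> R) (eps : R) (u : R -> C) : R -> C := fun x =>
  - weakD (weakD u) x + (x ^+ 2)%:C%C * u x
  + 'i%C / eps%:C%C * (f x)%:C%C * u x.

(* [S] is an everywhere defined inverse of the operator [T : Hdom -> L^2],
   modulo a.e. equality. *)
Definition is_inverse (T S : (R -> C) -> R -> C) : Prop :=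
  forall g, L2 g ->
    [/\ Hdom (S g), ae_equal (T (S g)) g &
        forall u, Hdom u -> ae_equal (T u) g -> ae_equal u (S g)].

Definition op_norm (S : (R -> C) -> R -> C) : \bar R :=
  ereal_sup [set L2norm (S g) | g in [set g | L2 g /\ (L2norm g <= 1)%E]].

(* The operator norm of T^-1. All inverses of [T] agree a.e., so the infimum
   is over at most one value; it is +oo when [T] is not invertible. *)
Definition inverse_norm (T : (R -> C) -> R -> C) : \bar R :=
  ereal_inf [set op_norm S | S in is_inverse T].

Definition Hshift (f : R -> R) (eps lambda : R) (u : R -> C) : R -> C :=
  fun x => Hop f eps u x - 'i%C * lambda%:C%C * u x.

Definition Psi (f : R -> R) (eps : R) : \bar R :=
  ((ereal_sup (range (fun lambda : R => inverse_norm (Hshift f eps lambda))))^-1)%E.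

End Defs.

(* Main.v *)
(** Put x0 = eps^(-1/(k+4)) and V = f / eps - lambda, so that
    H_eps - i lambda = -d^2 + x^2 + i V; the claim is that the supremum over
    lambda of the resolvent norm is comparable to x0^-2.

    Upper bound. The set of x with |x| <= x0 and |V x| < x0^2 is covered by a
    number of intervals of length O(1 / x0), the number being independent of
    lambda and eps: inside a compact set because the critical points of f are
    nondegenerate, outside because f' decays like |x|^-(k+1). Take chi = sgn V
    times a C^1 cutoff that vanishes on this cover and for |x| >= x0. Pairing
    (H_eps - i lambda) u = g with chi u bounds the mass of u where
    |V| >= x0^2. The mass in |x| >= x0 / 2 is controlled by the energy
    |u'|^2 + |x u|^2, and the mass on the short intervals by
    sup |u|^2 <= 2 |u| |u'|. Together x0^2 |u| <= C |g|. Surjectivity follows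
    from the continuity method, starting from a factored operator.

    Lower bound. For lambda = f(x0) / eps, a bump on [x0, x0 + 1/x0] satisfies
    |(H_eps - i lambda) u| <= C x0^2 |u|.

    Complex functions are split into real and imaginary parts, and functions in
    the domain are represented by absolutely continuous ones. *)
From HB Require Import structures.
From mathcomp Require Import all_boot all_order all_algebra.
From mathcomp Require Import complex ring lra.
From mathcomp Require Import all_classical all_reals all_analysis.
From mathcomp Require Import measurable_realfun.
Require Import Defs.
Set Implicit Arguments.
Unset Strict Implicit.
Unset Printing Implicit Defensive.
Import Order.TTheory GRing.Theory Num.Theory.
Import numFieldNormedType.Exports.
Local Open Scope ring_scope.
Local Open Scope classical_set_scope.

(** * Lebesgue integrals over the line *)

Section IntegralAPI.
Variable R : realType.
Local Notation mu := (@lebesgue_measure R).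
Implicit Types f g h : R -> R.

(** The quadratic form alone yields only |u| <= |g|, a bound independent of eps: its real part does
    not see the term i V, from which the gain x0^2 has to come. The multiplier chi makes V visible
    at the price of a commutator of size |chi'| |u| |u'|. Three costs then meet at one scale: the
    commutator with chi' = O(x0), the mass on intervals of length O(1 / x0), and the mass beyond x0
    / 2. Each is controlled through the energy |u'|^2 + |x u|^2 <= |g| |u|, so that x0^2 |u|^2 can
    absorb what remains. The scale is forced by the tail: over a length 1 / x0 near x0 the potential
    f / eps varies by about x0^-(k+2) / eps, which equals x0^2 exactly when x0^(k+4) = 1 / eps. The
    same identity makes the bump a quasi-mode. Existence of an inverse is a separate obligation:
    [inverse_norm] is an infimum over inverses, hence +oo if there is none, and an a priori estimate
    alone does not bound it from above. *)

Definition meas f := measurable_fun [set: R] f.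
Definition itg f := mu.-integrable [set: R] (EFin \o f).
Definition I f : R := Rintegral mu [set: R] f.

Lemma eqI f g : f =1 g -> I f = I g.
Proof. by move=> /funext ->. Qed.

Lemma eq_itg f g : f =1 g -> itg f -> itg g.
Proof. by move=> /funext ->. Qed.

Lemma itg_meas f : itg f -> meas f.
Proof. by move=> /measurable_int /measurable_EFinP. Qed.

Lemma itgD f g : itg f -> itg g -> itg (fun x => f x + g x).
Proof. by move=> hf hg; apply: (integrableD measurableT hf hg). Qed.

Lemma itgZ c f : itg f -> itg (fun x => c * f x).
Proof. by move=> hf; apply: (integrableZl measurableT c hf). Qed.

Lemma itgN f : itg f -> itg (fun x => - f x).
Proof. by move=> hf; apply: (integrableN hf). Qed.

Lemma itgB f g : itg f -> itg g -> itg (fun x => f x - g x).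
Proof. by move=> hf hg; apply: itgD => //; apply: itgN. Qed.

Lemma itg0 : itg (fun=> 0).
Proof. exact: integrable0. Qed.

Lemma itg_abs f : itg f -> itg (fun x => `|f x|).
Proof. by move=> hf; apply: (integrable_norm hf). Qed.

Lemma itg_le f g : meas f -> (forall x, `|f x| <= g x) -> itg g -> itg f.
Proof.
move=> mf le ig; apply: (le_integrable measurableT) ig.
- exact/measurable_EFinP.
- by move=> x _ /=; rewrite lee_fin (le_trans (le x))// ler_norm.
Qed.

Lemma ID f g : itg f -> itg g -> I (fun x => f x + g x) = I f + I g.
Proof. by move=> hf hg; apply: RintegralD. Qed.

Lemma IB f g : itg f -> itg g -> I (fun x => f x - g x) = I f - I g.
Proof. by move=> hf hg; apply: RintegralB. Qed.

Lemma IZ c f : itg f -> I (fun x => c * f x) = c * I f.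
Proof. by move=> hf; apply: RintegralZl. Qed.

Lemma IN f : itg f -> I (fun x => - f x) = - I f.
Proof.
by move=> hf; rewrite -mulN1r -IZ//; apply: eqI => x; rewrite mulN1r.
Qed.

Lemma I0 : I (fun=> 0) = 0.
Proof. by rewrite /I Rintegral_cst// mul0r. Qed.

Lemma I_ge0 f : (forall x, 0 <= f x) -> 0 <= I f.
Proof. by move=> h; apply: Rintegral_ge0. Qed.

Lemma I_le f g : itg f -> itg g -> (forall x, f x <= g x) -> I f <= I g.
Proof. by move=> hf hg h; apply: le_Rintegral. Qed.

Lemma I_abs f : itg f -> `|I f| <= I (fun x => `|f x|).
Proof. by move=> hf; apply: le_normr_Rintegral. Qed.

Lemma I_absle f g : meas f -> (forall x, `|f x| <= g x) -> itg g -> `|I f| <= I g.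
Proof.
move=> mf h ig; have If := itg_le mf h ig.
by apply: le_trans (I_abs If) _; apply: I_le => //; apply: itg_abs.
Qed.

Lemma ae_all (P : R -> Prop) : (forall x, P x) -> {ae mu, forall x, P x}.
Proof. move=> h; apply: (@filterS _ _ (ae_filter_ringOfSetsType mu) setT) => //.
exact: (@filterT _ _ (ae_filter_ringOfSetsType mu)). Qed.

Lemma ae_imp (P Q : R -> Prop) : {ae mu, forall x, P x} ->
  (forall x, P x -> Q x) -> {ae mu, forall x, Q x}.
Proof. by move=> hP h; exact: (@filterS _ _ (ae_filter_ringOfSetsType mu) _ _ h hP). Qed.

Lemma ae_imp2 (P1 P2 Q : R -> Prop) : {ae mu, forall x, P1 x} ->
  {ae mu, forall x, P2 x} -> (forall x, P1 x -> P2 x -> Q x) ->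
  {ae mu, forall x, Q x}.
Proof.
by move=> h1 h2 h; exact: (@filterS2 _ _ (ae_filter_ringOfSetsType mu) _ _ _ h h1 h2).
Qed.

Definition aeq f g := {ae mu, forall x, f x = g x}.

Lemma aeq_sym f g : aeq f g -> aeq g f.
Proof. by move=> h; apply: ae_imp h _ => x ->. Qed.

Lemma eq_aeq f g : f =1 g -> aeq f g.
Proof. exact: ae_all. Qed.

Lemma I_ae f g : meas f -> meas g -> aeq f g -> I f = I g.
Proof.
move=> mf mg h; rewrite /I /Rintegral; congr fine.
apply: ae_eq_integral => //; try exact/measurable_EFinP.
by apply: ae_imp h _ => x /= ->.
Qed.

Lemma itg_ae f g : itg f -> meas g -> aeq f g -> itg g.
Proof.
move=> /integrableP[mf If] mg h; apply/integrableP; split.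
  exact/measurable_EFinP.
rewrite (_ : (\int[mu]_x _)%E = (\int[mu]_x `|(EFin \o f) x|)%E) //.
apply: ae_eq_integral => //.
- by apply: measurableT_comp => //; apply/measurable_EFinP.
- exact: measurableT_comp.
- by apply: ae_imp h _ => x /= ->.
Qed.

Lemma measD f g : meas f -> meas g -> meas (fun x => f x + g x).
Proof. exact: measurable_funD. Qed.
Lemma measB f g : meas f -> meas g -> meas (fun x => f x - g x).
Proof. exact: measurable_funB. Qed.
Lemma measM f g : meas f -> meas g -> meas (fun x => f x * g x).
Proof. exact: measurable_funM. Qed.
Lemma measN f : meas f -> meas (fun x => - f x).
Proof. by move=> mf; exact: measurableT_comp. Qed.
Lemma meas_cst c : meas (fun=> c).
Proof. exact: measurable_cst. Qed.
Lemma measX f n : meas f -> meas (fun x => f x ^+ n).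
Proof. by move=> mf; exact: measurable_funX. Qed.
Lemma meas_abs f : meas f -> meas (fun x => `|f x|).
Proof. by move=> mf; exact: measurableT_comp. Qed.
Lemma meas_cont f : continuous f -> meas f.
Proof. exact: continuous_measurable_fun. Qed.
Lemma meas_id : meas (fun x => x).
Proof. exact: measurable_id. Qed.
Lemma meas_ind (A : set R) : measurable A -> meas (fun x => \1_A x).
Proof. by move=> mA; exact: measurable_indic. Qed.

Lemma I_eq0 f : (forall x, 0 <= f x) -> itg f -> I f = 0 -> aeq f (fun=> 0).
Proof.
move=> f0 If I0f; have := ae_eq_integral_abs mu (measurableT) (f := EFin \o f).
move=> /(_ (measurable_int mu If))[+ _].
have -> : (\int[mu]_x `|(EFin \o f) x| = \int[mu]_x (EFin \o f) x)%E.
  by apply: eq_integral => x _; rewrite /= ger0_norm.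
have fn := integrable_fin_num measurableT If.
rewrite -(fineK fn) => /(_ (congr1 EFin I0f)).
by move=> h; apply: ae_imp h _ => x /(_ Logic.I) [].
Qed.

Lemma measE f : meas f -> measurable_fun [set: R] (EFin \o f).
Proof. by move=> mf; apply/measurable_EFinP. Qed.

Lemma cvgE (u : nat -> R) (l : R) : u n @[n --> \oo] --> l ->
  (u n)%:E @[n --> \oo] --> l%:E.
Proof. by move=> h; apply: cvg_EFin => //; exact: nearW. Qed.

Lemma I_dct (f_ : nat -> R -> R) f g :
  (forall n, meas (f_ n)) -> meas f ->
  {ae mu, forall x, f_ n x @[n --> \oo] --> f x} ->
  itg g -> (forall n x, `|f_ n x| <= g x) ->
  itg f /\ I (f_ n) @[n --> \oo] --> I f.
Proof.
move=> mf_ mf cv ig le.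
have [|||||i1 _ c3] := @dominated_convergence _ _ R mu setT measurableT
  (fun n => EFin \o f_ n) (EFin \o f) (EFin \o g).
- by move=> n; exact: measE (mf_ n).
- exact: measE mf.
- apply: ae_imp cv _ => x cv _ /=; exact: cvgE cv.
- exact: ig.
- by apply: ae_all => x n _ /=; rewrite lee_fin.
split => //; rewrite /I /Rintegral.
by apply: fine_cvg; rewrite fineK//; exact: integrable_fin_num.
Qed.

(** Serves to pass from bounds on truncated integrals to the whole line. Integrability of the limit
    is part of the conclusion, hence Fatou rather than dominated convergence. *)
Lemma itg_fatou (f_ : nat -> R -> R) f C :
  (forall n x, 0 <= f_ n x) -> (forall n, itg (f_ n)) -> (forall n, I (f_ n) <= C) ->
  (forall x, f_ n x @[n --> \oo] --> f x) ->
  itg f /\ I f <= C.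
Proof.
move=> p0 i_ le cv.
have mf : meas f by apply: measurable_fun_cvg (fun x _ => cv x) => n; exact: itg_meas.
have f0 x : 0 <= f x.
  rewrite -(cvg_lim (@Rhausdorff R) (cv x)); apply: limr_ge.
    by apply/cvg_ex; exists (f x); exact: cv.
  by apply: nearW => n; exact: p0.
have le2 : (\int[mu]_x (f x)%:E <= C%:E)%E.
  have -> : (\int[mu]_x (f x)%:E = \int[mu]_x limn_einf (fun n => (f_ n x)%:E))%E.
    apply: eq_integral => x _; rewrite limn_einf_lim.
    have cvx : (f_ n x)%:E @[n --> \oo] --> (f x)%:E by exact: cvgE (cv x).
    apply/esym/cvg_lim => //.
    have := cvg_einfs cvx; exact.
  apply: (@le_trans _ _ (limn_einf (fun n => \int[mu]_x (f_ n x)%:E)%E)).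
    apply: (@fatou _ _ R mu setT measurableT (fun n => EFin \o f_ n)).
      by move=> n; apply: measE; exact: itg_meas.
    by move=> n x _; rewrite /= lee_fin.
  rewrite limn_einf_lim; apply: lime_le; first exact: is_cvg_einfs.
  (* The infimum over the indices from n on is at most its first term. *)
  apply: nearW => n; apply: (@le_trans _ _ (\int[mu]_x (f_ n x)%:E)%E).
    apply: ge_ereal_inf; exists (\int[mu]_x (f_ n x)%:E)%E => //.
    by exists n => //=.
  have fn := integrable_fin_num measurableT (i_ n).
  by rewrite -(fineK fn) lee_fin; exact: le.
have If : itg f.
  apply/integrableP; split; first exact/measurable_EFinP.
  under eq_integral do rewrite /= ger0_norm//.
  exact: le_lt_trans le2 (ltry _).
split => //; have fn := integrable_fin_num measurableT If.
by rewrite -lee_fin (fineK fn).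
Qed.

End IntegralAPI.

(** * Absolute continuity *)

Section AbsolutelyContinuous.
Variable R : realType.
Local Notation mu := (@lebesgue_measure R).
Implicit Types (f g h k F G : R -> R) (a b c x y t : R).

(** Half-open, so that adjacent intervals add up pointwise, and real-valued, so that integrals over
    intervals become integrals over the line with a factor. *)
Definition ind a b x : R := ((a < x) && (x <= b))%:R.

Lemma indE a b : ind a b = (fun x => \1_`]a, b] x).
Proof. by apply/funext => x; rewrite indicE /ind mem_setE in_itv. Qed.

Lemma meas_indab a b : meas (ind a b).
Proof. by rewrite indE; exact: meas_ind. Qed.

Lemma itg_indab a b : itg (ind a b).
Proof. by rewrite indE; exact: (integrable_indic_itv a b false false). Qed.

Lemma ind_ge0 a b x : 0 <= ind a b x. Proof. exact: ler0n. Qed.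
Lemma ind_le1 a b x : ind a b x <= 1. Proof. by rewrite /ind; case: (_ && _). Qed.

Lemma I_indab a b : a <= b -> I (ind a b) = b - a.
Proof.
move=> ab; rewrite indE /I /Rintegral integral_indic// setIT.
rewrite [X in fine X](lebesgue_measure_itv (Interval (BRight a) (BRight b)))/= lte_fin; case: ltgtP ab => // -> _ /=.
by rewrite subrr.
Qed.

Lemma ind_split a b c x : a <= b -> b <= c -> ind a c x = ind a b x + ind b c x.
Proof.
move=> ab bc; rewrite /ind.
case: (ltP a x); case: (ltP b x); case: (leP x b); case: (leP x c) => //=; lra.
Qed.

Lemma ind_empty a b x : b <= a -> ind a b x = 0.
Proof. by rewrite /ind => ba; case: (ltP a x); case: (leP x b) => //=; lra. Qed.

Lemma restrict_ind a b h : (fun x => ind a b x * h x) = h \_ `]a, b].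
Proof.
apply/funext => x; rewrite /patch mem_setE in_itv /= /ind.
by case: ifP => _; rewrite ?mul1r ?mul0r.
Qed.

Lemma itg_ind a b h : itg (fun x => ind a b x * h x) <-> mu.-integrable `]a, b] (EFin \o h).
Proof.
rewrite /itg restrict_ind -restrict_EFin.
by apply: iff_sym; exact: integrable_mkcond.
Qed.

Definition loc_itg h := meas h /\ forall a b, itg (fun x => ind a b x * h x).

Lemma loc_integrable a b h : loc_itg h -> mu.-integrable `[a, b] (EFin \o h).
Proof.
move=> [mh /(_ (a - 1) b) /itg_ind H].
apply: integrableS H => // x /=; rewrite !in_itv /= => /andP[ax ->]; rewrite andbT; lra.
Qed.

Lemma I_ind a b h : loc_itg h ->
  I (fun x => ind a b x * h x) = \int[mu]_(x in `[a, b]) h x.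
Proof.
move=> lh; rewrite /I restrict_ind -Rintegral_mkcond Rintegral_itv_obnd_cbnd//.
by apply/itg_ind; case: lh.
Qed.

(* Local absolute continuity of [F] with density [h]; Sobolev functions are
   handled through such representatives. *)
Definition AC F h := loc_itg h /\
  forall a b, a <= b -> F b - F a = I (fun x => ind a b x * h x).

Lemma AC_meas' F h : AC F h -> meas h. Proof. by case=> -[]. Qed.
Lemma AC_itg F h a b : AC F h -> itg (fun x => ind a b x * h x).
Proof. by case=> -[_ +] _; apply. Qed.

(** To the right of x - 1, F is the constant F (x - 1) plus the integral of h from x - 1, which is
    continuous in its upper end. *)
Lemma AC_cont F h : AC F h -> continuous F.
Proof.
move=> [lh hF] x.
have cx : {within `[x - 1, x + 1], continuous (fun y => parameterized_integral mu (x - 1) y h)}.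
  by apply: parameterized_integral_continuous; [lra|exact: loc_integrable].
have xin : x \in `](x - 1), (x + 1)[%R by rewrite in_itv /=; apply/andP; split; lra.
have c1 : {for x, continuous (fun y => parameterized_integral mu (x - 1) y h)}.
  have /continuous_within_itvP[|+ _ _] := cx; first lra.
  exact.
have E y : x - 1 <= y -> F y = F (x - 1) + parameterized_integral mu (x - 1) y h.
  by move=> xy; rewrite /parameterized_integral -I_ind// -hF//; ring.
have c2 : {for x, continuous (fun y => F (x - 1) + parameterized_integral mu (x - 1) y h)}.
  by apply: continuousD => //; exact: cst_continuous.
rewrite /continuous_at (E x); last lra.
apply: cvg_trans c2; apply: near_eq_cvg; near=> y; apply/esym/E.
near: y; apply: lt_le_nbhsr; lra.
Unshelve. all: by end_near. Qed.

Lemma AC_meas F h : AC F h -> meas F.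
Proof. by move=> /AC_cont; exact: meas_cont. Qed.

Lemma AC_bound F h a b : AC F h -> exists M : R, 0 <= M /\ forall x, a <= x -> x <= b -> `|F x| <= M.
Proof.
move=> AF; have Ih := itg_abs (AC_itg a b AF).
exists (`|F a| + I (fun x => `|ind a b x * h x|)); split.
  by rewrite addr_ge0// I_ge0.
move=> x ax xb; have -> : F x = F a + (F x - F a) by ring.
apply: le_trans (ler_normD _ _) _; rewrite lerD2l AF.2//.
apply: I_absle => // [|y]; first exact: itg_meas (AC_itg _ _ AF).
rewrite !normrM ler_wpM2r// !ger0_norm ?ind_ge0// (ind_split _ ax xb).
by rewrite lerDl ind_ge0.
Qed.

Lemma loc_itgM F h k : AC F h -> loc_itg k -> loc_itg (fun x => F x * k x).
Proof.
move=> AF [mk Lk]; split; first exact: measM (AC_meas AF) mk.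
move=> a b; have [M [M0 hM]] := AC_bound a b AF.
apply: itg_le (itgZ M (itg_abs (Lk a b))).
  by apply: measM (meas_indab _ _) _; exact: measM (AC_meas AF) mk.
move=> x; rewrite !normrM /ind; case: (boolP (_ && _)) => [/andP[ax xb]|_].
  by rewrite normr1 !mul1r ler_wpM2r// hM// ltW.
by rewrite normr0 !mul0r mulr0.
Qed.

Lemma loc_itgD h k : loc_itg h -> loc_itg k -> loc_itg (fun x => h x + k x).
Proof.
move=> [mh Lh] [mk Lk]; split; first exact: measD.
by move=> a b; apply: eq_itg (itgD (Lh a b) (Lk a b)) => x; rewrite mulrDr.
Qed.

Lemma loc_itgZ c h : loc_itg h -> loc_itg (fun x => c * h x).
Proof.
move=> [mh Lh]; split; first exact: measM (meas_cst c) mh.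
by move=> a b; apply: eq_itg (itgZ c (Lh a b)) => x; rewrite mulrCA.
Qed.

Lemma ACD F h G k : AC F h -> AC G k -> AC (fun x => F x + G x) (fun x => h x + k x).
Proof.
move=> AF AG; split; first by apply: loc_itgD; [case: AF|case: AG].
move=> a b ab; rewrite opprD addrACA AF.2// AG.2// -ID.
- by apply: eqI => x; rewrite mulrDr.
- exact: AC_itg AF.
- exact: AC_itg AG.
Qed.

Lemma ACZ c F h : AC F h -> AC (fun x => c * F x) (fun x => c * h x).
Proof.
move=> AF; split; first by apply: loc_itgZ; case: AF.
move=> a b ab; rewrite -mulrBr AF.2// -IZ; last exact: AC_itg AF.
by apply: eqI => x; rewrite mulrCA.
Qed.

Lemma ACN F h : AC F h -> AC (fun x => - F x) (fun x => - h x).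
Proof.
move=> /(ACZ (- 1)) H; under eq_fun do rewrite -mulN1r.
by under [X in AC _ X]eq_fun do rewrite -mulN1r.
Qed.

Lemma ACB F h G k : AC F h -> AC G k -> AC (fun x => F x - G x) (fun x => h x - k x).
Proof. by move=> AF AG; apply: ACD AF (ACN AG). Qed.

Lemma eq_AC F h F' h' : F =1 F' -> h =1 h' -> AC F h -> AC F' h'.
Proof. by move=> /funext -> /funext ->. Qed.

Lemma AC_ae F h h' : meas h' -> aeq h h' -> AC F h -> AC F h'.
Proof.
move=> mh' e AF.
have e' a b : aeq (fun x => ind a b x * h x) (fun x => ind a b x * h' x).
  by apply: ae_imp e _ => x ->.
have m' a b : meas (fun x => ind a b x * h' x) by apply: measM => //; exact: meas_indab.
split; first by split => // a b; exact: itg_ae (AC_itg a b AF) (m' a b) (e' a b).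
move=> a b ab; rewrite AF.2//; apply: I_ae => //; exact: itg_meas (AC_itg _ _ AF).
Qed.

Lemma cont_loc_itg h : continuous h -> loc_itg h.
Proof.
move=> ch; split; first exact: meas_cont.
move=> a b; apply/itg_ind.
have H : mu.-integrable `[a, b] (EFin \o h).
  apply: continuous_compact_integrable; first exact: segment_compact.
  exact: continuous_subspaceT.
by apply: integrableS H => //; apply: subset_itvr; rewrite bnd_simp.
Qed.

Lemma C1_AC F h : (forall x, is_derive x 1 F (h x)) -> continuous h -> AC F h.
Proof.
move=> dF ch; have lh := cont_loc_itg ch; split => // a b; rewrite le_eqVlt => /orP[/eqP ->|ab].
  rewrite subrr (@eqI _ _ (fun=> 0)) ?I0// => x.
  by rewrite ind_empty ?mul0r.
rewrite I_ind// /Rintegral.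
have cF : continuous F.
  by move=> x; apply: differentiable_continuous; apply/derivable1_diffP; apply: ex_derive.
rewrite (@continuous_FTC2 _ h F a b)//.
- exact: continuous_subspaceT.
- split => [x _| |]; first exact: ex_derive.
    exact: cvg_at_right_filter (cF a).
  exact: cvg_at_left_filter (cF b).
- by move=> x _; rewrite derive1E; exact: derive_val.
Qed.

Lemma ae_ne c : {ae mu, forall x, x <> c}.
Proof.
exists [set c]; split => //; first exact: lebesgue_measure_set1.
by move=> x /= /contrapT.
Qed.

Let J h a b := I (fun x => ind a b x * h x).

Let J_split h a b c : loc_itg h -> a <= b -> b <= c -> J h a c = J h a b + J h b c.
Proof.
move=> [_ L] ab bc; rewrite /J -ID//; apply: eqI => x.
by rewrite -mulrDl -ind_split.
Qed.

Let J_empty h a b : b <= a -> J h a b = 0.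
Proof.
move=> ba; rewrite /J (@eqI _ _ (fun=> 0)) ?I0// => x.
by rewrite ind_empty ?mul0r.
Qed.

Lemma AC_exists h : loc_itg h -> exists F, AC F h.
Proof.
(* The signed integral from 0 to x: one of the two terms vanishes, according to the sign of x. *)
move=> lh; exists (fun x => J h 0 x - J h x 0); split => // a b ab; rewrite -/(J h a b).
have [a0|a0] := leP 0 a; have [b0|b0] := leP 0 b.
- by rewrite (@J_empty h _ _ b0) (@J_empty h _ _ a0) (J_split lh a0 ab); ring.
- lra.
- by rewrite (@J_empty h _ _ b0) (@J_empty h _ _ (ltW a0)) (J_split lh (ltW a0) b0); ring.
- by rewrite (@J_empty h _ _ (ltW b0)) (@J_empty h _ _ (ltW a0)) (J_split lh ab (ltW b0)); ring.
Qed.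

End AbsolutelyContinuous.

(** * Product rule and integrals of derivatives over the line *)

Section ACProduct.
Variable R : realType.
Local Notation mu := (@lebesgue_measure R).
Implicit Types (f g h k F G : R -> R) (a b c x y t : R).

(** Both sides are the double integral of H s K t over the triangle s < t. This is the source of the
    product rule [ACM]. *)
Lemma fubini_triangle (H K : R -> R) : itg H -> itg K ->
  I (fun s => H s * I (fun t => if s < t then K t else 0)) =
  I (fun t => K t * I (fun s => if s < t then H s else 0)).
Proof.
move=> iH iK.
have mif (L : R -> R) (p : R -> bool) : measurable_fun setT p -> itg L ->
    itg (fun t => if p t then L t else 0).
  move=> mp iL; apply: itg_le (itg_abs iL).
    by apply: measurable_fun_ifT => //; exact: itg_meas.
  by move=> x; case: (p x) => //; rewrite normr0.
have mlt1 s : measurable_fun setT (fun t : R => s < t).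
  by apply: measurable_fun_ltr => //; exact: measurable_cst.
have mlt2 t : measurable_fun setT (fun s : R => s < t).
  by apply: measurable_fun_ltr => //; exact: measurable_cst.
pose f (z : R * R) : \bar R := (if z.1 < z.2 then H z.1 * K z.2 else 0)%:E.
have mf : measurable_fun setT f.
  apply/measurable_EFinP; apply: measurable_fun_ifT.
  - by apply: measurable_fun_ltr; [exact: measurable_fst|exact: measurable_snd].
  - apply: measurable_funM.
      by apply: measurableT_comp (itg_meas iH) _; exact: measurable_fst.
    by apply: measurableT_comp (itg_meas iK) _; exact: measurable_snd.
  - exact: measurable_cst.
have fin (L : R -> R) : itg L -> (\int[mu]_x (L x)%:E)%E = (I L)%:E.
  by move=> iL; rewrite /I /Rintegral fineK//; exact: integrable_fin_num.
have If : (mu \x mu)%E.-integrable setT f.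
  have /(_ mf)[_] := integrable12ltyP mu mu (f := f); apply.
  apply: (@le_lt_trans _ _ (\int[mu]_s ((`|H s| * I (fun t => `|K t|))%:E))%E); last first.
    under eq_fun do rewrite mulrC.
    by rewrite fin ?ltry//; apply: itgZ; exact: itg_abs.
  apply: ge0_le_integral => //.
  - by move=> s _; apply: integral_ge0.
  - apply: (@measurable_fun_fubini_tonelli_F _ _ _ _ R mu (abse \o f)).
      exact: measurableT_comp.
    by move=> z; exact: abse_ge0.
  - by apply: measE; apply: measM; [apply: meas_abs; exact: itg_meas|exact: meas_cst].
  move=> s _; rewrite -IZ; last exact: itg_abs.
  rewrite -fin; last by apply: itgZ; exact: itg_abs.
  apply: ge0_le_integral => //.
  - apply: measurableT_comp => //; apply: measE; apply: measurable_fun_ifT.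
    + exact: mlt1.
    + exact: (measM (meas_cst (H s)) (itg_meas iK)).
    + exact: measurable_cst.
  - exact: (measE (measM (meas_cst `|H s|) (meas_abs (itg_meas iK)))).
  - by move=> t _; rewrite /f /= lee_fin; case: ifP => _; rewrite ?normrM// normr0 mulr_ge0.
have Fu := Fubini If.
apply: (congr1 fine).
transitivity (\int[mu]_s \int[mu]_t f (s, t))%E.
  apply: eq_integral => s _.
  rewrite /= -IZ -?fin//; last 2 first.
  - by apply: itgZ; exact: mif.
  - exact: mif.
  by apply: eq_integral => t _; rewrite /f /=; case: ifP => _; rewrite ?mulr0.
rewrite Fu; apply: eq_integral => t _.
rewrite /= -IZ -?fin//; last 2 first.
- by apply: itgZ; exact: mif.
- exact: mif.
by apply: eq_integral => s _; rewrite /f /=; case: ifP => _; rewrite ?mulr0// mulrC.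
Qed.

(** With the two densities cut to (a, b], the inner integrals of [fubini_triangle] are G b - G s and
    F t - F a, so Fubini becomes integration by parts. *)
Lemma ACM F h G k : AC F h -> AC G k ->
  AC (fun x => F x * G x) (fun x => h x * G x + F x * k x).
Proof.
move=> AF AG.
have lh : loc_itg (fun x => h x * G x).
  case: AF => lh _; have [m L] := loc_itgM AG lh; split.
    by move: m; under eq_fun do rewrite mulrC.
  by move=> a b; apply: eq_itg (L a b) => x; rewrite (mulrC (h x)).
have lk : loc_itg (fun x => F x * k x) by apply: loc_itgM AF _; case: AG.
split; first exact: loc_itgD.
move=> a b ab.
have iH := AC_itg a b AF; have iK := AC_itg a b AG.
have := fubini_triangle iH iK.
have -> : I (fun s => ind a b s * h s * I (fun t => if s < t then ind a b t * k t else 0))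
    = I (fun s => G b * (ind a b s * h s) - ind a b s * (h s * G s)).
  apply: eqI => s; rewrite {1 3 4}/ind.
  case: (boolP (_ && _)) => [/andP[as_ sb]|_]; last by rewrite !mul0r mulr0 subrr.
  rewrite (@eqI _ _ (fun t => ind s b t * k t)).
    by rewrite -AG.2//; ring.
  move=> t; rewrite /ind; case: ifPn => st /=; last by rewrite mul0r.
  by rewrite (lt_trans as_ st).
have -> : I (fun s => ind a b s * k s * I (fun t => if t < s then ind a b t * h t else 0))
    = I (fun s => ind a b s * (F s * k s) - F a * (ind a b s * k s)).
  apply: eqI => t; rewrite {1 3 4}/ind.
  case: (boolP (_ && _)) => [/andP[at_ tb]|_]; last by rewrite !mul0r mulr0 subrr.
  (* The triangle is strict while [ind] includes its right end: the integrands differ at the single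
     point s = t. *)
  rewrite (@I_ae _ _ (fun s => ind a t s * h s)).
  - by rewrite -AF.2 ?ltW//; ring.
  - apply: measurable_fun_ifT; last exact: meas_cst.
      by apply: measurable_fun_ltr => //; exact: measurable_cst.
    exact: itg_meas iH.
  - by apply: itg_meas (AC_itg _ _ AF).
  - apply: ae_imp (@ae_ne _ t) _ => s st; rewrite /ind.
    case: (ltgtP s t) st => // [st|ts] _; rewrite ?(le_trans (ltW st) tb)//.
    by rewrite andbF mul0r.
rewrite IB ?IB; last 4 first.
- exact: lk.2.
- exact: itgZ.
- exact: itgZ.
- exact: lh.2.
rewrite !IZ// -AF.2// -AG.2// => E.
rewrite (@eqI _ _ (fun x => ind a b x * (h x * G x) + ind a b x * (F x * k x))); last first.
  by move=> x; rewrite mulrDr.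
rewrite ID; [|exact: lh.2|exact: lk.2].
lra.
Qed.

Lemma I_tendsto f (a b : nat -> R) : itg f ->
  (forall n, a n <= - n%:R) -> (forall n, n%:R <= b n) ->
  I (fun x => ind (a n) (b n) x * f x) @[n --> \oo] --> I f.
Proof.
move=> fi an bn; apply: (I_dct (g := fun x => `|f x|) _ _ _ _ _).2.
- by move=> n; apply: measM; [exact: meas_indab|exact: itg_meas].
- exact: itg_meas.
- apply: ae_all => x; apply: cvg_near_cst.
  near=> n; have xn : `|x| < n%:R by near: n; exact: nbhs_infty_gtr.
  move: xn; rewrite /ind ltr_norml => /andP[h1 h2].
  by rewrite (le_lt_trans (an n) h1) (le_trans (ltW h2) (bn n)) mul1r.
- exact: itg_abs.
- by move=> n x; rewrite normrM ger0_norm ?ind_ge0// ler_piMl// ind_le1.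
Unshelve. all: by end_near. Qed.

Lemma itg_bdd_ind f C : (forall x, 0 <= f x) -> loc_itg f ->
  (forall n : nat, I (fun x => ind (- n%:R) n%:R x * f x) <= C) -> itg f /\ I f <= C.
Proof.
move=> f0 [mf lf] le; apply: itg_fatou le _.
- by move=> n x; rewrite mulr_ge0 ?ind_ge0.
- by move=> n; exact: lf.
move=> x; apply: cvg_near_cst.
near=> n; have xn : `|x| < n%:R by near: n; exact: nbhs_infty_gtr.
by move: xn; rewrite /ind ltr_norml => /andP[-> /ltW ->]; rewrite mul1r.
Unshelve. all: by end_near. Qed.

(** Chebyshev: a window longer than the integral of |f| divided by e contains a point with |f| < e.
    Its length N does not depend on c, so such points exist arbitrarily far out in both
    directions. *)
Lemma itg_small f (e : R) : itg f -> 0 < e ->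
  exists N : R, forall c, exists y, [/\ c < y, y <= c + N & `|f y| < e].
Proof.
move=> fi e0; set A := I (fun x => `|f x|) / e.
have A0 : 0 <= A by rewrite divr_ge0 ?I_ge0// ltW.
exists (A + 1) => c; apply: contrapT => /forallNP H.
have big y : c < y -> y <= c + (A + 1) -> e <= `|f y|.
  by move=> h1 h2; rewrite leNgt; apply/negP => h3; apply: (H y).
have K : I (fun x => e * ind c (c + (A + 1)) x) <= I (fun x => `|f x|).
  apply: I_le; [exact: itgZ (itg_indab _ _)|exact: itg_abs|].
  move=> x; rewrite /ind; case: (boolP (_ && _)) => [/andP[cx xb]|_].
    by rewrite mulr1 big.
  by rewrite mulr0.
move: K; rewrite IZ; last exact: itg_indab.
rewrite I_indab; last by rewrite lerDl; lra.
rewrite mulrC -ler_pdivlMr// -/A; lra.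
Qed.

(** Compare F x with the value at a point to the right where F is small, which [itg_small]
    provides. *)
Lemma AC_le_int F h : AC F h -> itg F -> itg h -> forall x, F x <= I (fun y => `|h y|).
Proof.
move=> AF iF ih x; apply/ler_addgt0Pr => e e0.
have [N /(_ x)[y [/ltW xy _ Fy]]] := itg_small iF e0.
have -> : F x = F y - (F y - F x) by ring.
rewrite AF.2// addrC lerD//; last by rewrite (le_trans (ler_norm _))// ltW.
apply: le_trans (ler_norm _) _; rewrite normrN.
apply: I_absle (itg_abs ih); first exact: itg_meas (AC_itg _ _ AF).
by move=> z; rewrite normrM ger0_norm ?ind_ge0// ler_piMl// ind_le1.
Qed.

(** No decay of F is assumed: [itg_small] supplies endpoints going to -oo and +oo at which |F| < e /
    2, and the integral of h between them is at most e in modulus. *)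
Lemma I_deriv0 F h : AC F h -> itg F -> itg h -> I h = 0.
Proof.
move=> AF iF ih; apply/eqP; rewrite -normr_le0; apply/ler_addgt0Pr => e e0.
rewrite add0r; have [N HN] := itg_small iF (divr_gt0 e0 (ltr0n R 2)).
pose a n := xget 0 [set y : R | y <= - n%:R /\ `|F y| < e / 2].
pose b n := xget 0 [set y : R | n%:R <= y /\ `|F y| < e / 2].
have aP n : a n <= - n%:R /\ `|F (a n)| < e / 2.
  apply: (xgetPex 0 (P := [set y : R | y <= - n%:R /\ `|F y| < e / 2])).
  have [y [_ h1 h2]] := HN (- n%:R - N); exists y; split => //.
  by apply: le_trans h1 _; rewrite subrK.
have bP n : n%:R <= b n /\ `|F (b n)| < e / 2.
  apply: (xgetPex 0 (P := [set y : R | n%:R <= y /\ `|F y| < e / 2])).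
  by have [y [/ltW h1 _ h2]] := HN n%:R; exists y.
have cv := I_tendsto ih (fun n => (aP n).1) (fun n => (bP n).1).
have cv' := cvg_norm (FF := eventually_filter) cv.
rewrite -(cvg_lim (@Rhausdorff R) cv'); apply: limr_le.
  by apply/cvg_ex; eexists; exact: cv'.
apply: nearW => n; have ab : a n <= b n.
  apply: le_trans (aP n).1 _; apply: le_trans (bP n).1.
  by rewrite (@le_trans _ _ 0)// ?ler0n// oppr_le0 ler0n.
rewrite -AF.2// (le_trans (ler_normB _ _))//.
by have [_ h1] := aP n; have [_ h2] := bP n; lra.
Qed.

End ACProduct.

(** * Square integrable functions and the energy estimate *)

Section SquareIntegrable.
Variable R : realType.
Implicit Types (f g h k F G a b P Q : R -> R) (c x y t : R).

Definition L2r f := meas f /\ itg (fun x => f x ^+ 2).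

Lemma eq_L2 f g : f =1 g -> L2r f -> L2r g.
Proof. by move=> /funext ->. Qed.

Lemma L2_le c f g : meas f -> (forall x, f x ^+ 2 <= c * g x ^+ 2) -> L2r g -> L2r f.
Proof.
move=> mf le [mg ig]; split => //.
apply: itg_le (itgZ c ig); first exact: measX.
by move=> x; rewrite ger0_norm ?sqr_ge0.
Qed.

Lemma L2_le2 f g h : meas f -> (forall x, f x ^+ 2 <= g x ^+ 2 + h x ^+ 2) ->
  L2r g -> L2r h -> L2r f.
Proof.
move=> mf le [mg ig] [mh ih]; split => //.
apply: itg_le (itgD ig ih); first exact: measX.
by move=> x; rewrite ger0_norm ?sqr_ge0.
Qed.

Lemma L2_mul f g : L2r f -> L2r g -> itg (fun x => f x * g x).
Proof.
move=> [mf jf] [mg jg]; apply: itg_le (itgD jf jg); first exact: measM.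
move=> x; rewrite normrM -[f x ^+ 2]real_normK ?num_real// -[g x ^+ 2]real_normK ?num_real//.
have := sqr_ge0 (`|f x| - `|g x|); have := sqr_ge0 (`|f x| + `|g x|); nra.
Qed.

Lemma L2Z c f : L2r f -> L2r (fun x => c * f x).
Proof.
move=> Lf; apply: (L2_le (c := c ^+ 2)) (Lf); first exact: measM (meas_cst c) Lf.1.
by move=> x; rewrite exprMn.
Qed.

Lemma L2N f : L2r f -> L2r (fun x => - f x).
Proof.
move=> Lf; apply: (L2_le (c := 1)) (Lf); first exact: measN Lf.1.
by move=> x; rewrite sqrrN mul1r.
Qed.

Lemma L2D f g : L2r f -> L2r g -> L2r (fun x => f x + g x).
Proof.
move=> Lf Lg; apply: L2_le2 (L2Z 2 Lf) (L2Z 2 Lg); first exact: measD Lf.1 Lg.1.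
by move=> x; have := sqr_ge0 (f x - g x); nra.
Qed.

Lemma L2B f g : L2r f -> L2r g -> L2r (fun x => f x - g x).
Proof. by move=> Lf /L2N; exact: L2D. Qed.

Lemma L2_bounded M h f : meas h -> (forall x, `|h x| <= M) -> L2r f ->
  L2r (fun x => h x * f x).
Proof.
move=> mh hM Lf; apply: (L2_le (c := M ^+ 2)) (Lf); first exact: measM mh Lf.1.
move=> x; rewrite exprMn ler_wpM2r ?sqr_ge0// -real_normK ?num_real//.
by rewrite ler_sqr ?nnegrE// (le_trans (normr_ge0 _) (hM x)).
Qed.

Lemma L2_ae f g : meas g -> aeq f g -> L2r f -> L2r g.
Proof.
move=> mg e [mf jf]; split => //; apply: itg_ae jf (measX 2 mg) _.
by apply: ae_imp e _ => x ->.
Qed.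

Lemma I_sqr_eq0 f : L2r f -> I (fun x => f x ^+ 2) <= 0 -> aeq f (fun=> 0).
Proof.
move=> [mf jf] h; apply: ae_imp (I_eq0 (fun x => sqr_ge0 (f x)) jf _) _.
  by apply/eqP; rewrite eq_le h I_ge0// => x; exact: sqr_ge0.
by move=> x /eqP; rewrite sqrf_eq0 => /eqP.
Qed.

Lemma ibp a a1 b b1 : AC a a1 -> AC b b1 -> L2r a -> L2r a1 -> L2r b -> L2r b1 ->
  I (fun x => a x * b1 x) = - I (fun x => a1 x * b x).
Proof.
move=> Aa Ab La La1 Lb Lb1.
have := I_deriv0 (ACM Aa Ab) (L2_mul La Lb) (itgD (L2_mul La1 Lb) (L2_mul La Lb1)).
by rewrite ID; [lra|exact: L2_mul|exact: L2_mul].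
Qed.

Lemma is_derive_AC_id : AC (fun x : R => x) (fun=> 1).
Proof. by apply: C1_AC; exact: cst_continuous. Qed.

(* Domain of the harmonic oscillator, with the continuous representatives. *)
Definition H2w a a1 a2 := [/\ AC a a1, AC a1 a2, L2r a, L2r a1 &
  L2r a2 /\ L2r (fun x => x ^+ 2 * a x)].

Lemma H2w_x a a1 a2 : H2w a a1 a2 -> L2r (fun x => x * a x).
Proof.
move=> [Aa _ La _ [_ Lx]]; apply: L2_le2 La Lx.
  by apply: measM (AC_meas Aa); exact: meas_id.
move=> x; rewrite !exprMn; have := sqr_ge0 (x ^+ 2 - 1).
have := sqr_ge0 (a x); nra.
Qed.

Lemma H2w_lin c d a a1 a2 b b1 b2 : H2w a a1 a2 -> H2w b b1 b2 ->
  H2w (fun x => c * a x + d * b x) (fun x => c * a1 x + d * b1 x)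
      (fun x => c * a2 x + d * b2 x).
Proof.
move=> [A1 A2 L1 L2 [L3 L4]] [B1 B2 M1 M2 [M3 M4]]; split.
- by apply: ACD; exact: ACZ.
- by apply: ACD; exact: ACZ.
- by apply: L2D; exact: L2Z.
- by apply: L2D; exact: L2Z.
split; first by apply: L2D; exact: L2Z.
have -> : (fun x => x ^+ 2 * (c * a x + d * b x)) =
    (fun x => c * (x ^+ 2 * a x) + d * (x ^+ 2 * b x)).
  by apply/funext => x; ring.
by apply: L2D; exact: L2Z.
Qed.

(** The derivative of x a^2 has integral 0, so the integral of a^2 is that of - 2 x a a'. This is
    the bottom of the spectrum of the harmonic oscillator. *)
Lemma H2w_uncertainty a a1 a2 : H2w a a1 a2 ->
  I (fun x => a x ^+ 2) <= I (fun x => a1 x ^+ 2) + I (fun x => (x * a x) ^+ 2).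
Proof.
move=> Ha; have Lx := H2w_x Ha; case: Ha => Aa _ La La1 [_ Lx2].
have Axa := ACM is_derive_AC_id (ACM Aa Aa).
have i1 : itg (fun x => x * (a x * a x)).
  by apply: eq_itg (L2_mul Lx La) => x; ring.
have i2 : itg (fun x => 1 * (a x * a x) + x * (a1 x * a x + a x * a1 x)).
  apply: eq_itg (itgD (L2_mul La La) (itgZ 2 (L2_mul Lx La1))) => x; ring.
have := I_deriv0 Axa i1 i2.
rewrite (@eqI _ _ (fun x => a x ^+ 2 + 2 * (x * a x * a1 x))); last by move=> x; ring.
rewrite ID; [|exact: La.2|by apply: itgZ; exact: L2_mul].
move=> /eqP; rewrite addr_eq0 => /eqP ->; rewrite -IN; last by apply: itgZ; exact: L2_mul.
rewrite -ID; [|exact: La1.2|exact: Lx.2].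
apply: I_le; [by apply: itgN; apply: itgZ; exact: L2_mul|by apply: itgD; [exact: La1.2|exact: Lx.2]|].
by move=> x; have := sqr_ge0 (a1 x + x * a x); nra.
Qed.

(* Real part of (-d^2/dx^2 + x^2 + P + iQ)(a + ib), where [a2 = a'']; the
   imaginary part is [opr P (-Q) b b2 a]. For H_eps - i lambda, P = 0 and
   Q = f / eps - lambda; a nonzero P only serves the continuity method. *)
Definition opr P Q a a2 b := fun x => - a2 x + (x ^+ 2 + P x) * a x - Q x * b x.

Definition bounded_mfun P := meas P /\ exists M, forall x, `|P x| <= M.

Lemma L2_bm P f : bounded_mfun P -> L2r f -> L2r (fun x => P x * f x).
Proof. by move=> [mP [M hM]]; exact: L2_bounded mP hM. Qed.

Lemma L2_opr P Q a a1 a2 b b1 b2 : bounded_mfun P -> bounded_mfun Q ->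
  H2w a a1 a2 -> H2w b b1 b2 -> L2r (opr P Q a a2 b).
Proof.
move=> bP bQ [A1 A2 L1 L2 [L3 L4]] [B1 B2 M1 M2 [M3 M4]].
apply: L2B; last exact: L2_bm.
apply: L2D; first exact: L2N.
have -> : (fun x => (x ^+ 2 + P x) * a x) = (fun x => x ^+ 2 * a x + P x * a x).
  by apply/funext => x; rewrite mulrDl.
by apply: L2D => //; exact: L2_bm.
Qed.

Lemma energy1 P a a1 a2 : bounded_mfun P -> (forall x, 0 <= P x) ->
  H2w a a1 a2 ->
  I (fun x => a1 x ^+ 2) + I (fun x => (x * a x) ^+ 2) <=
  I (fun x => (- a2 x + (x ^+ 2 + P x) * a x) * a x).
Proof.
move=> bP P0 Ha; have Lx := H2w_x Ha; case: Ha => Aa Aa1 La La1 [La2 Lx2].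
have e1 : I (fun x => a1 x ^+ 2) = I (fun x => - (a x * a2 x)).
  rewrite IN; last exact: L2_mul.
  by rewrite (ibp Aa Aa1)// opprK; apply: eqI => x; rewrite expr2.
rewrite e1 -ID; [|by apply: itgN; exact: L2_mul|exact: Lx.2].
have Pa : L2r (fun x => P x * a x) by exact: L2_bm.
apply: I_le.
- by apply: itgD; [apply: itgN; exact: L2_mul|exact: Lx.2].
- apply: L2_mul La; apply: L2D; first exact: L2N.
  by apply: eq_L2 (L2D Lx2 Pa) => x; rewrite mulrDl.
- move=> x; have -> : (- a2 x + (x ^+ 2 + P x) * a x) * a x =
    - (a x * a2 x) + (x * a x) ^+ 2 + P x * a x ^+ 2 by ring.
  by rewrite lerDl mulr_ge0// sqr_ge0.
Qed.

(** The Q terms of the two components are - Q a b and + Q a b and cancel; the nonnegative P is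
    dropped. *)
Lemma energy P Q a a1 a2 b b1 b2 : bounded_mfun P -> bounded_mfun Q ->
  (forall x, 0 <= P x) -> H2w a a1 a2 -> H2w b b1 b2 ->
  I (fun x => a1 x ^+ 2) + I (fun x => (x * a x) ^+ 2) +
  (I (fun x => b1 x ^+ 2) + I (fun x => (x * b x) ^+ 2)) <=
  I (fun x => opr P Q a a2 b x * a x + opr P (fun x => - Q x) b b2 a x * b x).
Proof.
move=> bP bQ P0 Ha Hb.
apply: le_trans (lerD (energy1 bP P0 Ha) (energy1 bP P0 Hb)) _.
have La : L2r a by case: Ha.
have Lb : L2r b by case: Hb.
have bQ' : bounded_mfun (fun x => - Q x).
  by case: bQ => mQ [M hM]; split; [exact: measN|exists M => x; rewrite normrN].
have b0 : bounded_mfun (fun=> 0).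
  by split; [exact: meas_cst|exists 0 => x; rewrite normr0].
have i1 := L2_mul (L2_opr bP b0 Ha Hb) La.
have i2 := L2_mul (L2_opr bP b0 Hb Ha) Lb.
have e1 : I (fun x => (- a2 x + (x ^+ 2 + P x) * a x) * a x) = I (fun x => opr P (fun=> 0) a a2 b x * a x).
  by apply: eqI => x; rewrite /opr mul0r subr0.
have e2 : I (fun x => (- b2 x + (x ^+ 2 + P x) * b x) * b x) = I (fun x => opr P (fun=> 0) b b2 a x * b x).
  by apply: eqI => x; rewrite /opr mul0r subr0.
rewrite e1 e2 -ID// le_eqVlt; apply/orP; left; apply/eqP; apply: eqI => x.
by rewrite /opr; ring.
Qed.

(** Energy and uncertainty give |u|^2 <= Re (L u, u) <= (|L u|^2 + |u|^2) / 2. The resulting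
    constant 1 is the same for all P >= 0 and Q, which gives the continuity method a uniform step
    size. *)
Lemma apriori P Q a a1 a2 b b1 b2 : bounded_mfun P -> bounded_mfun Q ->
  (forall x, 0 <= P x) -> H2w a a1 a2 -> H2w b b1 b2 ->
  I (fun x => a x ^+ 2 + b x ^+ 2) <=
  I (fun x => opr P Q a a2 b x ^+ 2 + opr P (fun x => - Q x) b b2 a x ^+ 2).
Proof.
move=> bP bQ P0 Ha Hb.
have bQ' : bounded_mfun (fun x => - Q x).
  by case: bQ => mQ [M hM]; split; [exact: measN|exists M => x; rewrite normrN].
have La : L2r a by case: Ha.
have Lb : L2r b by case: Hb.
have L1 := L2_opr bP bQ Ha Hb.
have L2 := L2_opr bP bQ' Hb Ha.
have E := energy bP bQ P0 Ha Hb.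
have U1 := H2w_uncertainty Ha; have U2 := H2w_uncertainty Hb.
have K : I (fun x => opr P Q a a2 b x * a x + opr P (fun x => - Q x) b b2 a x * b x) <=
  I (fun x => 2^-1 * (opr P Q a a2 b x ^+ 2 + opr P (fun x => - Q x) b b2 a x ^+ 2) +
     2^-1 * (a x ^+ 2 + b x ^+ 2)).
  apply: I_le.
  - by apply: itgD; exact: L2_mul.
  - by apply: itgD; apply: itgZ; apply: itgD; [exact: L1.2|exact: L2.2|exact: La.2|exact: Lb.2].
  - move=> x; set u := opr P Q a a2 b x; set v := opr P _ b b2 a x.
    by have := sqr_ge0 (u - a x); have := sqr_ge0 (v - b x); nra.
have i1 : itg (fun x => opr P Q a a2 b x ^+ 2 + opr P (fun x => - Q x) b b2 a x ^+ 2).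
  by apply: itgD; [exact: L1.2|exact: L2.2].
have i2 : itg (fun x => a x ^+ 2 + b x ^+ 2) by apply: itgD; [exact: La.2|exact: Lb.2].
rewrite [X in _ <= X]ID in K; [|exact: itgZ|exact: itgZ].
rewrite !IZ// in K.
have S : I (fun x => a x ^+ 2 + b x ^+ 2) = I (fun x => a x ^+ 2) + I (fun x => b x ^+ 2).
  by rewrite ID; [|exact: La.2|exact: Lb.2].
rewrite S in K *; lra.
Qed.

End SquareIntegrable.

(** * Reflection, Cauchy-Schwarz and pointwise derivatives *)

Section Reflection.
Variable R : realType.
Local Notation mu := (@lebesgue_measure R).
Implicit Types (f g h k F G a b P Q : R -> R) (c x y t : R).

(** The image of Lebesgue measure under x -> - x gives (a, b] the length of [- b, - a), so
    uniqueness of Lebesgue measure identifies the two. *)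
Lemma I_refl f : itg f -> itg (fun x => f (- x)) /\ I (fun x => f (- x)) = I f.
Proof.
move=> fi.
have mopp : measurable_fun [set: measurableTypeR R] (fun x : measurableTypeR R => - x : measurableTypeR R).
  exact: (measN (@meas_id R)).
pose nu0 : {measure set (measurableTypeR R) -> \bar R} := pushforward mu (fun x : measurableTypeR R => - x : measurableTypeR R).
pose nu := nu0 mopp.
have E A : measurable A -> mu A = nu A.
  apply: (@lebesgue_measure_unique R nu) => _ [[a b] _ <-] /=.
  rewrite /nu /nu0 /= /pushforward.
  have -> : (fun x : measurableTypeR R => - x : measurableTypeR R) @^-1` `]a, b] = `[- b, - a[%classic :> set R.
    by apply/seteqP; split => x /=; rewrite !in_itv /= lerNl ltrNr andbC.
  rewrite [LHS](lebesgue_measure_itv (Interval (BRight a) (BRight b))).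
  rewrite [RHS](lebesgue_measure_itv (Interval (BLeft (- b)) (BLeft (- a)))) /= !lte_fin ltrN2.
  by case: ifP => // _; rewrite -!EFinB opprK addrC.
have EI (h : R -> \bar R) : (\int[mu]_x h x = \int[nu]_x h x)%E.
  by apply: eq_measure_integral => A mA _; exact: E.
have i2 : itg (fun x => f (- x)).
  have [mf fin] := integrableP _ _ _ fi; apply/integrableP; split.
    by apply: measE; apply: measurableT_comp; [exact: itg_meas|exact: mopp].
  move: fin; rewrite EI ge0_integral_pushforward//.
  by apply: measurableT_comp.
split => //; rewrite /I /Rintegral [in RHS]EI integral_pushforward//.
by apply: measE; exact: itg_meas.
Qed.

Lemma AC_refl F h : AC F h -> AC (fun x => F (- x)) (fun x => - h (- x)).
Proof.
move=> AF.
(* Reflection turns half-open intervals around; the two indicators differ only at the endpoints a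
   and b. *)
have e (a b : R) : aeq (fun x => ind (- b) (- a) (- x) * h (- x)) (fun x => ind a b x * h (- x)).
  apply: ae_imp2 (@ae_ne _ a) (@ae_ne _ b) _ => x xa xb; congr (_ * _).
  rewrite /ind ltrN2 lerN2 andbC.
  have ax : (a == x) = false by apply/eqP => /esym.
  have bx : (x == b) = false by apply/eqP.
  by rewrite [a < x]lt_neqAle [x < b]lt_neqAle ax bx.
have mh : meas (fun x => h (- x)).
  by apply: measurableT_comp; [exact: AC_meas' AF|exact: (measN (@meas_id R))].
have m2 (a b : R) : meas (fun x => ind a b x * h (- x)) by apply: measM => //; exact: meas_indab.
have K (a b : R) := I_refl (AC_itg (- b) (- a) AF).
have i2 (a b : R) : itg (fun x => ind a b x * h (- x)) by exact: itg_ae (K a b).1 (m2 a b) (e a b).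
split.
  split; first exact: measN.
  by move=> a b; apply: eq_itg (itgN (i2 a b)) => x; rewrite mulrN.
move=> a b ab; have -> : I (fun x => ind a b x * - h (- x)) = - I (fun x => ind a b x * h (- x)).
  by rewrite -IN//; apply: eqI => x; rewrite mulrN.
rewrite -(I_ae _ _ (e a b))//; last exact: itg_meas (K a b).1.
by rewrite (K a b).2 -AF.2 ?lerN2//; ring.
Qed.

Lemma L2_refl f : L2r f -> L2r (fun x => f (- x)).
Proof.
move=> [mf fi]; split; last exact: (I_refl fi).1.
by apply: measurableT_comp => //; exact: (measN (@meas_id R)).
Qed.

Lemma cauchy_schwarz f g : L2r f -> L2r g ->
  I (fun x => f x * g x) ^+ 2 <= I (fun x => f x ^+ 2) * I (fun x => g x ^+ 2).
Proof.
move=> Lf Lg; set A := I (fun x => f x ^+ 2); set C := I (fun x => g x ^+ 2).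
set B := I _.
have K s : 0 <= s ^+ 2 * A - 2 * s * B + C.
  have -> : s ^+ 2 * A - 2 * s * B + C = I (fun x => (s * f x - g x) ^+ 2).
    rewrite -!IZ; [|exact: L2_mul|exact: Lf.2].
    rewrite -IB; [|apply: itgZ; exact: Lf.2|apply: itgZ; exact: L2_mul].
    rewrite -ID; [|apply: itgB; [apply: itgZ; exact: Lf.2|apply: itgZ; exact: L2_mul]|exact: Lg.2].
    by apply: eqI => x; ring.
  by apply: I_ge0 => x; exact: sqr_ge0.
have A0 : 0 <= A by apply: I_ge0 => x; exact: sqr_ge0.
move: A0; rewrite le_eqVlt => /orP[/eqP A0|A0].
  rewrite -A0 mul0r; have [->|B0] := eqVneq B 0; first by rewrite expr0n.
  (* For A = 0 the quadratic is affine in s, and at this s it would be -1. *)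
  have := K ((C + 1) / (2 * B)); rewrite -A0 mulr0 add0r.
  have -> : 2 * ((C + 1) / (2 * B)) * B = C + 1 by field.
  lra.
have := K (B / A); have -> : (B / A) ^+ 2 * A - 2 * (B / A) * B + C = C - B ^+ 2 / A by field; lra.
by rewrite subr_ge0 ler_pdivrMr// mulrC.
Qed.

Lemma dD f g x c d : is_derive x 1 f c -> is_derive x 1 g d ->
  is_derive x 1 (fun y => f y + g y) (c + d).
Proof. exact: is_deriveD. Qed.

Lemma dM f g x c d : is_derive x 1 f c -> is_derive x 1 g d ->
  is_derive x 1 (fun y => f y * g y) (c * g x + f x * d).
Proof.
move=> hf hg; apply: is_derive_eq (is_deriveM hf hg) _.
by rewrite /GRing.scale /= addrC; congr (_ + _); rewrite mulrC.
Qed.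

Lemma dcst c x : is_derive x 1 (fun=> c) 0.
Proof. exact: is_derive_cst. Qed.

Lemma did x : is_derive x 1 (fun y => y) 1.
Proof. exact: is_derive_id. Qed.

Lemma dZ s f x c : is_derive x 1 f c -> is_derive x 1 (fun y => s * f y) (s * c).
Proof. by move=> hf; apply: is_derive_eq (dM (dcst s x) hf) _; rewrite mul0r add0r. Qed.

Lemma dcomp f g x c d : is_derive (g x) 1 f c -> is_derive x 1 g d ->
  is_derive x 1 (fun y => f (g y)) (c * d).
Proof. by move=> hf hg; have := is_derive1_comp hf hg. Qed.

Lemma dnear f g x c : (\forall y \near x, f y = g y) -> is_derive x 1 g c ->
  is_derive x 1 f c.
Proof.
move=> e hg; apply: (near_eq_is_derive (f := g)) => //.
by near=> y; apply/esym; near: y.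
Unshelve. all: by end_near. Qed.

(** A ball on which F stays close to F x has positive measure, hence meets the set where F
    vanishes. *)
Lemma aeq0_AC F h : AC F h -> aeq F (fun=> 0) -> forall x, F x = 0.
Proof.
move=> AF F0 x; apply/eqP; rewrite -normr_le0; apply/ler_addgt0Pr => e e0; rewrite add0r.
have cF := AC_cont AF; have /cvgrPdist_lt /(_ e e0) /nbhs_ballP [d /= d0 Hd] := cF x.
have : exists y, ball x d y /\ F y = 0.
  apply: contrapT => /forallNP H.
  have [N [mN N0 sub]] := F0.
  pose S : set R := `](x - d), (x + d)[%classic.
  have SE y : S y -> ball x d y by rewrite /S /= in_itv /= /ball /= ltr_distlC.
  have : (mu S <= 0)%E.
    rewrite -N0; apply: le_measure; rewrite ?inE//; first exact: measurable_itv.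
    move=> y /= xy; apply: sub => /= Fy; apply: (H y); split => //.
    exact: SE.
  rewrite /S (lebesgue_measure_itv (Interval (BRight (x - d)) (BLeft (x + d)))) /= lte_fin.
  by rewrite ifT ?lee_fin; lra.
move=> [y [xy Fy]]; have := Hd y xy; rewrite /ball /= Fy subr0; exact: ltW.
Qed.

End Reflection.

(** * Solvability *)

Section FirstOrder.
Variable R : realType.
Implicit Types (f g h k F G a b P Q w : R -> R) (c x y t : R).

(** The Japanese bracket, a smooth substitute for |x|; [djp] is its derivative, bounded by 1. *)
Definition jp x : R := Num.sqrt (1 + x ^+ 2).
Definition djp x : R := x / jp x.

Lemma jp_sqr x : jp x ^+ 2 = 1 + x ^+ 2.
Proof. by rewrite sqr_sqrtr// addr_ge0// sqr_ge0. Qed.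

Lemma jp_ge1 x : 1 <= jp x.
Proof. by rewrite -sqrtr1 ler_sqrt ?lerDl ?sqr_ge0// addr_ge0// sqr_ge0. Qed.

Lemma jp_gt0 x : 0 < jp x.
Proof. exact: lt_le_trans (jp_ge1 x). Qed.

Lemma jp_ge_abs x : `|x| <= jp x.
Proof.
rewrite -ler_sqr ?nnegrE ?(ltW (jp_gt0 x))// jp_sqr real_normK ?num_real//.
by rewrite lerDr.
Qed.

Lemma djp_le1 x : `|djp x| <= 1.
Proof.
by rewrite normrM normfV (gtr0_norm (jp_gt0 x)) ler_pdivrMr ?jp_gt0// mul1r jp_ge_abs.
Qed.

Lemma jp_anti x y : x <= y -> y <= 0 -> jp y <= jp x.
Proof.
by move=> xy y0; rewrite ler_sqrt ?addr_ge0 ?sqr_ge0//; nra.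
Qed.

Lemma jp_even x : jp (- x) = jp x.
Proof. by rewrite /jp sqrrN. Qed.

Lemma is_derive_jp x : is_derive x 1 jp (djp x).
Proof.
have h0 : 0 < (1 + x ^+ 2 : R) by rewrite ltr_pwDl// sqr_ge0.
have d1 : is_derive x 1 (fun y : R => 1 + y ^+ 2) (2 * x).
  by apply: is_derive_eq (dD (dcst 1 x) (dM (did x) (did x))) _; ring.
have H : is_derive x 1 jp _ := @dcomp R (@Num.sqrt R) (fun y => 1 + y ^+ 2) x _ _ (is_derive1_sqrt h0) d1.
apply: is_derive_eq H _; rewrite /djp /jp; field.
by apply/eqP => h; move: (jp_gt0 x); rewrite /jp h ltxx.
Qed.

Lemma cont_jp : continuous jp.
Proof.
move=> x; apply: differentiable_continuous; apply/derivable1_diffP.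
by apply: ex_derive; exact: is_derive_jp.
Qed.

Lemma cont_djp : continuous djp.
Proof.
move=> x; rewrite /djp; apply: cvgM; first exact: cvg_id.
by apply: cvgV; [rewrite gt_eqF// jp_gt0|exact: cont_jp].
Qed.

Lemma AC_jp : AC jp djp.
Proof. by apply: C1_AC; [exact: is_derive_jp|exact: cont_djp]. Qed.

Lemma is_derive_primitive h F : continuous h -> AC F h -> forall x, is_derive x 1 F (h x).
Proof.
move=> ch AF x; have lh := AF.1.
have [] := @continuous_FTC1_closed R h (x - 1) x (x + 1) _ (loc_integrable _ _ lh) _ (ch x); try lra.
set G := (G in derivable G) => dG eG.
have E y : x - 1 <= y -> F y = F (x - 1) + G y.
  by move=> xy; rewrite /G -I_ind// -AF.2//; ring.
have dG' : is_derive x 1 (fun y => F (x - 1) + G y) (h x).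
  have -> : h x = 0 + 'D_1 G x by rewrite add0r -derive1E eG.
  by apply: is_deriveD; exact/derivableP.
suff : \forall y \near x, F y = F (x - 1) + G y.
  by move=> nE; exact: dnear nE dG'.
near=> y; apply: E; near: y; apply: lt_le_nbhsr; lra.
Unshelve. all: by end_near. Qed.

(** Integrating factors for w' + p w = g: the exponentials of P and of - P, where P is a primitive
    of p = [jp]. *)
Lemma exp_weight : exists E Em : R -> R, [/\ AC E (fun x => jp x * E x),
  AC Em (fun x => - (jp x * Em x)), forall x, 0 < E x & forall x, E x * Em x = 1].
Proof.
have [P AP] := AC_exists (cont_loc_itg cont_jp).
have dP := is_derive_primitive cont_jp AP.
have cP := AC_cont AP.
have cE (s : R) : continuous (fun x => expR (s * P x)).
  move=> x; apply: (@continuous_comp _ _ _ (fun x => s * P x) expR); last exact: continuous_expR.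
  by apply: cvgM; [exact: cvg_cst|exact: cP].
have dE (s x : R) : is_derive x 1 (fun x => expR (s * P x)) (s * jp x * expR (s * P x)).
  have d1 : is_derive x 1 (fun x => s * P x) (s * jp x).
    exact: dZ (dP x).
  by apply: is_derive_eq (dcomp (is_derive_expR _) d1) _; rewrite mulrC.
have A (s : R) : AC (fun x => expR (s * P x)) (fun x => s * jp x * expR (s * P x)).
  apply: C1_AC => x; apply: cvgM; last exact: cE.
  by apply: cvgM; [exact: cvg_cst|exact: cont_jp].
exists (fun x => expR (1 * P x)), (fun x => expR (- 1 * P x)); split.
- by apply: eq_AC (A 1) => // x; rewrite mul1r.
- by apply: eq_AC (A (- 1)) => // x; ring.
- by move=> x; exact: expR_gt0.
- by move=> x; rewrite -expRD -mulrDl subrr mul0r expR0.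
Qed.

(** The product d E is constant and E increases, so |d| stays above |d 0| on the left half-line;
    square integrability there forces d 0 = 0. *)
Lemma first_order_unique d : AC d (fun x => - (jp x * d x)) -> L2r d ->
  forall x, d x = 0.
Proof.
have [E [Em [AE AEm E0 EEm]]] := exp_weight.
move=> Ad Ld.
have Emono x : x <= 0 -> E x <= E 0.
  move=> x0; rewrite -subr_ge0 AE.2//; apply: I_ge0 => y.
  by rewrite mulr_ge0 ?ind_ge0// mulr_ge0// ltW// jp_gt0.
have cst x y : x <= y -> d x * E x = d y * E y.
  move=> xy; have := (ACM Ad AE).2 x y xy.
  rewrite (@eqI _ _ (fun=> 0)); last by move=> z; ring.
  by rewrite I0 => /eqP; rewrite subr_eq0 => /eqP.
pose e := `|d 0 * E 0| / E 0.
have e0 : 0 <= e by rewrite divr_ge0// ltW.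
have big x : x <= 0 -> e ^+ 2 <= d x ^+ 2.
  move=> x0; rewrite -[d x ^+ 2]real_normK ?num_real// ler_sqr ?nnegrE//.
  rewrite /e -(cst x 0 x0) normrM (gtr0_norm (E0 x)) ler_pdivrMr//.
  by rewrite ler_wpM2l// Emono.
have d0 : d 0 = 0.
  apply: contrapT => /eqP dn0.
  have ep : 0 < e ^+ 2.
    by rewrite exprn_gt0// divr_gt0// normr_gt0 mulf_neq0// gt_eqF.
  have [N HN] := itg_small Ld.2 ep.
  have [y [_ h1 h2]] := HN (- N).
  have y0 : y <= 0 by rewrite (le_trans h1)// addNr.
  by move: (big y y0); rewrite leNgt (le_lt_trans (ler_norm _) h2).
have z x : d x * E x = 0.
  have [x0|/ltW x0] := leP x 0; first by rewrite (cst x 0)// d0 mul0r.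
  by rewrite -(cst 0 x)// d0 mul0r.
move=> x; have /eqP := z x; rewrite mulf_eq0 => /orP[/eqP//|/eqP h].
by have := E0 x; rewrite h ltxx.
Qed.

(** Variation of constants from -oo: w x = E(x)^-1 times the integral of E g up to x. The weighted
    bound on p w comes from integrating the derivative of p w^2. *)
Lemma first_order g : L2r g ->
  exists w, [/\ AC w (fun x => g x - jp x * w x), L2r w & L2r (fun x => jp x * w x)].
Proof.
have [E [Em [AE AEm E0 EEm]]] := exp_weight.
move=> Lg; set A := I (fun x => g x ^+ 2).
have Em0 x : 0 < Em x by have := EEm x; have := E0 x; move=> h1 h2; rewrite -(pmulr_rgt0 _ h1) h2.
pose le_ (x t : R) : R := (t <= x)%R%:R.
have le0 x t : 0 <= le_ x t by rewrite ler0n.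
have le1 x t : le_ x t <= 1 by rewrite /le_; case: (t <= x).
have mle x : meas (le_ x).
  have -> : le_ x = (fun t => \1_`]-oo, x] t).
    by apply/funext => t; rewrite indicE /le_ mem_setE in_itv.
  exact: meas_ind.
have AEE := ACM AE AE.
have lE : loc_itg (fun t => E t ^+ 2) by apply: cont_loc_itg; exact: AC_cont AEE.
(* To the left of x the derivative 2 p E^2 of E^2 is at least c E^2. *)
have tail c x : 0 < c -> (forall t, t <= x -> c <= 2 * jp t) ->
    itg (fun t => le_ x t * E t ^+ 2) /\ I (fun t => le_ x t * E t ^+ 2) <= E x ^+ 2 / c.
  move=> c0 hc.
  have il n : itg (fun t => ind (- n%:R) n%:R t * (le_ x t * E t ^+ 2)).
    apply: itg_le (lE.2 (- n%:R) n%:R).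
      by apply: measM (meas_indab _ _) _; exact: measM lE.1.
    move=> t; rewrite ger0_norm; last by rewrite mulr_ge0 ?ind_ge0// mulr_ge0 ?le0// sqr_ge0.
    by rewrite ler_wpM2l ?ind_ge0// ler_piMl ?sqr_ge0.
  apply: (itg_fatou _ il).
  - by move=> n t; rewrite mulr_ge0 ?ind_ge0// mulr_ge0 ?le0// sqr_ge0.
  - move=> n; rewrite ler_pdivlMr// mulrC -IZ//.
    have [nx|xn] := leP (- n%:R) x; last first.
      rewrite (@eqI _ _ (fun=> 0)) ?I0 ?sqr_ge0// => t.
      rewrite /ind /le_; case: (ltP (- n%:R) t); rewrite ?mul0r ?mulr0//= => nt.
      by case: (leP t x) => tx; [lra|rewrite mul0r !mulr0].
    apply: (@le_trans _ _ (E x ^+ 2 - E (- n%:R) ^+ 2)); last by rewrite gerBl sqr_ge0.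
    have -> : E x ^+ 2 - E (- n%:R) ^+ 2 = E x * E x - E (- n%:R) * E (- n%:R) by [].
    rewrite AEE.2//; apply: I_le; [exact: itgZ|exact: AC_itg AEE|].
    move=> t; rewrite /ind /le_; case: (ltP (- n%:R) t); rewrite ?mul0r ?mulr0//= => nt.
    case: (leP t x) => tx; last by rewrite !mul0r !mulr0.
    have h1 := hc t tx; have h2 : 0 <= E t ^+ 2 by exact: sqr_ge0.
    case: (t <= n%:R); rewrite !mul1r; last first.
      by rewrite mul0r mulr0; have := ltW (jp_gt0 t); nra.
    by rewrite expr2 in h2 *; nra.
  - move=> t; apply: cvg_near_cst.
    near=> n; have xn : `|t| < n%:R by near: n; exact: nbhs_infty_gtr.
    by move: xn; rewrite /ind ltr_norml => /andP[-> /ltW ->]; rewrite mul1r.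
have leX x t : le_ x t ^+ 2 = le_ x t.
  by rewrite /le_; case: (t <= x); rewrite ?expr1n ?expr0n.
have LE x : L2r (fun t => le_ x t * E t).
  split; first exact: measM (mle x) (AC_meas AE).
  apply: eq_itg (tail 2 x _ _).1 => // [t|t _]; last by have := jp_ge1 t; lra.
  by rewrite exprMn leX.
have iF x : itg (fun t => le_ x t * E t * g t) by exact: L2_mul.
pose F x := I (fun t => le_ x t * E t * g t).
have le_ind (a b t : R) : a <= b -> ind a b t = le_ b t - le_ a t.
  by rewrite /ind /le_ => ab; case: (leP t a); case: (leP t b) => //=; rewrite ?subr0 ?subrr//; lra.
have AF : AC F (fun t => E t * g t).
  have ii (a b : R) : a <= b -> itg (fun t => ind a b t * (E t * g t)).
    move=> ab; apply: eq_itg (itgB (iF b) (iF a)) => t.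
    by rewrite le_ind//; ring.
  split.
    split; first exact: measM (AC_meas AE) Lg.1.
    move=> a b; have [/ii//|/ltW ba] := leP a b.
    by apply: eq_itg (@itg0 R) => t; rewrite ind_empty ?mul0r.
  move=> a b ab; rewrite /F -IB//; apply: eqI => t.
  by rewrite le_ind//; ring.
pose w x := Em x * F x.
have Aw : AC w (fun x => g x - jp x * w x).
  apply: eq_AC (ACM AEm AF) => // x; rewrite /w.
  have -> : Em x * (E x * g x) = E x * Em x * g x by ring.
  by rewrite EEm; ring.
(* Cauchy-Schwarz on the integral defining F, with [tail] at c = 2 p(x): on the negative axis p
   decreases, so p t >= p x for t <= x. This controls the boundary term at - n below. *)
have bw x : x <= 0 -> jp x * w x ^+ 2 <= A / 2.
  move=> x0; have c0 : 0 < 2 * jp x by rewrite mulr_gt0 ?jp_gt0.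
  have [_ h1] := tail (2 * jp x) x c0 (fun t tx => ler_wpM2l (ler0n R 2) (jp_anti tx x0)).
  have h2 := cauchy_schwarz (LE x) Lg; rewrite -/A -/(F x) in h2.
  rewrite (@eqI _ (fun t => (le_ x t * E t) ^+ 2) (fun t => le_ x t * E t ^+ 2)) in h2; last first.
    by move=> t; rewrite exprMn leX.
  have A0 : 0 <= A by apply: I_ge0 => t; exact: sqr_ge0.
  have h3 : F x ^+ 2 <= E x ^+ 2 / (2 * jp x) * A by apply: le_trans h2 _; exact: ler_wpM2r.
  have h4 : jp x * w x ^+ 2 <= jp x * (Em x ^+ 2 * (E x ^+ 2 / (2 * jp x) * A)).
    by rewrite /w exprMn ler_wpM2l ?(ltW (jp_gt0 x))// ler_wpM2l ?sqr_ge0.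
  apply: le_trans h4 _; rewrite le_eqVlt; apply/orP; left; apply/eqP.
  have -> : jp x * (Em x ^+ 2 * (E x ^+ 2 / (2 * jp x) * A)) = (E x * Em x) ^+ 2 * A / 2.
    by field; rewrite gt_eqF// jp_gt0.
  by rewrite EEm; ring.
have Lpw : L2r (fun x => jp x * w x).
  have cw := AC_cont Aw.
  have Apww := ACM AC_jp (ACM Aw Aw).
  have mpw : meas (fun x => jp x * w x) by apply: measM; [exact: AC_meas AC_jp|exact: AC_meas Aw].
  have lpw : loc_itg (fun x => (jp x * w x) ^+ 2).
    apply: cont_loc_itg => x; apply: cvgM; apply: cvgM; [exact: cont_jp|exact: cw|exact: cont_jp|exact: cw].
  (* Integrate the derivative of p w^2 over (- n, n]. With v = p w it is at most 2 g^2 - v^2 / 2;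
     the boundary term at n is nonnegative, the one at - n is at most A / 2. Hence 5 = 2 (2 +
     1/2). *)
  split => //; have [] := @itg_bdd_ind R _ (5 * A) _ lpw _ => // [x|n]; first exact: sqr_ge0.
  have n0 : - n%:R <= (n%:R : R) by rewrite ge0_cp ?ler0n.
  have nn0 : - n%:R <= (0 : R) by rewrite oppr_le0 ler0n.
  have b1 := bw _ nn0.
  have b2 : 0 <= jp n%:R * (w n%:R * w n%:R) by rewrite mulr_ge0 ?(ltW (jp_gt0 _))// -expr2 sqr_ge0.
  have E1 := Apww.2 _ _ n0.
  have ig : itg (fun x => ind (- n%:R) n%:R x * g x ^+ 2).
    apply: itg_le Lg.2; first exact: measM (meas_indab _ _) (measX 2 Lg.1).
    move=> x; rewrite ger0_norm; first by rewrite ler_piMl ?sqr_ge0 ?ind_le1.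
    by apply: mulr_ge0; [exact: ind_ge0|exact: sqr_ge0].
  have gA : I (fun x => ind (- n%:R) n%:R x * g x ^+ 2) <= A.
    by apply: I_le ig Lg.2 _ => x; rewrite ler_piMl ?sqr_ge0 ?ind_le1.
  set Y := I _.
  have K : I (fun x => ind (- n%:R) n%:R x * (djp x * (w x * w x) + jp x * ((g x - jp x * w x) * w x + w x * (g x - jp x * w x)))) <=
     I (fun x => 2 * (ind (- n%:R) n%:R x * g x ^+ 2) - 2^-1 * (ind (- n%:R) n%:R x * (jp x * w x) ^+ 2)).
    apply: I_le; first exact: AC_itg Apww.
      by apply: itgB; apply: itgZ => //; exact: lpw.2.
    move=> x; rewrite !(mulrCA _ (ind _ _ x)) -mulrBr ler_wpM2l ?ind_ge0//.
    have h1 := djp_le1 x; have h2 := jp_ge1 x; move: h1; rewrite ler_norml => /andP[_ h1].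
    have h3 : djp x * (w x * w x) <= (jp x * w x) ^+ 2.
      rewrite exprMn expr2; have := sqr_ge0 (w x); rewrite expr2 => h4.
      apply: (@le_trans _ _ (1 * (w x * w x))); first exact: ler_wpM2r.
      by rewrite ler_wpM2r// mulr_ege1.
    set v := jp x * w x in h3 *.
    have -> : jp x * ((g x - v) * w x + w x * (g x - v)) = 2 * v * (g x - v) by rewrite /v; ring.
    by have := sqr_ge0 (v - 2 * g x); nra.
  rewrite IB in K; [|exact: itgZ|by apply: itgZ; exact: lpw.2].
  rewrite !IZ// in K; last exact: lpw.2.
  rewrite -/Y -E1 in K; rewrite expr2 in b1; lra.
exists w; split => //.
apply: (L2_le (c := 1) _ _ Lpw); first exact: AC_meas Aw.
by move=> x; rewrite mul1r [X in _ <= X]exprMn; apply: ler_peMl; [exact: sqr_ge0|exact: exprn_ege1 (jp_ge1 x)].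
Unshelve. all: by end_near. Qed.

(** The function p w solves the same equation with right-hand side p g + p' w, again in L^2; by
    uniqueness it is the solution of [first_order], whose product with p is square integrable. *)
Lemma first_order_weight g w : L2r g -> AC w (fun x => g x - jp x * w x) ->
  L2r w -> L2r (fun x => jp x * w x) -> L2r (fun x => jp x * g x) ->
  L2r (fun x => jp x ^+ 2 * w x).
Proof.
move=> Lg Aw Lw Lpw Lpg.
have Lh : L2r (fun x => jp x * g x + djp x * w x).
  apply: L2D => //; apply: L2_bounded (djp_le1) Lw; exact: meas_cont cont_djp.
have [v [Av Lv Lpv]] := first_order Lh.
have e := @first_order_unique (fun x => jp x * w x - v x) _ (L2B Lpw Lv).
apply: eq_L2 Lpv => x; rewrite expr2 -mulrA; congr (_ * _).
apply/esym/eqP; rewrite -subr_eq0; apply/eqP; apply: e.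
by apply: eq_AC (ACB (ACM AC_jp Aw) Av) => // y; ring.
Qed.

(* With p = sqrt(1 + x^2), -d^2 + p^2 + p' = (d + p)(-d + p), so two first
   order equations have to be solved, the second one reflected. *)
Lemma base_solvable g : L2r g -> exists a a1 a2, H2w a a1 a2 /\
  forall x, - a2 x + (x ^+ 2 + (1 + djp x)) * a x = g x.
Proof.
move=> Lg; have [w [Aw Lw Lpw]] := first_order Lg.
have Lpw' : L2r (fun x => jp x * w (- x)).
  by apply: eq_L2 (L2_refl Lpw) => x; rewrite jp_even.
(* With b x = a (- x), the equation - a' + p a = w becomes b' + p b = w (- x). *)
have [b [Ab Lb Lpb]] := first_order (L2_refl Lw).
have Lppb := first_order_weight (L2_refl Lw) Ab Lb Lpb Lpw'.
pose a x := b (- x).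
have Aa : AC a (fun x => jp x * a x - w x).
  by apply: eq_AC (AC_refl Ab) => // x; rewrite /a opprK jp_even; ring.
have La : L2r a := L2_refl Lb.
have Lpa : L2r (fun x => jp x * a x) by apply: eq_L2 (L2_refl Lpb) => x; rewrite jp_even.
have Lppa : L2r (fun x => jp x ^+ 2 * a x) by apply: eq_L2 (L2_refl Lppb) => x; rewrite jp_even.
have La1 := L2B Lpa Lw.
pose a2 x := djp x * a x + jp x ^+ 2 * a x - g x.
have Aa1 : AC (fun x => jp x * a x - w x) a2.
  by apply: eq_AC (ACB (ACM AC_jp Aa) Aw) => // x; rewrite /a2; ring.
have Ldj : L2r (fun x => djp x * a x).
  by apply: L2_bounded (djp_le1) La; exact: meas_cont cont_djp.
exists a, (fun x => jp x * a x - w x), a2; split; last first.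
  by move=> x; rewrite /a2 jp_sqr; ring.
split => //; split; first by apply: L2B => //; exact: L2D.
apply: (L2_le (c := 1) _ _ Lppa).
  by apply: measM (AC_meas Aa); apply: measX; exact: meas_id.
move=> x; rewrite mul1r !exprMn ler_wpM2r ?sqr_ge0// ler_sqr ?nnegrE ?sqr_ge0// jp_sqr.
by rewrite lerDr.
Qed.

End FirstOrder.

(** * Summation of geometrically decaying series in L^2 *)

Section ContinuityMethod.
Variable R : realType.
Local Notation mu := (@lebesgue_measure R).
Implicit Types (f g h k F G a b P Q w : R -> R) (c x y t : R).

Lemma IDn (F : nat -> R -> R) n : (forall j, itg (F j)) ->
  itg (fun x => \sum_(j < n) F j x) /\
  I (fun x => \sum_(j < n) F j x) = \sum_(j < n) I (F j).
Proof.
move=> iF; elim: n => [|n [IH1 IH2]].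
  have E : (fun x => \sum_(j < 0) F j x) = (fun=> 0).
    by apply/funext => x; rewrite big_ord0.
  by rewrite E big_ord0; split; [exact: itg0|exact: I0].
have E : (fun x => \sum_(j < n.+1) F j x) = (fun x => \sum_(j < n) F j x + F n x).
  by apply/funext => x; rewrite big_ord_recr.
by rewrite E big_ord_recr /= -IH2; split; [exact: itgD|exact: ID].
Qed.

(** The factor 1 - 2^-m is the exact geometric sum, kept so that the induction on m closes. *)
Lemma partial_sum_bound (d : nat -> R) (B : R) :
  (forall j, `|d j| <= B * 2^-1 ^+ j) -> forall n m,
  `|\sum_(j < n + m) d j - \sum_(j < n) d j| <= 2 * B * 2^-1 ^+ n * (1 - 2^-1 ^+ m).
Proof.
move=> hd n; elim=> [|m IH]; first by rewrite addn0 !subrr normr0 mulr0.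
rewrite addnS big_ord_recr /=.
rewrite addrAC; apply: le_trans (ler_normD _ _) _.
have := lerD IH (hd (n + m)%N); move/le_trans; apply.
by rewrite exprD exprS le_eqVlt; apply/orP; left; apply/eqP; field.
Qed.

Lemma geometric_cvg (d : nat -> R) (B : R) : (forall j, `|d j| <= B * 2^-1 ^+ j) ->
  exists s, (\sum_(j < n) d j @[n --> \oo] --> s) /\
    forall n, `|s - \sum_(j < n) d j| <= 2 * B * 2^-1 ^+ n.
Proof.
move=> hd.
have B0 : 0 <= B by have := hd 0%N; rewrite expr0 mulr1; exact: le_trans.
have cv : cvgn (series d).
  apply: normed_cvg; apply: (@series_le_cvg _ _ (geometric B 2^-1)).
  - by move=> n; exact: normr_ge0.
  - by move=> n; rewrite /geometric /= mulr_ge0// exprn_ge0// invr_ge0.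
  - by move=> n; exact: hd.
  - by apply: is_cvg_geometric_series; rewrite ger0_norm ?invr_ge0// invf_lt1// ltr1n.
have E : series d = (fun n => \sum_(j < n) d j).
  by apply/funext => n; rewrite /series /= big_mkord.
exists (limn (series d)); rewrite -E; split; first exact: cv.
move=> n; have c1 : (fun m => `|series d (n + m)%N - series d n|) @ \oo --> `|limn (series d) - series d n|.
  apply: (cvg_norm (FF := eventually_filter)); apply: cvgB; last exact: cvg_cst.
  have := cv; rewrite -(cvg_shiftn n); under eq_fun do rewrite addnC.
  exact.
have -> : \sum_(j < n) d j = series d n by rewrite E.
rewrite -(cvg_lim (@Rhausdorff R) c1); apply: limr_le.
  by apply/cvg_ex; eexists; exact: c1.
apply: nearW => m; rewrite E; apply: le_trans (partial_sum_bound hd n m) _.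
have q0 (k : nat) : 0 <= (2^-1 : R) ^+ k by rewrite exprn_ge0// invr_ge0.
by rewrite ler_piMr// ?gerBl// !mulr_ge0.
Qed.

(** The sum B of 4^j d_j^2 has integral at most 2 K, since 4 / 8 = 1 / 2, hence is finite a.e. Where
    it is finite, |d_j| <= sqrt(B) 2^-j, so the series converges pointwise with tail at most 2
    sqrt(B) 2^-n; squaring and integrating gives 8 K 4^-n. *)
Lemma L2_series (d : nat -> R -> R) (K : R) :
  (forall n, L2r (d n)) -> (forall n, I (fun x => d n x ^+ 2) <= K * 8^-1 ^+ n) ->
  exists s, L2r s /\
    forall n, I (fun x => (s x - \sum_(j < n) d j x) ^+ 2) <= 8 * K * 4^-1 ^+ n.
Proof.
move=> Ld hd.
pose e j x := 4 ^+ j * d j x ^+ 2.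
have e0 j x : 0 <= e j x by apply: mulr_ge0; [exact: exprn_ge0|exact: sqr_ge0].
have ie j : itg (e j) by apply: itgZ; exact: (Ld j).2.
pose Phi n x := \sum_(j < n) e j x.
have iPhi n : itg (Phi n) := (IDn n ie).1.
have Phi0 n x : 0 <= Phi n x by apply: sumr_ge0.
have K0 : 0 <= K.
  have := hd 0%N; rewrite expr0 mulr1; apply: le_trans.
  by apply: I_ge0 => x; exact: sqr_ge0.
have IPhi n : I (Phi n) <= 2 * K.
  rewrite /Phi (IDn n ie).2.
  have : forall n, \sum_(j < n) I (e j) <= 2 * K * (1 - 2^-1 ^+ n).
    elim=> [|m IH]; first by rewrite big_ord0 subrr mulr0.
    rewrite big_ord_recr /= /e IZ; last exact: (Ld m).2.
    have h1 : 4 ^+ m * I (fun x => d m x ^+ 2) <= K * 2^-1 ^+ m.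
      apply: le_trans (ler_wpM2l _ (hd m)) _; first by rewrite exprn_ge0.
      rewrite mulrCA -exprMn; have -> : (4 * 8^-1 : R) = 2^-1 by field.
      by [].
    apply: le_trans (lerD IH h1) _.
    by rewrite exprS le_eqVlt; apply/orP; left; apply/eqP; field.
  move/(_ n)/le_trans; apply; apply: ler_piMr; first by rewrite mulr_ge0.
  by rewrite gerBl; apply: exprn_ge0; rewrite invr_ge0.
pose PhiE x := limn (fun n => (Phi n x)%:E).
have ndPhi x : {homo (fun n => (Phi n x)%:E) : n m / (n <= m)%N >-> (n <= m)%E}.
  by apply/nondecreasing_seqP => n; rewrite lee_fin /Phi big_ord_recr /= lerDl.
have cvPhi x : (fun n => (Phi n x)%:E) @ \oo --> PhiE x.
  exact: ereal_nondecreasing_is_cvgn.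
have mPhi n : measurable_fun setT (fun x => (Phi n x)%:E) by apply: measE; exact: itg_meas.
have mPhiE : measurable_fun setT PhiE.
  by apply: (emeasurable_fun_cvg (fun n x => (Phi n x)%:E)) => // x _; exact: cvPhi.
have PhiE0 x : (0 <= PhiE x)%E.
  by apply: lime_ge; [exact: ereal_nondecreasing_is_cvgn|apply: nearW => n; rewrite lee_fin].
have IE : (\int[mu]_x PhiE x <= (2 * K)%:E)%E.
  have := @cvg_monotone_convergence _ _ R mu setT measurableT (fun n x => (Phi n x)%:E) mPhi.
  move=> /(_ (fun n x _ => Phi0 n x) (fun x _ => ndPhi x)) H.
  rewrite -(cvg_lim _ H)//; apply: lime_le.
    by apply/cvg_ex; eexists; exact: H.
  apply: nearW => n; have fn := integrable_fin_num measurableT (iPhi n).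
  by rewrite -(fineK fn) lee_fin; exact: IPhi.
have intE : mu.-integrable setT PhiE.
  apply/integrableP; split => //.
  by under eq_integral do rewrite gee0_abs//; apply: le_lt_trans IE (ltry _).
have aeE : {ae mu, forall x, PhiE x \is a fin_num}.
  by apply: ae_imp (integrable_ae measurableT intE) _ => x; apply.
pose B x := fine (PhiE x).
have iB : itg B.
  apply/integrableP; split; first exact: measE (measurableT_comp _ mPhiE).
  apply: le_lt_trans (integrable_lty measurableT intE).
  rewrite le_eqVlt; apply/orP; left; apply/eqP; apply: ae_eq_integral => //.
  - by apply: measurableT_comp => //; exact: measE (measurableT_comp _ mPhiE).
  - by apply: ae_imp aeE _ => x fx _; rewrite /= ger0_norm ?fine_ge0// /B fineK.
have IB : I B <= 2 * K.
  rewrite -lee_fin; apply: le_trans IE; rewrite /I /Rintegral fineK; last exact: integrable_fin_num.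
  rewrite le_eqVlt; apply/orP; left; apply/eqP; apply: ae_eq_integral => //.
  - exact: measE (itg_meas iB).
  - by apply: ae_imp aeE _ => x fx _; rewrite /B fineK.
pose good x := PhiE x \is a fin_num.
(* Terms are set to 0 on the null set where B is infinite, so that the series converges everywhere
   and its sum is measurable. *)
pose bd j x := if good x then d j x else 0.
have hB x : good x -> forall j, `|bd j x| <= Num.sqrt (B x) * 2^-1 ^+ j.
  move=> gx j; rewrite /bd gx.
  have h1 : e j x <= B x.
    rewrite -lee_fin /B fineK//; apply: (@le_trans _ _ (Phi j.+1 x)%:E).
      by rewrite lee_fin /Phi big_ord_recr /= lerDr; exact: sumr_ge0.
    apply: lime_ge; first exact: ereal_nondecreasing_is_cvgn.
    by exists j.+1 => // n /= jn; exact: ndPhi.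
  rewrite -ler_sqr ?nnegrE ?mulr_ge0 ?sqrtr_ge0 ?exprn_ge0 ?invr_ge0//.
  rewrite exprMn sqr_sqrtr ?fine_ge0// real_normK ?num_real// -exprM mulnC exprM.
  have -> : (2^-1 ^+ 2 : R) = 4^-1 by field.
  by rewrite exprVn -ler_pdivrMr ?invr_gt0 ?exprn_gt0// invrK mulrC.
have hB' x : forall j, `|bd j x| <= (if good x then Num.sqrt (B x) else 0) * 2^-1 ^+ j.
  by case: ifP => gx; [exact: hB|move=> j; rewrite /bd gx normr0 mul0r].
have [s Hs] := choice (fun x => geometric_cvg (hB' x)).
have mgood : measurable_fun setT good.
  have -> : good = (fun x => (PhiE x < +oo)%E).
    by apply/funext => x; rewrite /good ge0_fin_numE.
  by apply: measurable_fun_lte => //; exact: measurable_cst.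
have ms : meas s.
  apply: (@measurable_fun_cvg _ _ R setT (fun n x => \sum_(j < n) bd j x)) => [n|x _].
    apply: measurable_sum => j; apply: measurable_fun_ifT => //; exact: (Ld j).1.
  exact: (Hs x).1.
have le n x : (s x - \sum_(j < n) bd j x) ^+ 2 <= 4 * 4^-1 ^+ n * B x.
  have h := (Hs x).2 n.
  have B0 : 0 <= B x by rewrite fine_ge0.
  rewrite -real_normK ?num_real//; apply: (@le_trans _ _ ((2 * Num.sqrt (B x) * 2^-1 ^+ n) ^+ 2)).
    rewrite ler_sqr ?nnegrE ?mulr_ge0 ?sqrtr_ge0 ?exprn_ge0 ?invr_ge0//.
    apply: le_trans h _; rewrite ler_wpM2r ?exprn_ge0 ?invr_ge0// ler_wpM2l//.
    by case: ifP => // _; exact: sqrtr_ge0.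
  rewrite !exprMn sqr_sqrtr// -exprM mulnC exprM.
  have -> : (2^-1 ^+ 2 : R) = 4^-1 by field.
  by rewrite le_eqVlt; apply/orP; left; apply/eqP; ring.
have ssum n : L2r (fun x => \sum_(j < n) d j x).
  elim: n => [|n IH].
    apply: eq_L2 (L2Z 0 (Ld 0%N)) => x; by rewrite big_ord0 mul0r.
  by apply: eq_L2 (L2D IH (Ld n)) => x; rewrite big_ord_recr.
have sae n : aeq (fun x => \sum_(j < n) bd j x) (fun x => \sum_(j < n) d j x).
  apply: ae_imp aeE _ => x gx; apply: eq_bigr => j _; by rewrite /bd /good gx.
have mbd n : meas (fun x => \sum_(j < n) bd j x).
  by apply: measurable_sum => j; apply: measurable_fun_ifT => //; exact: (Ld j).1.
have iD n : itg (fun x => (s x - \sum_(j < n) bd j x) ^+ 2) /\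
    I (fun x => (s x - \sum_(j < n) bd j x) ^+ 2) <= 8 * K * 4^-1 ^+ n.
  have i1 : itg (fun x => (s x - \sum_(j < n) bd j x) ^+ 2).
    apply: itg_le (itgZ (4 * 4^-1 ^+ n) iB); first by apply: measX; exact: measB.
    by move=> x; rewrite ger0_norm ?sqr_ge0.
  split => //; apply: le_trans (I_le i1 (itgZ (4 * 4^-1 ^+ n) iB) (le n)) _.
  rewrite IZ//; have -> : 8 * K * 4^-1 ^+ n = 4 * 4^-1 ^+ n * (2 * K) by ring.
  by rewrite ler_wpM2l// mulr_ge0// exprn_ge0// invr_ge0.
exists s; split.
  split => //; apply: eq_itg (iD 0%N).1 => x.
  by rewrite big_ord0 subr0.
move=> n; rewrite (@I_ae _ _ (fun x => (s x - \sum_(j < n) bd j x) ^+ 2)).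
- exact: (iD n).2.
- by apply: measX; apply: measB => //; exact: (ssum n).1.
- by apply: measX; exact: measB.
- by apply: ae_imp (sae n) _ => x ->.
Qed.

End ContinuityMethod.

(** * Continuity method *)

Section Solvability.
Variable R : realType.
Local Notation mu := (@lebesgue_measure R).
Implicit Types (f g h k F G a b P Q w : R -> R) (c x y t : R).

(** Surjectivity in real components: g1 + i g2 is the right-hand side and a + i b the solution. *)
Definition solvable P Q := forall g1 g2, L2r g1 -> L2r g2 ->
  exists a a1 a2 b b1 b2, [/\ H2w a a1 a2, H2w b b1 b2,
    aeq (opr P Q a a2 b) g1 & aeq (opr P (fun x => - Q x) b b2 a) g2].

Lemma bmN Q : bounded_mfun Q -> bounded_mfun (fun x => - Q x).
Proof. by move=> [mQ [M hM]]; split; [exact: measN|exists M => x; rewrite normrN]. Qed.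

Lemma bmD P Q : bounded_mfun P -> bounded_mfun Q -> bounded_mfun (fun x => P x + Q x).
Proof.
move=> [mP [M hM]] [mQ [N hN]]; split; first exact: measD.
by exists (M + N) => x; apply: le_trans (ler_normD _ _) _; exact: lerD.
Qed.

Lemma bmZ c P : bounded_mfun P -> bounded_mfun (fun x => c * P x).
Proof.
move=> [mP [M hM]]; split; first exact: measM (meas_cst c) mP.
by exists (`|c| * M) => x; rewrite normrM ler_wpM2l.
Qed.

Lemma apriori_ae P Q a a1 a2 b b1 b2 g1 g2 : bounded_mfun P -> bounded_mfun Q ->
  (forall x, 0 <= P x) -> H2w a a1 a2 -> H2w b b1 b2 -> meas g1 -> meas g2 ->
  aeq (opr P Q a a2 b) g1 -> aeq (opr P (fun x => - Q x) b b2 a) g2 ->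
  I (fun x => a x ^+ 2 + b x ^+ 2) <= I (fun x => g1 x ^+ 2 + g2 x ^+ 2).
Proof.
move=> bP bQ P0 Ha Hb m1 m2 e1 e2.
have E : aeq (fun x => opr P Q a a2 b x ^+ 2 + opr P (fun x => - Q x) b b2 a x ^+ 2)
    (fun x => g1 x ^+ 2 + g2 x ^+ 2).
  by apply: ae_imp2 e1 e2 _ => x -> ->.
apply: le_trans (apriori bP bQ P0 Ha Hb) _; rewrite (I_ae _ _ E)//.
- by apply: measD; apply: measX; [exact: (L2_opr bP bQ Ha Hb).1|exact: (L2_opr bP (bmN bQ) Hb Ha).1].
- by apply: measD; exact: measX.
Qed.

(* [apriori] makes the solution operator a contraction of L^2, so a
   perturbation of squared modulus at most 1/8 is absorbed by a Neumann series. *)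
Lemma solvable_step P Q P' Q' : bounded_mfun P -> bounded_mfun Q ->
  (forall x, 0 <= P x) -> meas P' -> meas Q' ->
  (forall x, `|P' x - P x| <= 4^-1) -> (forall x, `|Q' x - Q x| <= 4^-1) ->
  solvable P Q -> solvable P' Q'.
Proof.
move=> bP bQ P0 mP' mQ' hP hQ sol g1 g2 Lg1 Lg2.
pose dP x := P' x - P x; pose dQ x := Q' x - Q x.
have bdP : bounded_mfun dP by split; [exact: measB mP' bP.1|exists 4^-1].
have bdQ : bounded_mfun dQ by split; [exact: measB mQ' bQ.1|exists 4^-1].
(* Real and imaginary parts of (dP + i dQ)(a + i b). Their squares sum to (dP^2 + dQ^2)(a^2 + b^2),
   whence the factor 1/8 = 1/16 + 1/16. *)
pose D1 a b x := dP x * a x - dQ x * b x.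
pose D2 a b x := dP x * b x + dQ x * a x.
have LD1 a b : L2r a -> L2r b -> L2r (D1 a b) by move=> La Lb; apply: L2B; exact: L2_bm.
have LD2 a b : L2r a -> L2r b -> L2r (D2 a b) by move=> La Lb; apply: L2D; exact: L2_bm.
have small (h : R -> R) x : `|h x| <= 4^-1 -> h x ^+ 2 <= 16^-1.
  move=> hh; rewrite -real_normK ?num_real//.
  have -> : (16^-1 : R) = 4^-1 ^+ 2 by field.
  by rewrite ler_sqr ?nnegrE// invr_ge0.
have Dle a b x : D1 a b x ^+ 2 + D2 a b x ^+ 2 <= 8^-1 * (a x ^+ 2 + b x ^+ 2).
  have -> : D1 a b x ^+ 2 + D2 a b x ^+ 2 = (dP x ^+ 2 + dQ x ^+ 2) * (a x ^+ 2 + b x ^+ 2).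
    by rewrite /D1 /D2; ring.
  rewrite ler_wpM2r ?addr_ge0 ?sqr_ge0//.
  by have := small _ _ (hP x); have := small _ _ (hQ x); rewrite -/(dP x) -/(dQ x); lra.
have i2 a b : L2r a -> L2r b -> itg (fun x => a x ^+ 2 + b x ^+ 2).
  by move=> La Lb; apply: itgD; [exact: La.2|exact: Lb.2].
have ID2 a b : L2r a -> L2r b ->
    I (fun x => (- D1 a b x) ^+ 2 + (- D2 a b x) ^+ 2) <= 8^-1 * I (fun x => a x ^+ 2 + b x ^+ 2).
  move=> La Lb; rewrite -IZ; last exact: i2.
  apply: I_le; first by apply: i2; apply: L2N; [exact: LD1|exact: LD2].
    by apply: itgZ; exact: i2.
  by move=> x; rewrite !sqrrN.
pose T := ((R -> R) * (R -> R) * (R -> R) * ((R -> R) * (R -> R) * (R -> R)))%type.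
pose ok (z : T) := H2w z.1.1.1 z.1.1.2 z.1.2 /\ H2w z.2.1.1 z.2.1.2 z.2.2.
pose L1 (z : T) := opr P Q z.1.1.1 z.1.2 z.2.1.1.
pose L2 (z : T) := opr P (fun x => - Q x) z.2.1.1 z.2.2 z.1.1.1.
have /choice[S HS] : forall gg : (R -> R) * (R -> R), exists z : T,
    L2r gg.1 -> L2r gg.2 -> [/\ ok z, aeq (L1 z) gg.1 & aeq (L2 z) gg.2].
  move=> [h1 h2] /=; have [L|nL] := pselect (L2r h1 /\ L2r h2); last first.
    by exists (h1, h1, h1, (h1, h1, h1)) => ? ?; exfalso; apply: nL.
  have [a [a1 [a2 [b [b1 [b2 [? ? ? ?]]]]]]] := sol h1 h2 L.1 L.2.
  by exists (a, a1, a2, (b, b1, b2)).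
(* Neumann iterates: L z_0 = g and L z_(n+1) = - D z_n, where L is the operator for P, Q and D the
   perturbation. *)
pose z := fix z n := if n is m.+1 then
  S (fun x => - D1 (z m).1.1.1 (z m).2.1.1 x, fun x => - D2 (z m).1.1.1 (z m).2.1.1 x)
  else S (g1, g2).
pose A n := (z n).1.1.1; pose B n := (z n).2.1.1.
have okL (y : T) : ok y -> L2r y.1.1.1 /\ L2r y.2.1.1.
  by move=> [[_ _ ? _ _] [_ _ ? _ _]].
have okz n : ok (z n).
  elim: n => [|n IH] /=.
    by have [] := HS (g1, g2) Lg1 Lg2.
  have [La Lb] := okL _ IH.
  have [] := HS (fun x => - D1 (A n) (B n) x, fun x => - D2 (A n) (B n) x) => //=.
    by apply: L2N; exact: LD1.
  by apply: L2N; exact: LD2.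
have LA n : L2r (A n) by have [] := okL _ (okz n).
have LB n : L2r (B n) by have [] := okL _ (okz n).
have zS n : aeq (L1 (z n.+1)) (fun x => - D1 (A n) (B n) x) /\
            aeq (L2 (z n.+1)) (fun x => - D2 (A n) (B n) x).
  have [] := HS (fun x => - D1 (A n) (B n) x, fun x => - D2 (A n) (B n) x) => //=.
    by apply: L2N; exact: LD1.
  by apply: L2N; exact: LD2.
have z0 : aeq (L1 (z 0%N)) g1 /\ aeq (L2 (z 0%N)) g2 by have [] := HS (g1, g2) Lg1 Lg2.
pose K := I (fun x => g1 x ^+ 2 + g2 x ^+ 2).
have Kn n : I (fun x => A n x ^+ 2 + B n x ^+ 2) <= K * 8^-1 ^+ n.
  elim: n => [|n IH].
    rewrite expr0 mulr1; have [Ha Hb] := okz 0%N.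
    by apply: (apriori_ae bP bQ P0 Ha Hb Lg1.1 Lg2.1 z0.1 z0.2).
  have [Ha Hb] := okz n.+1.
  apply: le_trans (apriori_ae bP bQ P0 Ha Hb _ _ (zS n).1 (zS n).2) _.
  - by apply: measN; exact: (LD1 _ _ (LA n) (LB n)).1.
  - by apply: measN; exact: (LD2 _ _ (LA n) (LB n)).1.
  apply: le_trans (ID2 _ _ (LA n) (LB n)) _.
  by rewrite exprS mulrCA ler_wpM2l// invr_ge0.
have KA n : I (fun x => A n x ^+ 2) <= K * 8^-1 ^+ n.
  apply: le_trans (Kn n); apply: I_le; [exact: (LA n).2|exact: i2|].
  by move=> x; rewrite lerDl sqr_ge0.
have KB n : I (fun x => B n x ^+ 2) <= K * 8^-1 ^+ n.
  apply: le_trans (Kn n); apply: I_le; [exact: (LB n).2|exact: i2|].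
  by move=> x; rewrite lerDr sqr_ge0.
have [sa [Lsa Hsa]] := L2_series LA KA.
have [sb [Lsb Hsb]] := L2_series LB KB.
have Lh1 : L2r (fun x => g1 x - D1 sa sb x) by apply: L2B => //; exact: LD1.
have Lh2 : L2r (fun x => g2 x - D2 sa sb x) by apply: L2B => //; exact: LD2.
(* Only the L^2 sum s of the iterates is known, not its derivatives. Solving L u = g - D s produces
   an element of the domain; it remains to show u = s a.e., which turns this into (L + D) u = g. *)
have [oku eu1 eu2] := HS (fun x => g1 x - D1 sa sb x, fun x => g2 x - D2 sa sb x) Lh1 Lh2.
set u := S _ in oku eu1 eu2; rewrite /= in eu1 eu2.
have [Lua Lub] := okL _ oku.
pose SA n x := \sum_(j < n) A j x; pose SB n x := \sum_(j < n) B j x.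
have LSA n : L2r (SA n).
  elim: n => [|n IH].
    by apply: eq_L2 (L2Z 0 (LA 0%N)) => x; rewrite /SA big_ord0 mul0r.
  by apply: eq_L2 (L2D IH (LA n)) => x; rewrite /SA big_ord_recr.
have LSB n : L2r (SB n).
  elim: n => [|n IH].
    by apply: eq_L2 (L2Z 0 (LB 0%N)) => x; rewrite /SB big_ord0 mul0r.
  by apply: eq_L2 (L2D IH (LB n)) => x; rewrite /SB big_ord_recr.
have partial n : exists v : T, [/\ ok v, v.1.1.1 =1 SA n.+1, v.2.1.1 =1 SB n.+1,
    aeq (L1 v) (fun x => g1 x - D1 (SA n) (SB n) x) &
    aeq (L2 v) (fun x => g2 x - D2 (SA n) (SB n) x)].
  elim: n => [|n [v [okv va vb e1 e2]]].
    exists (z 0%N); split => //.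
    - by move=> x; rewrite /SA big_ord1.
    - by move=> x; rewrite /SB big_ord1.
    - by apply: ae_imp z0.1 _ => x ->; rewrite /D1 /SA /SB !big_ord0; ring.
    - by apply: ae_imp z0.2 _ => x ->; rewrite /D2 /SA /SB !big_ord0; ring.
  have [Hva Hvb] := okv; have [Hza Hzb] := okz n.+1.
  exists (fun x => 1 * v.1.1.1 x + 1 * (z n.+1).1.1.1 x,
          fun x => 1 * v.1.1.2 x + 1 * (z n.+1).1.1.2 x,
          fun x => 1 * v.1.2 x + 1 * (z n.+1).1.2 x,
         (fun x => 1 * v.2.1.1 x + 1 * (z n.+1).2.1.1 x,
          fun x => 1 * v.2.1.2 x + 1 * (z n.+1).2.1.2 x,
          fun x => 1 * v.2.2 x + 1 * (z n.+1).2.2 x)).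
  split.
  - by split; exact: H2w_lin.
  - by move=> x /=; rewrite !mul1r va /SA [RHS]big_ord_recr.
  - by move=> x /=; rewrite !mul1r vb /SB [RHS]big_ord_recr.
  - apply: ae_imp2 e1 (zS n).1 _ => x E1 E2.
    have -> : g1 x - D1 (SA n.+1) (SB n.+1) x = (g1 x - D1 (SA n) (SB n) x) + (- D1 (A n) (B n) x).
      by rewrite /D1 /SA /SB !big_ord_recr /=; ring.
    by rewrite -E1 -E2 /L1 /opr /=; ring.
  - apply: ae_imp2 e2 (zS n).2 _ => x E1 E2.
    have -> : g2 x - D2 (SA n.+1) (SB n.+1) x = (g2 x - D2 (SA n) (SB n) x) + (- D2 (A n) (B n) x).
      by rewrite /D2 /SA /SB !big_ord_recr /=; ring.
    by rewrite -E1 -E2 /L2 /opr /=; ring.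
have Isum f1 f2 : L2r f1 -> L2r f2 -> I (fun x => f1 x ^+ 2 + f2 x ^+ 2) =
    I (fun x => f1 x ^+ 2) + I (fun x => f2 x ^+ 2).
  by move=> L1' L2'; rewrite ID; [|exact: L1'.2|exact: L2'.2].
(* Since L (u - S_(n+1)) = - D (s - S_n), the a priori estimate turns convergence of S_n to s into
   convergence of S_(n+1) to u. *)
have diff n : I (fun x => (u.1.1.1 x - SA n.+1 x) ^+ 2 + (u.2.1.1 x - SB n.+1 x) ^+ 2) <=
    2 * K * 4^-1 ^+ n.
  have [v [[Hva Hvb] va vb e1 e2]] := partial n; have [Hua Hub] := oku.
  have := @apriori_ae P Q _ _ _ _ _ _ (fun x => - D1 (fun x => sa x - SA n x) (fun x => sb x - SB n x) x)
    (fun x => - D2 (fun x => sa x - SA n x) (fun x => sb x - SB n x) x) bP bQ P0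
    (H2w_lin 1 (-1) Hua Hva) (H2w_lin 1 (-1) Hub Hvb).
  have Ld1 := L2B Lsa (LSA n); have Ld2 := L2B Lsb (LSB n).
  move=> /(_ (measN (LD1 _ _ Ld1 Ld2).1) (measN (LD2 _ _ Ld1 Ld2).1)) H.
  rewrite (@eqI _ _ (fun x => (1 * u.1.1.1 x + -1 * v.1.1.1 x) ^+ 2 + (1 * u.2.1.1 x + -1 * v.2.1.1 x) ^+ 2)); last first.
    by move=> x; rewrite va vb; ring.
  apply: le_trans (H _ _) _.
  - by apply: ae_imp2 eu1 e1 _ => x; rewrite /L1 /opr /D1 => E1 E2; lra.
  - by apply: ae_imp2 eu2 e2 _ => x; rewrite /L2 /opr /D2 => E1 E2; lra.
  apply: le_trans (ID2 _ _ Ld1 Ld2) _; rewrite Isum//.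
  by have := Hsa n; have := Hsb n; lra.
(* Both p and s are L^2 limits of the same partial sums, one of them with the index shifted. *)
have uniq (p s : R -> R) (Sn : nat -> R -> R) c : L2r p -> L2r s -> (forall n, L2r (Sn n)) ->
    (forall n, I (fun x => (p x - Sn n.+1 x) ^+ 2) <= c * 4^-1 ^+ n) ->
    (forall n, I (fun x => (s x - Sn n x) ^+ 2) <= c * 4^-1 ^+ n) -> aeq p s.
  move=> Lp Ls LSn h1 h2.
  have Lps := L2B Lp Ls.
  have c0 : 0 <= c.
    have := h2 0%N; rewrite expr0 mulr1; apply: le_trans.
    by apply: I_ge0 => x; exact: sqr_ge0.
  have est n : I (fun x => (p x - s x) ^+ 2) <= 4 * c * 4^-1 ^+ n.
    have Lx := L2B Lp (LSn n.+1); have Ly := L2B Ls (LSn n.+1).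
    have : I (fun x => (p x - s x) ^+ 2) <= I (fun x => 2 * (p x - Sn n.+1 x) ^+ 2 + 2 * (s x - Sn n.+1 x) ^+ 2).
      apply: I_le; [exact: Lps.2|by apply: itgD; apply: itgZ; [exact: Lx.2|exact: Ly.2]|].
      by move=> x; have := sqr_ge0 ((p x - Sn n.+1 x) + (s x - Sn n.+1 x)); nra.
    rewrite ID; [|by apply: itgZ; exact: Lx.2|by apply: itgZ; exact: Ly.2].
    rewrite !IZ; [|exact: Ly.2|exact: Lx.2] => /le_trans; apply.
    have := h1 n; have := h2 n.+1; rewrite exprS => k1 k2.
    have q0 : 0 <= c * 4^-1 ^+ n by rewrite mulr_ge0// exprn_ge0// invr_ge0.
    by lra.
  have ps0 : aeq (fun x => p x - s x) (fun=> 0).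
    apply: I_sqr_eq0 => //.
    have cv : 4 * c * 4^-1 ^+ n @[n --> \oo] --> 4 * c * 0.
      by apply: cvgMr; apply: cvg_expr; rewrite ger0_norm ?invr_ge0// invf_lt1// ltr1n.
    rewrite mulr0 in cv; rewrite -(cvg_lim (@Rhausdorff R) cv); apply: limr_ge.
      by apply/cvg_ex; eexists; exact: cv.
    exact: nearW.
  by apply: ae_imp ps0 _ => x /eqP; rewrite subr_eq0 => /eqP.
have K0 : 0 <= K by apply: I_ge0 => x; rewrite addr_ge0 ?sqr_ge0.
have q0 n : 0 <= K * 4^-1 ^+ n by rewrite mulr_ge0// exprn_ge0// invr_ge0.
have ua : aeq u.1.1.1 sa.
  apply: (uniq _ _ SA (8 * K)) => // n.
  have := diff n; rewrite Isum; [|exact: L2B|exact: L2B].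
  have : 0 <= I (fun x => (u.2.1.1 x - SB n.+1 x) ^+ 2) by apply: I_ge0 => x; exact: sqr_ge0.
  by have := q0 n; lra.
have ub : aeq u.2.1.1 sb.
  apply: (uniq _ _ SB (8 * K)) => // n.
  have := diff n; rewrite Isum; [|exact: L2B|exact: L2B].
  have : 0 <= I (fun x => (u.1.1.1 x - SA n.+1 x) ^+ 2) by apply: I_ge0 => x; exact: sqr_ge0.
  by have := q0 n; lra.
have uab : {ae mu, forall x, u.1.1.1 x = sa x /\ u.2.1.1 x = sb x} by apply: ae_imp2 ua ub _.
exists u.1.1.1, u.1.1.2, u.1.2, u.2.1.1, u.2.1.2, u.2.2; split.
- exact: oku.1.
- exact: oku.2.
- apply: ae_imp2 eu1 uab _ => x; rewrite /L1 /D1 /opr => E [Ea Eb].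
  have -> : P' x = P x + dP x by rewrite /dP; ring.
  have -> : Q' x = Q x + dQ x by rewrite /dQ; ring.
  by move: E; rewrite Ea Eb; lra.
- apply: ae_imp2 eu2 uab _ => x; rewrite /L2 /D2 /opr => E [Ea Eb].
  have -> : P' x = P x + dP x by rewrite /dP; ring.
  have -> : Q' x = Q x + dQ x by rewrite /dQ; ring.
  by move: E; rewrite Ea Eb; lra.
Qed.

(* Continuity method from P = 1 + p', Q = 0 to P = 0, Q = V. *)
Lemma solvable_V V : bounded_mfun V -> solvable (fun=> 0) V.
Proof.
move=> [mV [M hM]].
have M0 : 0 <= M by apply: le_trans (hM 0).
(* One step moves Q by at most M / N and P by at most 2 / N; both are below 1/4 once N > 4 M + 8. *)
pose N := (Num.bound (4 * M + 8)).+1.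
have NM : 4 * M + 8 < N%:R.
  apply: (@lt_trans _ _ (Num.bound (4 * M + 8))%:R); last by rewrite ltr_nat.
  by apply: archi_boundP; lra.
have N0 : 0 < N%:R :> R by rewrite ltr0n.
pose q x := 1 + djp x.
have q0 x : 0 <= q x by have := djp_le1 x; rewrite /q ler_norml; lra.
have q2 x : q x <= 2 by have := djp_le1 x; rewrite /q ler_norml; lra.
have mq : meas q by apply: measD; [exact: meas_cst|exact: meas_cont (@cont_djp R)].
have bq : bounded_mfun q by split => //; exists 2 => x; rewrite ger0_norm.
have bV : bounded_mfun V by split => //; exists M.
(* The path is linear, so P stays nonnegative along it, as the a priori estimate requires. *)
have main i : (i <= N)%N -> solvable (fun x => (1 - i%:R / N%:R) * q x) (fun x => (i%:R / N%:R) * V x).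
  elim: i => [_|i IH iN].
    move=> g1 g2 Lg1 Lg2.
    have [a [a1 [a2 [Ha Ea]]]] := base_solvable Lg1.
    have [b [b1 [b2 [Hb Eb]]]] := base_solvable Lg2.
    exists a, a1, a2, b, b1, b2; split => //.
      by apply: eq_aeq => x; rewrite -Ea /opr /q; ring.
    by apply: eq_aeq => x; rewrite -Eb /opr /q; ring.
  have d : i.+1%:R / N%:R = i%:R / N%:R + N%:R^-1 :> R.
    by rewrite -addn1 natrD mulrDl mul1r.
  apply: solvable_step (IH (ltnW iN)).
  - exact: bmZ.
  - exact: bmZ.
  - move=> x; rewrite mulr_ge0// subr_ge0 ler_pdivrMr// mul1r ler_nat; exact: ltnW.
  - exact: (bmZ _ bq).1.
  - exact: (bmZ _ bV).1.
  - move=> x; rewrite d; have -> : (1 - (i%:R / N%:R + N%:R^-1)) * q x - (1 - i%:R / N%:R) * q x = - (q x / N%:R) by ring.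
    rewrite normrN ger0_norm; last by apply: divr_ge0 => //; exact: ltW.
    rewrite ler_pdivrMr//.
    by have := q2 x; lra.
  - move=> x; rewrite d; have -> : (i%:R / N%:R + N%:R^-1) * V x - i%:R / N%:R * V x = V x / N%:R by ring.
    rewrite normrM normfV (gtr0_norm N0) ler_pdivrMr//.
    by have := hM x; lra.
have := main N (leqnn N); rewrite divff ?gt_eqF// subrr.
congr (solvable _ _); apply/funext => x; first by rewrite mul0r.
by rewrite mul1r.
Qed.

End Solvability.

(** * Weak derivatives *)

Section TestFunctions.
Variable R : realType.
Local Notation mu := (@lebesgue_measure R).
Implicit Types (f g h F G phi psi : R -> R) (s t x y : R).

(** For the gluing points of piecewise functions, where both pieces are flat to second order. *)
Lemma dquad f x (C : R) : (forall y, `|f y - f x| <= C * (y - x) ^+ 2) ->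
  is_derive x 1 f 0.
Proof.
move=> h; apply/is_derive1_caratheodory.
exists (fun y => (f y - f x) / (y - x)); split.
- move=> y; have [->|yx] := eqVneq y x; first by rewrite !subrr mulr0.
  by rewrite divfK// subr_eq0.
- have C0 : 0 <= C.
    by have := h (x + 1); rewrite addrAC subrr add0r expr1n mulr1; exact: le_trans.
  change ((fun y => (f y - f x) / (y - x)) @ x --> (f x - f x) / (x - x)).
  rewrite subrr mul0r; apply/cvgrPdist_le => e e0.
  have C1 : 0 < C + 1 by lra.
  near=> y; rewrite sub0r normrN normrM normfV.
  have [->|yx] := eqVneq y x; first by rewrite !subrr normr0 mul0r ltW.
  have yx0 : 0 < `|y - x| by rewrite normr_gt0 subr_eq0.
  rewrite ler_pdivrMr//; apply: le_trans (h y) _.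
  rewrite -real_normK ?num_real// expr2 mulrA ler_wpM2r//.
  have yd : `|y - x| <= e / (C + 1).
    rewrite distrC; near: y; apply: (@cvgr_dist_le _ _ _ _ _ (fun y => y) x); first exact: cvg_id.
    by rewrite divr_gt0.
  apply: (@le_trans _ _ (C * (e / (C + 1)))); first exact: ler_wpM2l.
  rewrite mulrA ler_pdivrMr//; nra.
- by rewrite subrr mul0r.
Unshelve. all: by end_near. Qed.

Lemma Cn_S n f : Cn n.+1 f <-> (forall x, derivable f x 1) /\ Cn n (f^`()).
Proof.
split=> [[d c]|[d0 [d c]]].
  split; first by move=> x; exact: (d 0%N).
  split; last by rewrite -derive1Sn.
  by move=> l x ln; rewrite -derive1Sn; exact: (d l.+1).
split; last by rewrite derive1Sn.
by move=> [|l] x ln; [exact: d0|rewrite derive1Sn; exact: d].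
Qed.

Lemma Cn_intro n f g : (forall x, is_derive x 1 f (g x)) -> Cn n g -> Cn n.+1 f.
Proof.
move=> fg Cg; apply/Cn_S; split; first by move=> x; exact: ex_derive.
have -> // : f^`() = g.
by apply/funext => x; rewrite derive1E; exact: derive_val.
Qed.

Lemma Cn_elim n f : Cn n.+1 f ->
  (forall x, is_derive x 1 f (f^`() x)) /\ Cn n (f^`()).
Proof.
move=> /Cn_S[d c]; split => // x; rewrite derive1E; exact/derivableP.
Qed.

Lemma derivable_cont f : (forall x, derivable f x 1) -> continuous f.
Proof.
by move=> d x; apply: differentiable_continuous; apply/derivable1_diffP.
Qed.

Lemma Cn_cont n f : Cn n f -> continuous f.
Proof. by case: n => [[]//|n /Cn_S[d _]]; exact: derivable_cont. Qed.

Lemma Cn_pred n f : Cn n.+1 f -> Cn n f.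
Proof.
elim: n f => [f /Cn_cont cf|n IH f /Cn_elim[d c]]; first by split.
exact: Cn_intro d (IH _ c).
Qed.

Lemma Cn_cst n (c : R) : Cn n (fun=> c : R).
Proof.
elim: n c => [|n IH] c; first by split => //; exact: cst_continuous.
exact: Cn_intro (fun x => dcst c x) (IH 0).
Qed.

Lemma CnD n f g : Cn n f -> Cn n g -> Cn n (fun x => f x + g x).
Proof.
elim: n f g => [|n IH] f g.
  move=> /Cn_cont cf /Cn_cont cg; split => // x; apply: cvgD; [exact: cf|exact: cg].
move=> /Cn_elim[df cf] /Cn_elim[dg cg].
exact: Cn_intro (fun x => dD (df x) (dg x)) (IH _ _ cf cg).
Qed.

Lemma CnM n f g : Cn n f -> Cn n g -> Cn n (fun x => f x * g x).
Proof.
elim: n f g => [|n IH] f g.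
  move=> /Cn_cont cf /Cn_cont cg; split => // x; apply: cvgM; [exact: cf|exact: cg].
move=> Cf Cg; have [df cf] := Cn_elim Cf; have [dg cg] := Cn_elim Cg.
apply: Cn_intro (fun x => dM (df x) (dg x)) _.
by apply: CnD; apply: IH => //; exact: Cn_pred.
Qed.

Lemma CnZ n (c : R) f : Cn n f -> Cn n (fun x => c * f x).
Proof. by move=> Cf; apply: CnM => //; exact: Cn_cst. Qed.

(* The functions t^-i exp(-1/t), extended by 0, are closed under derivation up
   to linear combinations. *)
Definition flat (i : nat) t : R := if 0 < t then t^-1 ^+ i * expR (- t^-1) else 0.

Lemma flat_ge0 i t : 0 <= flat i t.
Proof.
rewrite /flat; case: ifP => // t0; rewrite mulr_ge0 ?expR_ge0// exprn_ge0// invr_ge0 ltW//.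
Qed.

(** With n = i + 1, exp y = exp(y / n)^n >= (y / n)^n; at y = 1 / t this gives t^-i exp(-1/t) <= n^n
    t. *)
Lemma flat_le i t : flat i t <= i.+1%:R ^+ i.+1 * `|t|.
Proof.
rewrite /flat; case: ifPn => [t0|_]; last by rewrite mulr_ge0// exprn_ge0.
set n : R := i.+1%:R.
have n0 : 0 < n by rewrite ltr0n.
have e : (t^-1 / n) ^+ i.+1 <= expR (t^-1).
  have -> : expR (t^-1) = expR (t^-1 / n) ^+ i.+1.
    by rewrite -expRM_natr divfK// gt_eqF.
  rewrite lerXn2r ?nnegrE ?expR_ge0 ?divr_ge0 ?invr_ge0 ?ltW//.
  by apply: lt_le_trans (expR_ge1Dx _); rewrite ltrDr.
rewrite expRN gtr0_norm//.
rewrite ler_pdivrMr ?expR_gt0//.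
apply: (@le_trans _ _ (n ^+ i.+1 * t * (t^-1 / n) ^+ i.+1)); last first.
  by rewrite ler_wpM2l// mulr_ge0 ?exprn_ge0// ltW.
rewrite le_eqVlt; apply/orP; left; apply/eqP.
rewrite exprMn.
have -> : n ^+ i.+1 * t * (t^-1 ^+ i.+1 * n^-1 ^+ i.+1) =
    n ^+ i.+1 * n^-1 ^+ i.+1 * (t^-1 ^+ i.+1 * t) by ring.
by rewrite -exprMn divff ?gt_eqF// expr1n mul1r exprSr -mulrA mulVf ?gt_eqF// mulr1.
Qed.

Lemma flatS i t : flat i t = t * flat i.+1 t.
Proof.
rewrite /flat; case: ifP => t0; last by rewrite mulr0.
by rewrite exprS !mulrA divff ?mul1r// gt_eqF.
Qed.

Lemma flat_le1 t : flat 0 t <= 1.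
Proof.
rewrite /flat expr0; case: ifP => t0 //.
by rewrite mul1r -[X in _ <= X]expR0 ler_expR oppr_le0 invr_ge0 ltW.
Qed.

Lemma is_derive_flat i t : is_derive t 1 (flat i) (- i%:R * flat i.+1 t + flat i.+2 t).
Proof.
have [t0|t0|->] := ltgtP t 0.
- have -> : - i%:R * flat i.+1 t + flat i.+2 t = 0 :> R.
    by rewrite /flat (lt_gtF t0) mulr0 addr0.
  apply: dnear (dcst 0 t); near=> y; rewrite /flat ifF//.
  by apply/negbTE; rewrite -leNgt ltW//; near: y; exact: lt_nbhsl.
- have d1 : is_derive t 1 (fun y : R => y^-1) (- t^-2).
    have := @is_deriveV R (fun y => y) t 1 1 _ (did t).
    by rewrite gt_eqF// => /(_ isT) H; apply: is_derive_eq H _; rewrite /GRing.scale /= mulr1.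
  have d2 n : is_derive t 1 (fun y : R => y^-1 ^+ n) (- n%:R * t^-1 ^+ n.+1).
    elim: n => [|n IH].
      by rewrite mulNr mul0r oppr0; exact: dcst.
    have H := dM d1 IH; under eq_fun do rewrite exprS.
    apply: is_derive_eq H _; rewrite -natr1 -exprVn !exprS expr0; ring.
  have d3 : is_derive t 1 (fun y : R => - y^-1) (t^-2).
    have := dZ (-1) d1; rewrite mulN1r opprK.
    by under eq_fun do rewrite mulN1r.
  have d4 := dM (d2 i) (dcomp (is_derive_expR _) d3).
  have -> : - i%:R * flat i.+1 t + flat i.+2 t =
      - i%:R * t^-1 ^+ i.+1 * expR (- t^-1) + t^-1 ^+ i * (expR (- t^-1) * t^-2).
    by rewrite /flat t0 -exprVn !exprS; ring.
  apply: dnear d4; near=> y; rewrite /flat ifT//.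
  by near: y; exact: lt_nbhsr.
- have -> : - i%:R * flat i.+1 0 + flat i.+2 0 = 0 :> R.
    by rewrite /flat ltxx mulr0 addr0.
  (* At 0, [flatS] and [flat_le] give a bound by a multiple of y^2. *)
  apply: (@dquad _ _ (i.+2%:R ^+ i.+2)) => y.
  have -> : flat i 0 = 0 by rewrite /flat ltxx.
  rewrite !subr0 flatS normrM (ger0_norm (flat_ge0 _ _)).
  apply: le_trans (ler_wpM2l (normr_ge0 _) (flat_le i.+1 y)) _.
  by rewrite mulrCA -expr2 real_normK ?num_real.
Unshelve. all: by end_near. Qed.

Lemma Cn_flat n i s t : Cn n (fun x => flat i (s * x + t)).
Proof.
have d j x : is_derive x 1 (fun x => flat j (s * x + t))
    ((- j%:R * flat j.+1 (s * x + t) + flat j.+2 (s * x + t)) * s).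
  have d1 : is_derive x 1 (fun x => s * x + t) s.
    by apply: is_derive_eq (dD (dZ s (did x)) (dcst t x)) _; rewrite mulr1 addr0.
  exact: dcomp (is_derive_flat j _) d1.
elim: n i => [|n IH] i.
  split => //; apply: derivable_cont => x; exact: ex_derive.
apply: Cn_intro (d i) _.
by apply: CnM; [apply: CnD => //; exact: CnZ|exact: Cn_cst].
Qed.

(** The smooth function exp(-1 / (n (x - a))) exp(-1 / (n (b - x))) on (a, b), extended by 0; it
    tends to the indicator of (a, b) as n grows. *)
Definition bump (n : nat) a b x : R := flat 0 (n%:R * x + - (n%:R * a)) * flat 0 (- n%:R * x + n%:R * b).

Lemma bump_ge0 n a b x : 0 <= bump n a b x.
Proof. by rewrite mulr_ge0 ?flat_ge0. Qed.

Lemma bump_le n a b x : bump n a b x <= ind a b x.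
Proof.
rewrite /ind; have [ax|xa] /= := ltP a x; last first.
  rewrite /bump /flat ifF ?mul0r//; apply/negbTE; rewrite -leNgt.
  by rewrite -mulrBr mulr_ge0_le0// subr_le0.
have [xb|bx] := leP x b; last first.
  rewrite /bump [X in _ * X]/flat ifF ?mulr0//; apply/negbTE; rewrite -leNgt.
  by rewrite mulNr addrC -mulrBr mulr_ge0_le0// subr_le0 ltW.
by rewrite -[X in _ <= X]mulr1 ler_pM ?flat_ge0 ?flat_le1.
Qed.

Lemma bump_test n a b : test_function (bump n a b).
Proof.
split; first by move=> m; apply: CnM; exact: Cn_flat.
exists (`|a| + `|b|) => x xab; apply/eqP; rewrite eq_le bump_ge0 andbT.
apply: le_trans (bump_le n a b x) _; rewrite /ind; case: (boolP (_ && _)) => // /andP[ax xb].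
have : `|x| <= `|a| + `|b|.
  rewrite ler_norml; have := ler_norm b; have := ler_norm (- a); rewrite normrN.
  by have := normr_ge0 a; have := normr_ge0 b => *; apply/andP; split; lra.
by rewrite leNgt xab.
Qed.

Lemma bump_cvg a b x : a < x -> x < b -> bump n a b x @[n --> \oo] --> (1 : R).
Proof.
move=> ax xb.
have c (d : R) : 0 < d -> flat 0 (n%:R * d) @[n --> \oo] --> (1 : R).
  move=> d0.
  have c1 : expR (- (n.+1%:R^-1 * d^-1)) @[n --> \oo] --> expR (- (0 * d^-1)).
    apply: (@cvg_comp _ _ _ (fun n => - (n.+1%:R^-1 * d^-1) : R) expR); last exact: continuous_expR.
    by apply: cvgN; apply: cvgMl; exact: cvg_harmonic.
  rewrite mul0r oppr0 expR0 in c1.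
  rewrite -(cvg_shiftS (fun n => flat 0 (n%:R * d))).
  apply: cvg_trans c1; apply: near_eq_cvg; apply: nearW => n.
  by rewrite /= /flat expr0 mul1r ifT ?invfM// mulr_gt0.
rewrite -[1]mulr1; apply: cvgM.
  have := c (x - a); rewrite subr_gt0 => /(_ ax).
  by under eq_fun do rewrite mulrBr.
have := c (b - x); rewrite subr_gt0 => /(_ xb).
by under eq_fun do rewrite mulrBr addrC -mulNr.
Qed.

Lemma test_elim phi : test_function phi -> exists M : R,
  [/\ 0 < M, AC phi (phi^`()), continuous (phi^`()),
    (forall x, M < `|x| -> phi x = 0) & (forall x, M < `|x| -> phi^`() x = 0)].
Proof.
move=> [Cp [M HM]]; exists (`|M| + 1).
have [d1 c1] := Cn_elim (Cp 1%N).
have big x : `|M| + 1 < `|x| -> M < `|x|.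
  by have := ler_norm M; lra.
split => //.
- by apply: C1_AC => //; exact: Cn_cont c1.
- exact: Cn_cont c1.
- by move=> x /big; exact: HM.
- move=> x /big xM.
  have : is_derive x 1 phi 0.
    apply: dnear (dcst 0 x); near=> y; apply: HM; near: y.
    have /cvgr_gt := @norm_continuous _ _ x; exact.
  by rewrite derive1E => d; exact: derive_val.
Unshelve. all: by end_near. Qed.

Lemma itg_compact h phi (M : R) : loc_itg h -> (exists psi, AC phi psi) ->
  (forall x, M < `|x| -> phi x = 0) -> itg (fun x => h x * phi x).
Proof.
move=> lh [psi Ap] HM.
have L := (loc_itgM Ap lh).2 (- (`|M| + 1)) (`|M| + 1).
apply: eq_itg L => x; rewrite /ind.
case: (boolP (_ && _)) => [_|]; first by rewrite mul1r mulrC.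
move=> nx; rewrite mul0r HM ?mulr0//.
by move: nx; rewrite negb_and -ltNge -leNgt; have := ler_norm M; have := ler_norm x; have := ler_norm (- x); rewrite normrN => ? ? ? /orP[]; lra.
Qed.

(** Cut to (- n, n], h has a vanishing primitive from -oo, so it is 0 a.e. by Lebesgue
    differentiation; the null sets for all n are then united. *)
Lemma AC_unique0 h : AC (fun=> 0) h -> aeq h (fun=> 0).
Proof.
move=> A0.
have K (n : nat) : {ae mu, forall x, ind (- n%:R) n%:R x * h x = 0}.
  pose k x := ind (- n%:R) n%:R x * h x.
  have ik : itg k := AC_itg _ _ A0.
  have lk : locally_integrable [set: R] k.
    by have := integrable_locally measurableT ik; rewrite patch_setT.
  have iy y : mu.-integrable `]-oo, y] (EFin \o k).
    by apply: integrableS ik.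
  apply: ae_imp (FTC1Ny iy lk) _ => x [_ E0]; rewrite -/(k x) -E0.
  have -> : (fun x : R => \int[mu]_(t in `]-oo, x]) k t) = fun=> 0.
    apply/funext => y; rewrite Rintegral_mkcond.
    have E : (k \_ `]-oo, y]) =1 (fun t => ind (- n%:R) (Num.min y n%:R) t * h t).
      move=> t; rewrite /patch mem_setE in_itv /= /k /ind le_min.
      case: (t <= y) => /=; first by [].
      by rewrite andbF mul0r.
    rewrite -/(I _) (eqI E).
    have [le|lt] := leP (- n%:R) (Num.min y n%:R).
      by rewrite -A0.2// subrr.
    rewrite (@eqI _ _ (fun=> 0)) ?I0// => t.
    by rewrite ind_empty ?mul0r// ltW.
  by rewrite derive1_cst.
have [N HN] := choice K.
have : mu.-negligible (\bigcup_n [set x | ind (- n%:R) n%:R x * h x <> 0]).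
  apply: negligible_bigcup => n; have := K n; apply: negligibleS => x /=; exact.
apply: negligibleS => x /= hx.
exists (Num.bound `|x|) => //=; rewrite /ind.
have := archi_boundP (normr_ge0 x); rewrite ltr_norml => /andP[-> /ltW ->].
by rewrite mul1r.
Qed.

(** Testing with [bump n a b] and letting n grow, dominated convergence gives integral 0 over every
    interval; hence h is a density of the zero function. *)
Lemma fundamental_lemma h : loc_itg h ->
  (forall phi, test_function phi -> I (fun x => h x * phi x) = 0) -> aeq h (fun=> 0).
Proof.
move=> lh H; apply: AC_unique0; split => // a b ab; rewrite subrr; apply/esym.
have ib : itg (fun x => `|ind a b x * h x|) := itg_abs (lh.2 a b).
have bump0 n x : (x <= a) || (b <= x) -> bump n a b x = 0.
  move=> /orP[xa|bx]; rewrite /bump /flat.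
    rewrite ifF ?mul0r//; apply/negbTE; rewrite -leNgt.
    by rewrite -mulrBr mulr_ge0_le0// subr_le0.
  rewrite [X in _ * X]ifF ?mulr0//; apply/negbTE; rewrite -leNgt.
  by rewrite mulNr addrC -mulrBr mulr_ge0_le0// subr_le0.
have ae1 : {ae mu, forall x, h x * bump n a b x @[n --> \oo] --> ind a b x * h x}.
  apply: ae_imp (@ae_ne _ b) _ => x xb.
  have [ax|xa] := ltP a x; last first.
    by apply: cvg_near_cst; apply: nearW => n; rewrite bump0 ?xa// /ind ltNge xa mul0r mulr0.
  have [xlb|bx|//] := ltgtP x b.
    rewrite /ind ax (ltW xlb) mul1r -[X in _ --> X]mulr1.
    by apply: cvgMr; exact: bump_cvg.
  apply: cvg_near_cst; apply: nearW => n; rewrite bump0 ?(ltW bx) ?orbT//.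
  by rewrite /ind (leNgt x) bx andbF mul0r mulr0.
have le1 n x : `|h x * bump n a b x| <= `|ind a b x * h x|.
  rewrite (normrM (h x)) (normrM (ind a b x)) mulrC ler_wpM2r//.
  rewrite (ger0_norm (bump_ge0 _ _ _ _)) (ger0_norm (ind_ge0 _ _ _)).
  exact: bump_le.
have m1 n : meas (fun x => h x * bump n a b x).
  by apply: measM lh.1 _; apply: meas_cont; exact: Cn_cont ((bump_test n a b).1 0%N).
have [_ cv] := I_dct m1 (itg_meas (lh.2 a b)) ae1 ib le1.
rewrite -(cvg_lim (@Rhausdorff R) cv).
by under eq_fun do rewrite (H _ (bump_test _ _ _)); rewrite lim_cst.
Qed.

End TestFunctions.

(** * Absolutely continuous representatives of weakly differentiable functions *)

Section WeakDerivatives.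
Variable R : realType.
Implicit Types (f g h F G phi psi u v : R -> R) (s t x y : R).

Definition weak_deriv u v := forall phi, test_function phi ->
  I (fun x => u x * derive1 phi x) = - I (fun x => v x * phi x).

Lemma test_itg h phi : loc_itg h -> test_function phi -> itg (fun x => h x * phi x).
Proof.
move=> lh /test_elim[M [_ Ap _ HM _]].
by apply: itg_compact HM => //; exists (derive1 phi).
Qed.

Lemma test_deriv phi : test_function phi -> test_function (derive1 phi).
Proof.
move=> tp; have [M [_ _ _ _ HM]] := test_elim tp; split; last by exists M.
by move=> n; have [_] := Cn_elim (tp.1 n.+1).
Qed.

Lemma AC_weak F h : AC F h -> weak_deriv F h.
Proof.
move=> AF phi tp; have [M [M0 Ap cp HM HM']] := test_elim tp.
have lh := AF.1; have lF : loc_itg F := cont_loc_itg (AC_cont AF).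
have i1 := test_itg lh tp; have i2 := test_itg lF (test_deriv tp).
have AFp := ACM AF Ap.
have iF : itg (fun x => F x * phi x) := test_itg lF tp.
have := I_deriv0 AFp iF (itgD i1 i2).
by rewrite ID//; lra.
Qed.

Lemma L2_loc h : L2r h -> loc_itg h.
Proof.
move=> Lh; split; first exact: Lh.1.
move=> a b; apply: itg_le (itgD (itg_indab a b) Lh.2).
  by apply: measM Lh.1; exact: meas_indab.
move=> x; rewrite normrM (ger0_norm (ind_ge0 _ _ _)) -[h x ^+ 2]real_normK ?num_real//.
rewrite /ind; case: (_ && _); rewrite ?mul1r ?mul0r; last by rewrite add0r sqr_ge0.
have -> : (true%:R : R) = 1 by [].
by have := sqr_ge0 (`|h x| - 1); nra.
Qed.

Lemma weak_unique u v v' : loc_itg v -> loc_itg v' -> weak_deriv u v -> weak_deriv u v' ->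
  aeq v v'.
Proof.
move=> lv lv' H H'.
have lvv : loc_itg (fun x => v x + (-1) * v' x) by apply: loc_itgD => //; exact: loc_itgZ.
have E : aeq (fun x => v x + (-1) * v' x) (fun=> 0).
  apply: fundamental_lemma => // phi tp.
  have i1 := test_itg lv tp; have i2 := test_itg lv' tp.
  rewrite (@eqI _ _ (fun x => v x * phi x - v' x * phi x)); last by move=> x; ring.
  by rewrite IB//; have := H phi tp; have := H' phi tp; lra.
by apply: ae_imp E _ => x; lra.
Qed.

Lemma test_itg0 : exists rho : R -> R, test_function rho /\ I rho = 1.
Proof.
have t1 := @bump_test R 1 0 1; have [M [_ A1 _ HM _]] := test_elim t1.
have i1 : itg (@bump R 1 0 1).
  have l1 : loc_itg (fun=> 1 : R) by apply: cont_loc_itg; exact: cst_continuous.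
  by apply: eq_itg (test_itg l1 t1) => x; rewrite mul1r.
have p : 0 < I (@bump R 1 0 1).
  rewrite lt_neqAle eq_sym I_ge0 ?andbT; last by move=> x; exact: bump_ge0.
  apply/negP => /eqP z.
  have := aeq0_AC A1 (I_eq0 (fun x => bump_ge0 _ _ _ _) i1 z) 2^-1.
  have d1 : (1 * 2^-1 + - (1 * 0) : R) = 2^-1 by field.
  have d2 : (-1 * 2^-1 + 1 * 1 : R) = 2^-1 by field.
  rewrite /bump d1 d2 /flat ifT ?invr_gt0// => /eqP.
  by rewrite mulf_eq0 orbb expr0 mul1r gt_eqF// expR_gt0.
exists (fun x => (I (@bump R 1 0 1))^-1 * @bump R 1 0 1 x); split.
  split; first by move=> n; apply: CnZ; exact: t1.1.
  by exists M => x xM; rewrite HM// mulr0.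
by rewrite IZ// mulVf// gt_eqF.
Qed.

(** Mean zero is what makes the primitive from the left of the support vanish again on its right. *)
Lemma test_primitive zeta : test_function zeta -> I zeta = 0 ->
  exists phi, test_function phi /\ derive1 phi = zeta.
Proof.
move=> tz z0; have [M [M0 Az _ HM _]] := test_elim tz.
have cz : continuous zeta := AC_cont Az.
have [Phi AP] := AC_exists (cont_loc_itg cz).
have dP := is_derive_primitive cz AP.
pose phi x := Phi x - Phi (- (M + 1)).
have dp x : is_derive x 1 phi (zeta x).
  by apply: is_derive_eq (dD (dP x) (dcst (- Phi (- (M + 1))) x)) _; rewrite addr0.
exists phi; split; last first.
  by apply/funext => x; rewrite derive1E; exact: derive_val.
split.
  move=> [|n]; first by split => //; apply: derivable_cont => x; exact: ex_derive.
  exact: Cn_intro dp (tz.1 n).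
exists (M + 1) => x xM; rewrite /phi.
have [x0|x0] := leP x 0.
  have xM' : x <= - (M + 1) by move: xM; rewrite ler0_norm//; lra.
  rewrite -[LHS]opprK opprB AP.2// (@eqI _ _ (fun=> 0)) ?I0 ?oppr0// => y.
  rewrite /ind; case: (boolP (_ && _)) => [/andP[xy yM]|_]; last by rewrite mul0r.
  by rewrite HM ?mulr0// ler0_norm; lra.
have xM' : M + 1 <= x by move: xM; rewrite gtr0_norm//; lra.
rewrite AP.2; last by lra.
rewrite -[RHS]z0; apply: eqI => y; rewrite /ind.
case: (boolP (_ && _)) => [_|]; first by rewrite mul1r.
rewrite negb_and -leNgt -ltNge mul0r => H; apply/esym/HM; case/orP: H => H.
  by rewrite ler0_norm; lra.
by rewrite gtr0_norm; lra.
Qed.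

(** du Bois-Reymond: with [rho] of integral 1, psi minus (integral of psi) rho has mean zero, hence
    is the derivative of a test function. So h - c is orthogonal to every psi, where c is the
    integral of h rho. *)
Lemma weak_const h : loc_itg h ->
  (forall phi, test_function phi -> I (fun x => h x * derive1 phi x) = 0) ->
  exists c : R, aeq h (fun=> c).
Proof.
move=> lh H; have [rho [tr r1]] := test_itg0.
pose c := I (fun x => h x * rho x); exists c.
have l1 : loc_itg (fun=> 1 : R) by apply: cont_loc_itg; exact: cst_continuous.
have lc : loc_itg (fun x => h x + (- c) * 1) by apply: loc_itgD => //; exact: loc_itgZ.
have E : aeq (fun x => h x + (- c) * 1) (fun=> 0).
  apply: fundamental_lemma => // psi tp.
  have ip : itg psi by apply: eq_itg (test_itg l1 tp) => x; rewrite mul1r.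
  have ir : itg rho by apply: eq_itg (test_itg l1 tr) => x; rewrite mul1r.
  have tz : test_function (fun x => psi x + (- I psi) * rho x).
    split; first by move=> n; apply: CnD; [exact: tp.1|apply: CnZ; exact: tr.1].
    have [M [_ _ _ HM _]] := test_elim tp; have [N [_ _ _ HN _]] := test_elim tr.
    exists (Num.max M N) => x; rewrite gt_max => /andP[xM xN].
    by rewrite HM// HN// mulr0 addr0.
  have z0 : I (fun x => psi x + (- I psi) * rho x) = 0.
    by rewrite ID ?IZ ?r1//; [ring|exact: itgZ].
  have [phi [tphi dphi]] := test_primitive tz z0.
  have := H phi tphi; rewrite dphi.
  rewrite (@eqI _ _ (fun x => h x * psi x + (- I psi) * (h x * rho x))); last by move=> x; ring.
  have i1 := test_itg lh tp; have i2 := test_itg lh tr.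
  rewrite ID ?IZ//; last exact: itgZ.
  rewrite -/c (@eqI _ (fun x => (h x + - c * 1) * psi x) (fun x => h x * psi x + (- c) * psi x)); last first.
    by move=> x; ring.
  by rewrite ID ?IZ//; [lra|exact: itgZ].
by apply: ae_imp E _ => x; lra.
Qed.

(* A weak derivative determines [u] up to a constant ([weak_const]). *)
Lemma weak_AC u v : loc_itg u -> loc_itg v -> weak_deriv u v ->
  exists F, AC F v /\ aeq u F.
Proof.
move=> lu lv W; have [G AG] := AC_exists lv.
have lG : loc_itg G := cont_loc_itg (AC_cont AG).
have lw : loc_itg (fun x => u x + (-1) * G x) by apply: loc_itgD => //; exact: loc_itgZ.
have [c ec] : exists c : R, aeq (fun x => u x + (-1) * G x) (fun=> c).
  apply: weak_const => // phi tp.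
  have i1 := test_itg lu (test_deriv tp); have i2 := test_itg lG (test_deriv tp).
  rewrite (@eqI _ _ (fun x => u x * derive1 phi x - G x * derive1 phi x)); last by move=> x; ring.
  by rewrite IB//; have := W phi tp; have := AC_weak AG tp; lra.
have Ac : AC (fun=> c) (fun=> 0).
  by apply: C1_AC; exact: cst_continuous.
exists (fun x => G x + c); split; last by apply: ae_imp ec _ => x; lra.
by apply: eq_AC (ACD AG Ac) => // x; rewrite addr0.
Qed.

End WeakDerivatives.

(** * Complex functions *)

Section Components.
Variable R : realType.
Local Notation C := R[i].
Local Notation mu := (@lebesgue_measure R).
Implicit Types (u v w : R -> C) (x y t : R).

Definition re u x : R := complex.Re (u x).
Definition im u x : R := complex.Im (u x).
Definition mkc (a b : R -> R) x : C := Complex (a x) (b x).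

Lemma L2normE u : L2norm u = ((\int[mu]_x (re u x ^+ 2 + im u x ^+ 2)%:E) `^ 2^-1)%E.
Proof.
rewrite /L2norm unlock; congr (_ `^ _)%E; apply: eq_integral => x _.
rewrite /= /re /im; case: (u x) => p q /=.
rewrite ger0_norm ?sqrtr_ge0// -[2 in LHS]/(2%:R) powR_mulrn ?sqrtr_ge0//.
by rewrite sqr_sqrtr// addr_ge0 ?sqr_ge0.
Qed.

Lemma L2P u : L2 u <-> L2r (re u) /\ L2r (im u).
Proof.
split=> [[m1 m2]|[[m1 i1] [m2 i2]]].
  have m1' : meas (re u) := m1; have m2' : meas (im u) := m2.
  rewrite L2normE => fin.
  have it : itg (fun x => re u x ^+ 2 + im u x ^+ 2).
    apply/integrableP; split; first by apply: measE; apply: measD; exact: measX.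
    under eq_integral do rewrite /= ger0_norm ?addr_ge0 ?sqr_ge0//.
    rewrite ltey; apply/eqP => E; move: fin; rewrite E poweRyr// invr_neq0.
  split; split => //; apply: itg_le it; rewrite ?addr_ge0//; try exact: measX.
    by move=> x; rewrite ger0_norm ?sqr_ge0// lerDl sqr_ge0.
  by move=> x; rewrite ger0_norm ?sqr_ge0// lerDr sqr_ge0.
split => //; rewrite L2normE.
have it := itgD i1 i2.
rewrite -(fineK (integrable_fin_num measurableT it)) poweR_EFin; exact: ltry.
Qed.

Lemma L2norm_sqrt u : L2 u ->
  L2norm u = (Num.sqrt (I (fun x => re u x ^+ 2 + im u x ^+ 2)))%:E.
Proof.
move=> /L2P[[_ i1] [_ i2]]; have it := itgD i1 i2.
rewrite L2normE -(fineK (integrable_fin_num measurableT it)) poweR_EFin.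
rewrite powR12_sqrt// fine_ge0// integral_ge0// => x _.
by rewrite lee_fin addr_ge0 ?sqr_ge0.
Qed.

Lemma aeP u v : ae_equal u v <-> aeq (re u) (re v) /\ aeq (im u) (im v).
Proof.
split=> [H|[H1 H2]].
  by split; apply: ae_imp H _ => x; rewrite /re /im => ->.
apply: ae_imp2 H1 H2 _ => x; rewrite /re /im.
by case: (u x) (v x) => [a b] [c d] /= -> ->.
Qed.

Lemma weakP u v : is_weak_derivative u v <->
  weak_deriv (re u) (re v) /\ weak_deriv (im u) (im v).
Proof.
have Ere (w : R -> C) (p : R -> R) : \int[mu]_x complex.Re (w x * (p x)%:C%C) = I (fun x => re w x * p x).
  by apply: eqI => x; rewrite /re; case: (w x) => a b /=; rewrite mulr0 subr0.
have Eim (w : R -> C) (p : R -> R) : \int[mu]_x complex.Im (w x * (p x)%:C%C) = I (fun x => im w x * p x).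
  by apply: eqI => x; rewrite /im; case: (w x) => a b /=; rewrite mulr0 add0r.
split=> [H|[H1 H2] phi tp].
  split=> phi tp; have := H phi tp; rewrite /cintegral !Ere !Eim => -[].
    by move=> -> _.
  by move=> _ ->.
rewrite /cintegral !Ere !Eim H1// H2//.
Qed.

Lemma weakD_spec u v : L2 v -> is_weak_derivative u v ->
  [/\ L2 (weakD u), is_weak_derivative u (weakD u) & ae_equal (weakD u) v].
Proof.
move=> Lv Wv; have [L W] : L2 (weakD u) /\ is_weak_derivative u (weakD u).
  by apply: (xgetPex (cst 0) (P := [set v | L2 v /\ is_weak_derivative u v])); exists v.
split => //; apply/aeP.
have [W1 W2] := (weakP _ _).1 W; have [V1 V2] := (weakP _ _).1 Wv.
have [L1 L2'] := (L2P _).1 L; have [M1 M2] := (L2P _).1 Lv.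
by split; [apply: weak_unique W1 V1|apply: weak_unique W2 V2]; exact: L2_loc.
Qed.

Lemma weak_deriv_ae (a a' b : R -> R) : meas a -> meas a' -> aeq a a' -> weak_deriv a b -> weak_deriv a' b.
Proof.
move=> ma ma' e H phi tp; rewrite -H//; apply: I_ae.
- by apply: measM => //; apply: meas_cont; exact: Cn_cont ((test_deriv tp).1 0%N).
- by apply: measM => //; apply: meas_cont; exact: Cn_cont ((test_deriv tp).1 0%N).
- by apply: ae_imp e _ => x ->.
Qed.

(** Representatives are built from the top: the weak derivative gets a1, then u gets a, whose
    density may be changed a.e. into a1. The second derivative is kept as [weakD] chose it. *)
Lemma Hdom_repr u : Hdom u -> exists a a1 a2 b b1 b2,
  [/\ H2w a a1 a2, H2w b b1 b2, ae_equal u (mkc a b) &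
     ae_equal (weakD (weakD u)) (mkc a2 b2)].
Proof.
move=> [[[Lu [v [Lv Wv]]] [LDu [w [Lw Ww]]]] Lx].
have [_ W1 _] := weakD_spec Lv Wv.
have [LDDu W2 _] := weakD_spec Lw Ww.
have rep (p q r : R -> R) : L2r p -> L2r q -> L2r r -> L2r (fun x => x ^+ 2 * p x) ->
    weak_deriv p q -> weak_deriv q r ->
    exists a a1, H2w a a1 r /\ aeq p a.
  move=> Lp Lq Lr Lxp Wp Wq.
  have [a1 [Aa1 ea1]] := weak_AC (L2_loc Lq) (L2_loc Lr) Wq.
  have [a [Aa ea]] := weak_AC (L2_loc Lp) (L2_loc Lq) Wp.
  exists a, a1; split => //; split.
  - exact: AC_ae (AC_meas Aa1) ea1 Aa.
  - exact: Aa1.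
  - exact: L2_ae (AC_meas Aa) ea Lp.
  - exact: L2_ae (AC_meas Aa1) ea1 Lq.
  - split => //; apply: L2_ae Lxp.
      by apply: measM (AC_meas Aa); apply: measX; exact: meas_id.
    by apply: ae_imp ea _ => x ->.
have [Wp1 Wq1] := (weakP _ _).1 W1; have [Wp2 Wq2] := (weakP _ _).1 W2.
have [L1 L1'] := (L2P _).1 Lu; have [M1 M1'] := (L2P _).1 LDu; have [N1 N1'] := (L2P _).1 LDDu.
have [X1 X1'] := (L2P _).1 Lx.
have X1r : L2r (fun x => x ^+ 2 * re u x).
  by apply: eq_L2 X1 => x; rewrite /re; case: (u x) => p q /=; rewrite mul0r subr0.
have X1i : L2r (fun x => x ^+ 2 * im u x).
  by apply: eq_L2 X1' => x; rewrite /im; case: (u x) => p q /=; rewrite mul0r addr0.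
have [a [a1 [Ha ea]]] := rep _ _ _ L1 M1 N1 X1r Wp1 Wp2.
have [b [b1 [Hb eb]]] := rep _ _ _ L1' M1' N1' X1i Wq1 Wq2.
exists a, a1, (re (weakD (weakD u))), b, b1, (im (weakD (weakD u))); split => //.
  exact/aeP.
by apply/aeP; split; exact: eq_aeq.
Qed.

Lemma Hdom_intro (a a1 a2 b b1 b2 : R -> R) : H2w a a1 a2 -> H2w b b1 b2 ->
  Hdom (mkc a b) /\ ae_equal (weakD (weakD (mkc a b))) (mkc a2 b2).
Proof.
move=> [A1 A2 L1 L2' [L3 L4]] [B1 B2 M1 M2 [M3 M4]].
have Lu : L2 (mkc a b) by apply/L2P.
have Lv : L2 (mkc a1 b1) by apply/L2P.
have Lw : L2 (mkc a2 b2) by apply/L2P.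
have W1 : is_weak_derivative (mkc a b) (mkc a1 b1).
  by apply/weakP; split; exact: AC_weak.
have [LD WD eD] := weakD_spec Lv W1.
have [e1 e2] := (aeP _ _).1 eD.
have [LD1 LD2] := (L2P _).1 LD.
(* The chosen first derivative agrees with a1 + i b1 only a.e., so the weak derivative is
   transferred along that equality. *)
have W2 : is_weak_derivative (weakD (mkc a b)) (mkc a2 b2).
  apply/weakP; split.
    by apply: weak_deriv_ae (AC_weak A2); [exact: L2'.1|exact: LD1.1|exact: aeq_sym e1].
  by apply: weak_deriv_ae (AC_weak B2); [exact: M2.1|exact: LD2.1|exact: aeq_sym e2].
have [_ _ eDD] := weakD_spec Lw W2.
split => //; split; last first.
  apply/L2P; split.
    by apply: eq_L2 L4 => x; rewrite /re /= mul0r subr0.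
  by apply: eq_L2 M4 => x; rewrite /im /= mul0r addr0.
split; split => //.
  by exists (mkc a1 b1).
by exists (mkc a2 b2).
Qed.

Lemma Hshift_comp (f : R -> R) (eps lam : R) u (a b a2 b2 : R -> R) : eps != 0 ->
  ae_equal u (mkc a b) -> ae_equal (weakD (weakD u)) (mkc a2 b2) ->
  ae_equal (Hshift f eps lam u)
    (mkc (opr (fun=> 0) (fun x => f x / eps - lam) a a2 b)
         (opr (fun=> 0) (fun x => - (f x / eps - lam)) b b2 a)).
Proof.
move=> e0 eu ew; apply: ae_imp2 eu ew _ => x; rewrite /Hshift /Hop => -> ->.
rewrite /mkc /opr -fmorphV /=.
by apply/eqP; rewrite eq_complex /=; apply/andP; split; apply/eqP; ring.
Qed.

End Components.

(** * Sublevel sets of the potential *)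

Section Sublevel.
Variable R : realType.
Implicit Types (f g : R -> R) (s t x y r : R) (A E : set R).

Lemma mvt f g (a b : R) : (forall x, is_derive x 1 f (g x)) -> a < b ->
  exists c, [/\ a < c, c < b & f b - f a = g c * (b - a)].
Proof.
move=> d ab; have [|c] := MVT ab (fun x _ => d x).
  by apply: continuous_subspaceT; apply: derivable_cont => x; exact: ex_derive.
by rewrite in_itv /= => /andP[ac cb] e; exists c.
Qed.

Definition covered (n : nat) (d : R) E :=
  exists cs : seq R, (size cs <= n)%N /\ forall x, E x -> exists2 c, c \in cs & `|x - c| < d.

Lemma covered_sub n d E E' : (forall x, E x -> E' x) -> covered n d E' -> covered n d E.
Proof. by move=> sub [cs [sz H]]; exists cs; split => // x /sub; exact: H. Qed.

Lemma covered_radius n d d' E : d <= d' -> covered n d E -> covered n d' E.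
Proof.
move=> dd [cs [sz H]]; exists cs; split => // x /H[c cin xc]; exists c => //.
exact: lt_le_trans dd.
Qed.

Lemma coveredU n m d E E' : covered n d E -> covered m d E' ->
  covered (n + m) d [set x | E x \/ E' x].
Proof.
move=> [cs [sz H]] [cs' [sz' H']]; exists (cs ++ cs'); split.
  by rewrite size_cat leq_add.
move=> x /= [/H|/H'] [c cin xc]; exists c => //; rewrite mem_cat cin ?orbT//.
Qed.

Lemma covered1 d E : (forall x y, E x -> E y -> x < y -> y - x < d) -> 0 < d -> covered 1 d E.
Proof.
move=> H d0; have [[p Ep]|nE] := pselect (exists p, E p).
  exists [:: p]; split => // x Ex; exists p; first by rewrite inE.
  have [xp|px|->] := ltgtP x p.
  - by rewrite ltr0_norm ?subr_lt0// opprB; exact: H.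
  - by rewrite gtr0_norm ?subr_gt0//; exact: H.
  - by rewrite subrr normr0.
by exists [::]; split => // x Ex; exfalso; apply: nE; exists x.
Qed.

(** The scaling r^2 against r is that of a nondegenerate critical point. Since n and C serve every
    level m, the cover will be uniform in lambda. *)
Definition sublevel_covered f A := exists n C, 0 < C /\ forall r m, 0 < r -> r <= 1 ->
  covered n (C * r) [set x | A x /\ `|f x - m| < r ^+ 2].

Lemma sublevel_coveredU f A B : sublevel_covered f A -> sublevel_covered f B ->
  sublevel_covered f [set x | A x \/ B x].
Proof.
move=> [n [C [C0 H]]] [m [D [D0 K]]]; exists (n + m)%N, (C + D); split; first exact: addr_gt0.
move=> r u r0 r1.
have H' := covered_radius _ (H r u r0 r1); have K' := covered_radius _ (K r u r0 r1).
apply: covered_sub (coveredU (H' ((C + D) * r) _) (K' ((C + D) * r) _)).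
- by move=> x /= [[Ax|Bx] xr]; [left|right].
- by rewrite ler_wpM2r ?ltW// ltrDl.
- by rewrite ler_wpM2r ?ltW// ltrDr.
Qed.

Lemma sublevel_covered_sub f A B : (forall x, A x -> B x) -> sublevel_covered f B ->
  sublevel_covered f A.
Proof.
move=> sub [n [C [C0 H]]]; exists n, C; split => // r m r0 r1.
by apply: covered_sub (H r m r0 r1) => x /= [/sub].
Qed.

Lemma sublevel_gap f f1 (a b c r m : R) : (forall x, is_derive x 1 f (f1 x)) ->
  0 < c -> (forall x, a <= x <= b -> c <= `|f1 x|) ->
  forall x y, a <= x -> y <= b -> `|f x - m| < r -> `|f y - m| < r -> x < y ->
  y - x < 2 * r / c.
Proof.
move=> d c0 H x y ax yb fx fy xy; have [z [xz zy e]] := mvt d xy.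
have h1 : `|f y - f x| < 2 * r.
  have -> : f y - f x = (f y - m) - (f x - m) by ring.
  by apply: le_lt_trans (ler_normB _ _) _; lra.
rewrite ltr_pdivlMr//; apply: le_lt_trans h1.
rewrite e normrM (gtr0_norm (_ : 0 < y - x)) ?subr_gt0// mulrC.
apply: ler_wpM2r; first by rewrite subr_ge0 ltW.
by apply: H; rewrite (le_trans ax (ltW xz)) (le_trans (ltW zy) yb).
Qed.

(** Away from critical points the length is O(r^2), weakened to O(r) by r <= 1 to match the critical
    case. *)
Lemma sublevel_covered1 f f1 (a b c : R) : (forall x, is_derive x 1 f (f1 x)) ->
  0 < c -> (forall x, a <= x <= b -> c <= `|f1 x|) ->
  sublevel_covered f [set x | a <= x <= b].
Proof.
move=> d c0 H; exists 1%N, (2 / c); split; first exact: divr_gt0.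
move=> r m r0 r1; apply: covered1; last by rewrite mulr_gt0 ?divr_gt0.
move=> x y /= [/andP[ax xb] fx] [/andP[ay yb] fy] xy.
have r2 : r ^+ 2 <= r by rewrite expr2; apply: ler_piMr => //; exact: ltW.
apply: lt_le_trans (sublevel_gap d c0 H ax yb fx fy xy) _.
by rewrite mulrAC; apply: ler_wpM2l => //; apply: divr_ge0 => //; exact: ltW.
Qed.

(** p is the zero of the increasing function f1 if there is one; otherwise it is the endpoint at
    which |f1| is smallest. *)
Lemma linear_growth f1 f2 (a b c : R) : (forall x, is_derive x 1 f1 (f2 x)) ->
  0 < c -> a <= b -> (forall x, a <= x <= b -> c <= f2 x) ->
  exists p, forall x, a <= x <= b -> c * `|x - p| <= `|f1 x|.
Proof.
move=> d c0 ab H.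
have grow x y : a <= x -> y <= b -> x < y -> c * (y - x) <= f1 y - f1 x.
  move=> ax yb xy; have [z [xz zy ->]] := mvt d xy.
  apply: ler_wpM2r; first by rewrite subr_ge0 ltW.
  by apply: H; rewrite (le_trans ax (ltW xz)) (le_trans (ltW zy) yb).
have zero p : a <= p -> p <= b -> f1 p = 0 -> forall x, a <= x <= b -> c * `|x - p| <= `|f1 x|.
  move=> ap pb p0 x /andP[ax xb]; have [xp|px|->] := ltgtP x p.
  - have := grow x p ax pb xp; rewrite p0 sub0r => h.
    by rewrite ltr0_norm ?subr_lt0// opprB (le_trans h)// -normrN ler_norm.
  - have := grow p x ap xb px; rewrite p0 subr0 => h.
    by rewrite gtr0_norm ?subr_gt0// (le_trans h)// ler_norm.
  - by rewrite subrr normr0 mulr0.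
have [fa|fa] := leP 0 (f1 a).
  exists a => x /andP[ax xb]; rewrite ger0_norm ?subr_ge0//.
  apply: le_trans (ler_norm _); move: ax; rewrite le_eqVlt => /orP[/eqP <-|ax].
    by rewrite subrr mulr0.
  by have := grow a x (lexx _) xb ax; lra.
have [fb|fb] := leP (f1 b) 0.
  exists b => x /andP[ax xb]; rewrite ler0_norm ?subr_le0// opprB -normrN.
  apply: le_trans (ler_norm _); move: xb; rewrite le_eqVlt => /orP[/eqP ->|xb].
    by rewrite subrr mulr0; lra.
  by have := grow x b ax (lexx _) xb; lra.
have [||p pin p0] := @IVT R f1 a b 0 ab.
- by apply: continuous_subspaceT; apply: derivable_cont => x; exact: ex_derive.
- by rewrite ge_min le_max (ltW fa) (ltW fb) orbT.
exists p; apply: zero => //; by move: pin; rewrite in_itv /= => /andP[].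
Qed.

Lemma linear_growth_abs f1 f2 (a b c : R) : (forall x, is_derive x 1 f1 (f2 x)) ->
  0 < c -> a <= b -> (forall x, a <= x <= b -> c <= f2 x) \/ (forall x, a <= x <= b -> f2 x <= - c) ->
  exists p, forall x, a <= x <= b -> c * `|x - p| <= `|f1 x|.
Proof.
move=> d c0 ab [H|H]; first exact: linear_growth d c0 ab H.
have d' x : is_derive x 1 (fun y => -1 * f1 y) (-1 * f2 x) by exact: dZ.
have [|p Hp] := linear_growth d' c0 ab; first by move=> x /H; lra.
by exists p => x /Hp; rewrite mulN1r normrN.
Qed.

(* Near a nondegenerate critical point p, |f'| >= c |x - p| >= c r outside the
   ball of radius r about p, so there the r^2-sublevel set has length O(r). *)
Lemma sublevel_covered2 f f1 f2 (a b c : R) : (forall x, is_derive x 1 f (f1 x)) ->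
  (forall x, is_derive x 1 f1 (f2 x)) -> 0 < c -> a <= b ->
  (forall x, a <= x <= b -> c <= f2 x) \/ (forall x, a <= x <= b -> f2 x <= - c) ->
  sublevel_covered f [set x | a <= x <= b].
Proof.
move=> d d' c0 ab H; have [p Hp] := linear_growth_abs d' c0 ab H.
exists (1 + (1 + 1))%N, (2 / c + 2); split; first by rewrite addr_gt0 ?divr_gt0.
move=> r m r0 r1.
have C0 : 0 < (2 / c + 2) * r by rewrite mulr_gt0// addr_gt0 ?divr_gt0.
have cr : 0 < c * r by rewrite mulr_gt0.
have far (u v : R) : (forall x, u <= x <= v -> a <= x <= b /\ r <= `|x - p|) ->
    covered 1 ((2 / c + 2) * r) [set x | u <= x <= v /\ `|f x - m| < r ^+ 2].
  move=> uv; apply: covered1 => // x y /= [/andP[ux xv] fx] [/andP[uy yv] fy] xy.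
  have Hc z : u <= z <= v -> c * r <= `|f1 z|.
    move=> /uv[zab zr]; apply: le_trans (Hp z zab); by apply: ler_wpM2l => //; exact: ltW.
  apply: lt_le_trans (sublevel_gap d cr Hc ux yv fx fy xy) _.
  have -> : 2 * r ^+ 2 / (c * r) = 2 / c * r by field; rewrite !gt_eqF.
  by apply: ler_wpM2r; [exact: ltW|rewrite lerDl].
have K1 := far a (Num.min b (p - r)).
have K2 := far (Num.max a (p + r)) b.
have K3 : covered 1 ((2 / c + 2) * r) [set x | `|x - p| < r].
  exists [:: p]; split => // x /= xp; exists p; rewrite ?inE//.
  apply: lt_le_trans xp _; rewrite -[X in X <= _]mul1r; apply: ler_wpM2r; first exact: ltW.
  by have := divr_gt0 (ltr0n R 2) c0; lra.
apply: covered_sub (coveredU K3 (coveredU (K1 _) (K2 _))).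
- move=> x /= [/andP[ax xb] fx]; have [xp|xp] := ltP (`|x - p|) r; [by left|right].
  move: xp; have [xp|px] := leP x p.
    rewrite ler0_norm ?subr_le0// => xp'; left; split => //.
    by rewrite ax le_min xb /=; lra.
  rewrite gtr0_norm ?subr_gt0// => xp'; right; split => //.
  by rewrite xb ge_max ax /= andbT; lra.
- move=> x; rewrite le_min => /andP[ax /andP[xb xp]]; rewrite ax xb; split => //.
  by rewrite ler0_norm; lra.
- move=> x; rewrite ge_max => /andP[/andP[ax xp] xb]; rewrite ax xb; split => //.
  by rewrite ger0_norm; lra.
Qed.

(** By continuity the first nonzero one among f1 p and f2 p keeps its sign and half its modulus near
    p; this selects between the two preceding covers. *)
Lemma sublevel_covered_local f f1 f2 p : (forall x, is_derive x 1 f (f1 x)) ->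
  (forall x, is_derive x 1 f1 (f2 x)) -> continuous f2 ->
  (f1 p = 0 -> f2 p <> 0) -> exists d : R, 0 < d /\ sublevel_covered f [set x | p - d <= x <= p + d].
Proof.
move=> d d' cf2 np.
have cf1 : continuous f1 by apply: derivable_cont => x; exact: ex_derive.
have near_c (g : R -> R) : continuous g -> g p != 0 -> exists d, 0 < d /\
    forall x, p - d <= x <= p + d -> `|g p - g x| < `|g p| / 2.
  move=> cg gp; have e0 : 0 < `|g p| / 2 by rewrite divr_gt0 ?normr_gt0.
  have /cvgrPdist_lt /(_ _ e0) /nbhs_ballP [e /= e1 He] := cg p.
  exists (e / 2); split; first exact: divr_gt0.
  move=> x xp; apply: He; rewrite /ball /= ltr_distlC; lra.
have [f1p|f1p] := eqVneq (f1 p) 0.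
  have f2p : f2 p != 0 by apply/eqP; exact: np.
  have [e [e0 He]] := near_c f2 cf2 f2p; exists e; split => //.
  have c0 : 0 < `|f2 p| / 2 by rewrite divr_gt0 ?normr_gt0.
  apply: (sublevel_covered2 d d' c0); first by lra.
  have [pos|neg|z] := ltgtP (f2 p) 0; last by rewrite z eqxx in f2p.
    by right => x /He; rewrite (ltr0_norm pos) ltr_distlC; lra.
  by left => x /He; rewrite (gtr0_norm neg) ltr_distlC; lra.
have [e [e0 He]] := near_c f1 cf1 f1p; exists e; split => //.
have c0 : 0 < `|f1 p| / 2 by rewrite divr_gt0 ?normr_gt0.
apply: (sublevel_covered1 d c0) => x /He h.
have := ler_normD (f1 p - f1 x) (f1 x); rewrite subrK; lra.
Qed.

Lemma sublevel_covered_compact f (X : R) :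
  (forall p, exists d : R, 0 < d /\ sublevel_covered f [set x | p - d <= x <= p + d]) ->
  sublevel_covered f [set x | - X <= x <= X].
Proof.
move=> H; have [d Hd] := choice H.
have := @segment_compact R (- X) X; rewrite compact_cover.
move=> /(_ R setT (fun p => ball p (d p))) [].
- by move=> p _; exact: ball_open.
- by move=> x _; exists x => //; exact: ballxx (Hd x).1.
move=> D _ HD.
have K (s : seq R) : sublevel_covered f [set x | exists2 p, p \in s & p - d p <= x <= p + d p].
  elim: s => [|p s IH].
    exists 0%N, 1; split => // r m _ _; exists [::]; split => // x /= [[p]].
    by rewrite in_nil.
  apply: sublevel_covered_sub (sublevel_coveredU (Hd p).2 IH) => x /= [q].
  rewrite inE => /orP[/eqP ->|qs] xq; [by left|by right; exists q].
apply: sublevel_covered_sub (K (finmap.enum_fset D)) => x /= xX.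
have xin : `[- X, X]%classic x by rewrite /= in_itv.
have [p pD] := HD x xin.
rewrite /ball /= ltr_distlC => /andP[h1 h2]; exists p => //.
by rewrite (ltW h1) (ltW h2).
Qed.

End Sublevel.

(** * The potential at infinity *)

Section Tail.
Variable R : realType.
Implicit Types (f g : R -> R) (k x y r : R).

Lemma powR_decr (e x y : R) : 0 < x -> x <= y -> 0 <= e -> y `^ (- e) <= x `^ (- e).
Proof.
move=> x0 xy e0; rewrite !powRN lef_pV2 ?posrE ?powR_gt0//; last exact: lt_le_trans xy.
by apply: ge0_ler_powR => //; rewrite nnegrE ltW//; exact: lt_le_trans xy.
Qed.

Lemma is_derive_invpow (k x : R) : 0 < `|x| ->
  is_derive x 1 (fun y : R => 1 / `|y| `^ k) (- k * Num.sg x * `|x| `^ (- k - 1)).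
Proof.
move=> x0.
have E : (fun y : R => 1 / `|y| `^ k) = (fun y => `|y| `^ (- k)).
  by apply/funext => y; rewrite powRN div1r.
rewrite E; have [xn|xp|z] := ltgtP x 0; last by rewrite z normr0 ltxx in x0.
- have d1 : is_derive x 1 (fun y : R => -1 * y) (-1) by apply: is_derive_eq (dZ (-1) (did x)) _; rewrite mulr1.
  have xN : 0 < -1 * x by lra.
  have d2 := @dcomp R (fun y => y `^ (- k)) (fun y => -1 * y) x _ _ (is_derive1_powR (- k) xN) d1.
  have Ex : -1 * x = `|x| by rewrite ltr0_norm//; lra.
  rewrite (ltr0_sg xn); apply: is_derive_eq; last first.
    by instantiate (1 := - k * `|x| `^ (- k - 1) * -1); ring.
  rewrite -Ex; apply: dnear d2; near=> y.
  by rewrite ltr0_norm ?mulN1r//; near: y; exact: lt_nbhsl.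
- rewrite (gtr0_sg xp); apply: is_derive_eq; last first.
    by instantiate (1 := - k * `|x| `^ (- k - 1)); ring.
  rewrite (gtr0_norm xp); apply: dnear (is_derive1_powR (- k) xp); near=> y.
  by rewrite gtr0_norm//; near: y; exact: lt_nbhsr.
Unshelve. all: by end_near. Qed.

Definition power_tail k f := exists C : R, 0 < C /\
  forall (x : R) (l : nat), 1 <= `|x| -> (l <= 3)%N ->
    `| (fun y : R => f y - 1 / `|y| `^ k)^`(l) x | <= C / `|x| `^ (k + l%:R + 1).

Lemma tail_derivative k f : 0 < k -> Cn 3 f ->
  power_tail k f ->
  exists C : R, [/\ 0 < C,
    (forall x, 1 <= `|x| -> `|derive1 f x + k * Num.sg x * `|x| `^ (- (k + 1))| <= C * `|x| `^ (- (k + 1)) / `|x|) &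
    (forall x, 1 <= `|x| -> `|f x| <= `|x| `^ (- k) + C)].
Proof.
move=> k0 Cf [C [C0 H]]; exists C; split => //.
  move=> x x1; have x0 : 0 < `|x| by exact: lt_le_trans x1.
  have := H x 1%N x1 isT; rewrite derive1n1.
  have [df _] := Cn_elim Cf.
  have d := dD (df x) (dZ (-1) (is_derive_invpow k x0)).
  have -> : derive1 (fun y : R => f y - 1 / `|y| `^ k) x = derive1 f x + k * Num.sg x * `|x| `^ (- (k + 1)).
    rewrite [LHS]derive1E.
    have -> : (fun y : R => f y - 1 / `|y| `^ k) = (fun y => f y + -1 * (1 / `|y| `^ k)).
      by apply/funext => y; rewrite mulN1r.
    by rewrite derive_val opprD; ring.
  move/le_trans; apply.
  have -> : `|x| `^ (k + 1%:R + 1) = `|x| `^ (k + 1) * `|x|.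
    by rewrite powRD ?(gt_eqF x0) ?implybT// powRr1.
  by rewrite invfM powRN mulrA.
move=> x x1; have := H x 0%N x1 isT; rewrite derive1n0 addr0.
have x0 : 0 < `|x| by exact: lt_le_trans x1.
rewrite div1r -powRN => h.
have -> : f x = `|x| `^ (- k) + (f x - `|x| `^ (- k)) by ring.
apply: le_trans (ler_normD _ _) _; rewrite (ger0_norm (powR_ge0 _ _)) lerD2l.
apply: le_trans h _; rewrite ler_pdivrMr ?powR_gt0//; apply: ler_peMr; first exact: ltW.
rewrite -[X in X <= _](powRr0 `|x|); apply: ler_powR => //.
by rewrite addr_ge0// ltW.
Qed.

Lemma EVT_bdd f (b : R) : continuous f -> exists M, 0 <= M /\ forall x, `|x| <= b -> `|f x| <= M.
Proof.
move=> cf; have [b0|b0] := leP 0 b; last first.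
  by exists 0; split => // x xb; have := normr_ge0 x; lra.
have cg : {within `[- b, b], continuous (fun x => `|f x|)}.
  apply: continuous_subspaceT => x; apply: (@continuous_comp _ _ _ f (fun y : R => `|y|)); first exact: cf.
  exact: norm_continuous.
have [|c _ Hc] := EVT_max _ cg; first by lra.
exists `|f c|; split => // x xb; apply: Hc.
by rewrite in_itv /= -ler_norml.
Qed.

Lemma bounded_decay k f : 0 < k -> Cn 3 f ->
  power_tail k f ->
  bounded_mfun f /\ exists X c D : R, [/\ 1 <= X, 0 < c, 0 < D,
    (forall x, X <= `|x| -> c * `|x| `^ (- (k + 1)) <= `|derive1 f x|) &
    (forall x, 1 <= `|x| -> `|derive1 f x| <= D * `|x| `^ (- (k + 1)))].
Proof.
move=> k0 Cf hf; have [C [C0 Hd Hf]] := tail_derivative k0 Cf hf.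
have cf := Cn_cont Cf; split.
  split; first exact: meas_cont.
  have [M1 [_ HM]] := @EVT_bdd f 1 cf.
  exists (M1 + (1 + C)) => x; have [x1|x1] := leP `|x| 1.
    by apply: le_trans (HM x x1) _; lra.
  apply: le_trans (Hf x (ltW x1)) _.
  have M10 : 0 <= M1 by apply: le_trans (HM 0 _); rewrite ?normr0.
  have : `|x| `^ (- k) <= 1.
    by rewrite -[X in _ <= X](powRr0 `|x|); apply: ler_powR; lra.
  lra.
have X0 : 1 <= Num.max 1 (2 * C / k) by rewrite le_max lexx.
(* Beyond 2 C / k the error C |x|^-(k+1) / |x| is at most half of the leading term k |x|^-(k+1). *)
exists (Num.max 1 (2 * C / k)), (k / 2), (k + C); split => //.
- by rewrite divr_gt0.
- by rewrite addr_gt0.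
- move=> x; rewrite ge_max => /andP[x1 xX].
  have x0 : 0 < `|x| by exact: lt_le_trans x1.
  set P := `|x| `^ (- (k + 1)); have P0 : 0 <= P by exact: powR_ge0.
  have h1 : C * P / `|x| <= k / 2 * P.
    rewrite ler_pdivrMr//; rewrite ler_pdivrMr// in xX.
    have : C * P <= (k / 2 * `|x|) * P by apply: ler_wpM2r => //; lra.
    by rewrite mulrAC.
  have h2 := Hd x x1; rewrite -/P in h2.
  have h3 : `|k * Num.sg x * P| = k * P.
    rewrite !normrM (gtr0_norm k0) (ger0_norm P0) normr_sg.
    by have -> : x != 0; [rewrite -normr_gt0|rewrite mulr1].
  have := ler_normB (derive1 f x + k * Num.sg x * P) (derive1 f x).
  by rewrite addrAC subrr add0r h3; lra.
- move=> x x1; have x0 : 0 < `|x| by exact: lt_le_trans x1.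
  set P := `|x| `^ (- (k + 1)); have P0 : 0 <= P by exact: powR_ge0.
  have h2 := Hd x x1; rewrite -/P in h2.
  have h1 : C * P / `|x| <= C * P.
    by rewrite ler_pdivrMr//; apply: ler_peMr => //; apply: mulr_ge0 => //; exact: ltW.
  have h3 : `|k * Num.sg x * P| <= k * P.
    rewrite !normrM (gtr0_norm k0) (ger0_norm P0) ler_wpM2r// ler_piMr ?(ltW k0)//.
    by rewrite normr_sg; case: (x != 0).
  have := ler_normB (derive1 f x + k * Num.sg x * P) (k * Num.sg x * P).
  by rewrite addrK; lra.
Qed.

Lemma tail_covered f (k c X a b x0 m : R) : (forall x, is_derive x 1 f (derive1 f x)) ->
  0 < k -> 0 < c -> 1 <= x0 -> 1 <= X ->
  (forall x, X <= `|x| -> c * `|x| `^ (- (k + 1)) <= `|derive1 f x|) ->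
  (forall x, a <= x <= b -> X <= `|x| <= x0) ->
  covered 1 (3 / c / x0) [set x | a <= x <= b /\ `|f x - m| < x0 `^ (- (k + 2))].
Proof.
move=> df k0 c0 x01 X1 H ab.
have x00 : 0 < x0 by exact: lt_le_trans x01.
have p0 : 0 < x0 `^ (- (k + 1)) by exact: powR_gt0.
apply: covered1; last by rewrite !divr_gt0.
move=> x y /= [/andP[ax xb] fx] [/andP[ay yb] fy] xy.
have Hc z : a <= z <= b -> c * x0 `^ (- (k + 1)) <= `|derive1 f z|.
  move=> /ab /andP[Xz zx0]; apply: le_trans (H z Xz); apply: ler_wpM2l; first exact: ltW.
  apply: powR_decr => //; first exact: lt_le_trans (lt_le_trans ltr01 X1) Xz.
  by rewrite addr_ge0// ltW.
apply: lt_trans (sublevel_gap df (mulr_gt0 c0 p0) Hc ax yb fx fy xy) _.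
have -> : x0 `^ (- (k + 2)) = x0 `^ (- (k + 1)) / x0.
  have -> : - (k + 2) = - (k + 1) + -1 by ring.
  by rewrite powRD ?(gt_eqF x00) ?implybT// powR_inv1// ltW.
have -> : 2 * (x0 `^ (- (k + 1)) / x0) / (c * x0 `^ (- (k + 1))) = 2 / c / x0.
  by field; rewrite !gt_eqF.
by rewrite ltr_pM2r ?invr_gt0// ltr_pM2r ?invr_gt0// ltr_nat.
Qed.

(* On a fixed compact set the r^2-sublevel sets with r = 1 / x0 suffice; in the
   tail |f'| >= c x0^-(k+1) gives length O(x0^-(k+2) / x0^-(k+1)). *)
Lemma sublevel_cover k f : 0 < k -> Cn 3 f ->
  (forall x, derive1 f x = 0 -> f^`(2) x <> 0) ->
  power_tail k f ->
  exists (n : nat) (C : R), 0 < C /\ forall x0 m, 1 <= x0 ->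
    covered n (C / x0) [set x | `|x| <= x0 /\ `|f x - m| < x0 `^ (- (k + 2))].
Proof.
move=> k0 Cf crit hf; have [_ [X [c [_ [X1 c0 _ Hc _]]]]] := bounded_decay k0 Cf hf.
have [df Cf1] := Cn_elim Cf; have [df1 Cf2] := Cn_elim Cf1.
have loc p := sublevel_covered_local df df1 (Cn_cont Cf2) (crit p).
have [n [C [C0 HC]]] := @sublevel_covered_compact R f X loc.
exists (n + (1 + 1))%N, (C + 3 / c); split; first by rewrite addr_gt0 ?divr_gt0.
move=> x0 m x01; have x00 : 0 < x0 by exact: lt_le_trans x01.
have K1 := tail_covered (a := X) (b := x0) m df k0 c0 x01 X1 Hc _.
have K2 := tail_covered (a := - x0) (b := - X) m df k0 c0 x01 X1 Hc _.
have K0 : covered n (C * x0^-1) [set x | [set x | - X <= x <= X] x /\ `|f x - m| < x0^-1 ^+ 2].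
  by apply: HC; rewrite ?invr_gt0// invf_le1.
have le1 : C * x0^-1 <= (C + 3 / c) / x0.
  apply: ler_wpM2r; first by rewrite invr_ge0 ltW.
  by rewrite lerDl ltW// divr_gt0.
have le2 : 3 / c / x0 <= (C + 3 / c) / x0.
  apply: ler_wpM2r; first by rewrite invr_ge0 ltW.
  by rewrite lerDr ltW.
apply: covered_sub (coveredU (covered_radius le1 K0) (coveredU (covered_radius le2 (K1 _)) (covered_radius le2 (K2 _)))).
- move=> x /= []; rewrite ler_norml => /andP[xl xr] fx.
  have [xX|Xx] := leP x X; last by right; left; rewrite (ltW Xx) xr.
  have [Xx|xX'] := leP (- X) x; last by right; right; rewrite xl (ltW xX').
  left; split; first by [].
  (* On the compact part the threshold x0^-(k+2) is enlarged to x0^-2 = r^2. *)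
  apply: lt_le_trans fx _.
  have -> : x0^-1 ^+ 2 = x0 `^ (- 2%:R) by rewrite powR_invn ?exprVn// ltW.
  by apply: ler_powR => //; lra.
- by move=> x /andP[Xx xx0]; rewrite ger0_norm ?Xx//; lra.
- by move=> x /andP[xx0 xX]; rewrite ler0_norm; [apply/andP; split; lra|lra].
Qed.

End Tail.

(** * The sign multiplier and the resolvent estimate *)

Section Cutoff.
Variable R : realType.
Implicit Types (f g G V : R -> R) (x y r t : R).

(** A rational step of class C^1 from 0 to 1; one continuous derivative is all that the multiplier
    identity asks of a cutoff. *)
Definition ramp t : R := let p := Num.max t 0 in p ^+ 2 / (1 + p ^+ 2).
Definition dramp t : R := let p := Num.max t 0 in 2 * p / (1 + p ^+ 2) ^+ 2.

Let den0 y : 0 < 1 + y ^+ 2 :> R.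
Proof. by rewrite ltr_pwDl// sqr_ge0. Qed.

Lemma ramp0 t : t <= 0 -> ramp t = 0.
Proof. by move=> t0; rewrite /ramp max_r// expr0n mul0r. Qed.

Lemma dramp0 t : t <= 0 -> dramp t = 0.
Proof. by move=> t0; rewrite /dramp max_r// mulr0 mul0r. Qed.

Lemma ramp_ge0 t : 0 <= ramp t.
Proof. by rewrite divr_ge0 ?sqr_ge0// ltW. Qed.

Lemma ramp_le1 t : ramp t <= 1.
Proof. by rewrite ler_pdivrMr// mul1r lerDr. Qed.

(** 9/25 is the value at 3/4. The threshold is 1 - (1/2)^2, the argument of the edge cutoff at |x| =
    x0 / 2; at distance 2 r from a centre the notch has argument 2^2 - 1. *)
Lemma ramp_ge t : 3 / 4 <= t -> 9 / 25 <= ramp t.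
Proof.
move=> t34; rewrite /ramp max_l; last by lra.
rewrite ler_pdivlMr//; nra.
Qed.

Lemma dramp_ge0 t : 0 <= dramp t.
Proof.
apply: divr_ge0; last exact: sqr_ge0.
by apply: mulr_ge0 => //; rewrite le_max lexx orbT.
Qed.

Lemma dramp_le1 t : dramp t <= 1.
Proof.
rewrite /dramp; set p := Num.max t 0.
rewrite ler_pdivrMr ?exprn_gt0// mul1r.
by have := sqr_ge0 (p - 1); have := sqr_ge0 (p ^+ 2); have := sqr_ge0 p; nra.
Qed.

(** The chain rule factor 2 t is unbounded, but [dramp] decays like y^-3 in y = t^2 - 1. After
    squaring, the claim follows from t^2 y^2 = (1 + y) y^2 <= (1 + y^2)^2. *)
Lemma dramp_mul t : `|2 * t * dramp (t ^+ 2 - 1)| <= 4.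
Proof.
have [t1|t1] := leP (t ^+ 2 - 1) 0; first by rewrite dramp0// mulr0 normr0.
rewrite /dramp max_l; last exact: ltW.
set y := t ^+ 2 - 1 in t1 *.
rewrite -(@ler_pXn2r _ 2) ?nnegrE// real_normK ?num_real//.
have ty : t ^+ 2 = 1 + y by rewrite /y; ring.
have d0 := den0 y.
have -> : (2 * t * (2 * y / (1 + y ^+ 2) ^+ 2)) ^+ 2 =
    16 * (t ^+ 2 * y ^+ 2) / ((1 + y ^+ 2) ^+ 2) ^+ 2.
  by field; rewrite gt_eqF.
rewrite ty ler_pdivrMr; last by rewrite !exprn_gt0.
have h : (1 + y) * y ^+ 2 <= (1 + y ^+ 2) ^+ 2.
  by have := sqr_ge0 (y ^+ 2 - y); have := sqr_ge0 y; nra.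
have e0 : 1 <= (1 + y ^+ 2) ^+ 2 by apply: exprn_ege1; rewrite lerDl sqr_ge0.
have e1 : (1 + y ^+ 2) ^+ 2 <= ((1 + y ^+ 2) ^+ 2) ^+ 2.
  by rewrite [X in _ <= X]expr2; apply: ler_peMr => //; apply: le_trans e0.
by lra.
Qed.

Lemma cont_max0 : continuous (fun t : R => Num.max t 0).
Proof.
by move=> t; apply: (@continuous_max _ _ (fun t => t) (fun=> 0)); [exact: cvg_id|exact: cvg_cst].
Qed.

Lemma cont_dramp : continuous dramp.
Proof.
move=> t; rewrite /dramp.
have c := @cont_max0 t.
apply: cvgM; first by apply: cvgM; [exact: cvg_cst|exact: c].
apply: cvgV; first by rewrite expf_neq0// gt_eqF.
have c2 : (fun t : R => 1 + (Num.max t 0) ^+ 2) @ t --> 1 + (Num.max t 0) ^+ 2.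
  by apply: cvgD; [exact: cvg_cst|apply: cvgM; exact: c].
by apply: cvgM; exact: c2.
Qed.

Lemma is_derive_ramp t : is_derive t 1 ramp (dramp t).
Proof.
have [t0|t0|->] := ltgtP t 0.
- rewrite dramp0 ?ltW//; apply: dnear (dcst 0 t); near=> y; apply: ramp0.
  by apply: ltW; near: y; exact: lt_nbhsl.
- have d1 : is_derive t 1 (fun y : R => y * y) (2 * t).
    by apply: is_derive_eq (dM (did t) (did t)) _; ring.
  have d2 : is_derive t 1 (fun y : R => 1 + y * y) (2 * t).
    by apply: is_derive_eq (dD (dcst 1 t) d1) _; rewrite add0r.
  have n0 : 1 + t * t != 0 by rewrite gt_eqF// -expr2.
  have d3 : is_derive t 1 (fun y : R => (1 + y * y)^-1) (- (2 * t) / (1 + t * t) ^+ 2).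
    have H := @is_deriveV R (fun y => 1 + y * y) t (2 * t) 1 n0 d2.
    by apply: is_derive_eq H _; rewrite /GRing.scale /= mulrC mulrN mulNr.
  have -> : dramp t = 2 * t * (1 + t * t)^-1 + t * t * (- (2 * t) / (1 + t * t) ^+ 2).
    by rewrite /dramp max_l ?ltW// expr2; field.
  apply: dnear (dM d1 d3); near=> y.
  rewrite /ramp max_l// ltW//; near: y; exact: lt_nbhsr.
- rewrite dramp0//; apply: (@dquad _ _ _ 1) => y.
  rewrite (ramp0 (lexx 0)) !subr0 mul1r ger0_norm ?ramp_ge0//.
  have [y0|y0] := leP y 0; first by rewrite ramp0// sqr_ge0.
  rewrite /ramp max_l; last exact: ltW.
  rewrite ler_pdivrMr//; apply: ler_peMr; first exact: sqr_ge0.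
  by rewrite lerDl sqr_ge0.
Unshelve. all: by end_near. Qed.

Definition C1fun G G' := (forall x, is_derive x 1 G (G' x)) /\ continuous G'.

Lemma C1_cont G G' : C1fun G G' -> continuous G.
Proof. by move=> [d _]; apply: derivable_cont => x; exact: ex_derive. Qed.

Lemma C1_mul f f' g g' : C1fun f f' -> C1fun g g' ->
  C1fun (fun x => f x * g x) (fun x => f' x * g x + f x * g' x).
Proof.
move=> Cf Cg; have cf := C1_cont Cf; have cg := C1_cont Cg.
split; first by move=> x; exact: dM (Cf.1 x) (Cg.1 x).
by move=> x; apply: cvgD; apply: cvgM; [exact: Cf.2|exact: cg|exact: cf|exact: Cg.2].
Qed.

Definition notch c r x := ramp (((x - c) / r) ^+ 2 - 1).
Definition dnotch c r x := dramp (((x - c) / r) ^+ 2 - 1) * (2 * ((x - c) / r) / r).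

Lemma is_derive_quad (c r e s x : R) :
  is_derive x 1 (fun y => s * ((y - c) / r) ^+ 2 + e) (s * (2 * ((x - c) / r) / r)).
Proof.
have d1 : is_derive x 1 (fun y => (y + - c) * r^-1) (r^-1).
  by apply: is_derive_eq (dM (dD (did x) (dcst (- c) x)) (dcst r^-1 x)) _; ring.
by apply: is_derive_eq (dD (dZ s (dM d1 d1)) (dcst e x)) _; ring.
Qed.

Lemma cont_quad (c r e s : R) : continuous (fun y => s * ((y - c) / r) ^+ 2 + e).
Proof. by apply: derivable_cont => x; apply: ex_derive; exact: is_derive_quad. Qed.

Lemma C1_ramp_quad (c r e s : R) :
  C1fun (fun x => ramp (s * ((x - c) / r) ^+ 2 + e))
        (fun x => dramp (s * ((x - c) / r) ^+ 2 + e) * (s * (2 * ((x - c) / r) / r))).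
Proof.
split.
  by move=> x; exact: (@dcomp R ramp (fun y => s * ((y - c) / r) ^+ 2 + e) x _ _
    (is_derive_ramp _) (is_derive_quad c r e s x)).
move=> x; apply: cvgM.
  by apply: (@continuous_comp _ _ _ (fun y => s * ((y - c) / r) ^+ 2 + e) dramp);
    [exact: cont_quad|exact: cont_dramp].
apply: cvgM; first exact: cvg_cst.
apply: cvgM; last exact: cvg_cst.
apply: cvgM; first exact: cvg_cst.
apply: cvgM; last exact: cvg_cst.
by apply: cvgB; [exact: cvg_id|exact: cvg_cst].
Qed.

Lemma C1_notch c r : C1fun (notch c r) (dnotch c r).
Proof.
have -> : notch c r = fun x => ramp (1 * ((x - c) / r) ^+ 2 + -1).
  by apply/funext => x; rewrite mul1r.
have -> : dnotch c r =
    fun x => dramp (1 * ((x - c) / r) ^+ 2 + -1) * (1 * (2 * ((x - c) / r) / r)).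
  by apply/funext => x; rewrite !mul1r.
exact: C1_ramp_quad.
Qed.

(** Each centre adds 4 / r to the derivative bound and multiplies the lower bound by 9/25, so only
    the number of centres counts, not their positions or overlaps. *)
Lemma product_notch (cs : seq R) r : 0 < r -> exists G G',
  [/\ C1fun G G', (forall x, 0 <= G x <= 1), (forall x, `|G' x| <= (size cs)%:R * (4 / r)),
      (forall x c, c \in cs -> `|x - c| < r -> G x = 0) &
      (forall x, (forall c, c \in cs -> 2 * r <= `|x - c|) -> (9 / 25) ^+ size cs <= G x)].
Proof.
move=> r0; elim: cs => [|c cs [G [G' [CG G01 Gd Gz Gb]]]].
  exists (fun=> 1), (fun=> 0); split => //.
  - by split; [move=> x; exact: dcst|exact: cst_continuous].
  - by move=> x; rewrite ler01 lexx.
  - by move=> x; rewrite normr0 mul0r.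
exists (fun x => notch c r x * G x), (fun x => dnotch c r x * G x + notch c r x * G' x).
split.
- exact: C1_mul (C1_notch c r) CG.
- move=> x; have /andP[g0 g1] := G01 x.
  by rewrite mulr_ge0 ?ramp_ge0//= mulr_ile1 ?ramp_ge0 ?ramp_le1.
- move=> x; have /andP[g0 g1] := G01 x; rewrite /= -nat1r mulrDl mul1r.
  apply: le_trans (ler_normD _ _) _; apply: lerD; last first.
    rewrite (normrM (notch c r x)) (ger0_norm (ramp_ge0 _)) -[X in _ <= X]mul1r.
    by apply: ler_pM => //; [exact: ramp_ge0|exact: ramp_le1].
  rewrite (normrM (dnotch c r x)) (ger0_norm g0) -[X in _ <= X]mulr1; apply: ler_pM => //.
  have -> : dnotch c r x = 2 * ((x - c) / r) * dramp (((x - c) / r) ^+ 2 - 1) / r.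
    by rewrite /dnotch; ring.
  rewrite normrM normfV (gtr0_norm r0); apply: ler_wpM2r; first by rewrite invr_ge0 ltW.
  exact: dramp_mul.
- move=> x e; rewrite inE => /orP[/eqP ->|ecs] xe; last by rewrite (Gz x e)// mulr0.
  rewrite /notch ramp0 ?mul0r// subr_le0 -real_normK ?num_real// expr_le1//.
  by rewrite normrM normfV (gtr0_norm r0) ler_pdivrMr// mul1r ltW.
- move=> x H; rewrite exprS; apply: ler_pM => //.
  + apply: ramp_ge; have := H c (mem_head c cs) => h.
    have h2 : 2 <= `|(x - c) / r| by rewrite normrM normfV (gtr0_norm r0) ler_pdivlMr.
    rewrite -real_normK ?num_real//; nra.
  + by apply: Gb => e ecs; apply: H; rewrite inE ecs orbT.
Qed.

Lemma edge_cutoff (x0 : R) : 0 < x0 -> exists G G',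
  [/\ C1fun G G', (forall x, 0 <= G x <= 1), (forall x, `|G' x| <= 2 / x0),
      (forall x, x0 <= `|x| -> G x = 0) & (forall x, `|x| <= x0 / 2 -> 9 / 25 <= G x)].
Proof.
move=> x00.
have C := C1_ramp_quad 0 x0 1 (-1).
exists (fun x => ramp (-1 * ((x - 0) / x0) ^+ 2 + 1)).
exists (fun x => dramp (-1 * ((x - 0) / x0) ^+ 2 + 1) * (-1 * (2 * ((x - 0) / x0) / x0))).
split => //.
- by move=> x; rewrite ramp_ge0 ramp_le1.
- move=> x; rewrite subr0.
  have [h|h] := leP (-1 * (x / x0) ^+ 2 + 1) 0.
    by rewrite dramp0// mul0r normr0 divr_ge0// ltW.
  have h1 : `|x / x0| <= 1.
    by rewrite -(@expr_le1 _ 2)// real_normK ?num_real//; lra.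
  rewrite normrM (ger0_norm (dramp_ge0 _)) -[X in _ <= X]mul1r.
  apply: ler_pM => //; [exact: dramp_ge0|exact: dramp_le1|].
  rewrite mulN1r normrN normrM normfV (gtr0_norm x00).
  apply: ler_wpM2r; first by rewrite invr_ge0 ltW.
  by rewrite normrM ger0_norm// -[X in _ <= X]mulr1 ler_wpM2l.
- move=> x xx; rewrite ramp0// subr0.
  have h : 1 <= `|x / x0| by rewrite normrM normfV (gtr0_norm x00) ler_pdivlMr// mul1r.
  by rewrite -[(x / x0) ^+ 2]real_normK ?num_real//; nra.
- move=> x xx; apply: ramp_ge; rewrite subr0.
  have h : `|x / x0| <= 2^-1 by rewrite normrM normfV (gtr0_norm x00) ler_pdivrMr// mulrC.
  have h0 := normr_ge0 (x / x0).
  by rewrite -[(x / x0) ^+ 2]real_normK ?num_real//; nra.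
Qed.

(* The sign jumps of V are harmless since G vanishes near the zeros of V. *)
Lemma sign_cutoff V G G' (U : set R) : continuous V -> C1fun G G' -> open U ->
  (forall x, U x -> G x = 0) -> (forall x, U x \/ V x != 0) ->
  C1fun (fun x => Num.sg (V x) * G x) (fun x => Num.sg (V x) * G' x).
Proof.
move=> cV [dG cG] oU GU HU.
have G'U x : U x -> G' x = 0.
  move=> Ux; have d0 : is_derive x 1 G 0.
    apply: dnear (dcst 0 x); have : nbhs x U by exact: open_nbhs_nbhs.
    by apply: filterS => y; exact: GU.
  by rewrite -(@derive_val _ _ _ _ _ _ _ (dG x)) derive_val.
have sgV x : V x != 0 -> \forall y \near x, Num.sg (V y) = Num.sg (V x).
  move=> Vx; have [n|p|z] := ltgtP (V x) 0; last by rewrite z eqxx in Vx.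
    near=> y; rewrite (ltr0_sg n) ltr0_sg//; near: y.
    by have /cvgr_lt := cV x; apply.
  near=> y; rewrite (gtr0_sg p) gtr0_sg//; near: y.
  by have /cvgr_gt := cV x; apply.
split=> x; have [Ux|Vx] := HU x.
- rewrite G'U// mulr0; apply: dnear (dcst 0 x).
  have : nbhs x U by exact: open_nbhs_nbhs.
  by apply: filterS => y /GU ->; rewrite mulr0.
- apply: dnear (dZ (Num.sg (V x)) (dG x)).
  by apply: filterS (sgV x Vx) => y ->.
- rewrite /continuous_at G'U// mulr0; apply: cvg_near_cst.
  have : nbhs x U by exact: open_nbhs_nbhs.
  by apply: filterS => y /G'U ->; rewrite mulr0.
- have c : (fun y => Num.sg (V x) * G' y) @ x --> Num.sg (V x) * G' x.
    by apply: cvgM; [exact: cvg_cst|exact: cG].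
  apply: cvg_trans c; apply: near_eq_cvg.
  by apply: filterS (sgV x Vx) => y /= ->.
Unshelve. all: by end_near. Qed.

End Cutoff.

(** * Weighted estimates and their combination *)

Section Resolvent.
Variable R : realType.
Implicit Types (f g h V chi a b G : R -> R) (c x y t r : R).

Lemma eq_implies_le x y : x = y -> x <= y.
Proof. by move=> ->. Qed.

Lemma young t x y : 0 < t -> 2 * (x * y) <= t * x ^+ 2 + t^-1 * y ^+ 2.
Proof.
move=> t0; rewrite -subr_ge0.
have -> : t * x ^+ 2 + t^-1 * y ^+ 2 - 2 * (x * y) = t * (x - t^-1 * y) ^+ 2.
  by field; rewrite gt_eqF.
by apply: mulr_ge0; [exact: ltW|exact: sqr_ge0].
Qed.

Lemma itg_bm h f : bounded_mfun h -> itg f -> itg (fun x => h x * f x).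
Proof.
move=> [mh [M hM]] If; apply: (@itg_le _ _ (fun x => M * `|f x|)).
- by apply: measM => //; exact: itg_meas.
- by move=> x; rewrite normrM; apply: ler_wpM2r.
- by apply: itgZ; exact: itg_abs.
Qed.

Lemma L2_sqr f : L2r f -> itg (fun x => f x ^+ 2).
Proof. by case. Qed.

Lemma ind_near c d x : `|x - c| < d -> ind (c - d) (c + d) x = 1.
Proof.
rewrite ltr_norml /ind => /andP[h1 h2].
have -> : c - d < x by lra.
by have -> : x <= c + d by lra.
Qed.

Section Estimates.
Variables V a a1 a2 b b1 b2 : R -> R.
Hypothesis bV : bounded_mfun V.
Hypotheses (Ha : H2w a a1 a2) (Hb : H2w b b1 b2).

Let g1 := opr (fun=> 0) V a a2 b.
Let g2 := opr (fun=> 0) (fun x => - V x) b b2 a.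
Let u2 x := a x ^+ 2 + b x ^+ 2.
(** For u = a + i b and g = g1 + i g2 its image under the operator, [N], [D], [X] and [E] are the
    squared L^2 norms of u, u', x u and g. *)
Let N := I u2.
Let D := I (fun x => a1 x ^+ 2 + b1 x ^+ 2).
Let X := I (fun x => x ^+ 2 * u2 x).
Let E := I (fun x => g1 x ^+ 2 + g2 x ^+ 2).

Let La : L2r a. Proof. by case: Ha. Qed.
Let La1 : L2r a1. Proof. by case: Ha. Qed.
Let La2 : L2r a2. Proof. by case: Ha => _ _ _ _ []. Qed.
Let Lb : L2r b. Proof. by case: Hb. Qed.
Let Lb1 : L2r b1. Proof. by case: Hb. Qed.
Let Lb2 : L2r b2. Proof. by case: Hb => _ _ _ _ []. Qed.
Let b0 : bounded_mfun (fun=> 0 : R).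
Proof. by split; [exact: meas_cst|exists 0 => x; rewrite normr0]. Qed.
Let Lg1 : L2r g1. Proof. exact: L2_opr b0 bV Ha Hb. Qed.
Let Lg2 : L2r g2. Proof. exact: L2_opr b0 (bmN bV) Hb Ha. Qed.
Let iu2 : itg u2. Proof. by apply: itgD; exact: L2_sqr. Qed.
Let idu2 : itg (fun x => a1 x ^+ 2 + b1 x ^+ 2).
Proof. by apply: itgD; exact: L2_sqr. Qed.
Let ig : itg (fun x => g1 x ^+ 2 + g2 x ^+ 2).
Proof. by apply: itgD; exact: L2_sqr. Qed.
Let ixu2 : itg (fun x => x ^+ 2 * u2 x).
Proof.
apply: eq_itg (itgD (L2_sqr (H2w_x Ha)) (L2_sqr (H2w_x Hb))) => x.
by rewrite /u2; ring.
Qed.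

(* Pairing with chi u: the term (a2 b - a b2) chi is a derivative up to chi'. *)
Lemma multiplier_identity chi chi' : AC chi chi' ->
  bounded_mfun chi -> bounded_mfun chi' ->
  I (fun x => V x * chi x * u2 x) =
  I (fun x => chi x * (g2 x * a x - g1 x * b x)) +
  I (fun x => chi' x * (a1 x * b x - a x * b1 x)).
Proof.
move=> Ac bc bc'.
have i1 : itg (fun x => chi x * (g2 x * a x - g1 x * b x)).
  by apply: itg_bm => //; apply: itgB; exact: L2_mul.
have i2 : itg (fun x => chi' x * (a1 x * b x - a x * b1 x)).
  by apply: itg_bm => //; apply: itgB; exact: L2_mul.
have i3 : itg (fun x => chi x * (a2 x * b x - a x * b2 x)).
  by apply: itg_bm => //; apply: itgB; exact: L2_mul.
have [Aa Aa1 _ _ _] := Ha; have [Ab Ab1 _ _ _] := Hb.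
have AF : AC (fun x => chi x * (a1 x * b x - a x * b1 x))
    (fun x => chi' x * (a1 x * b x - a x * b1 x) + chi x * (a2 x * b x - a x * b2 x)).
  apply: eq_AC (ACM Ac (ACB (ACM Aa1 Ab) (ACM Aa Ab1))) => // x; ring.
have z : I (fun x => chi' x * (a1 x * b x - a x * b1 x) + chi x * (a2 x * b x - a x * b2 x)) = 0.
  apply: I_deriv0 AF _ (itgD i2 i3).
  by apply: itg_bm => //; apply: itgB; exact: L2_mul.
rewrite -ID// -[RHS]subr0 -z -IB; [|exact: itgD|exact: itgD].
by apply: eqI => x; rewrite /g1 /g2 /opr /u2; ring.
Qed.

(** Young's inequality on both terms of the identity, with parameters left free: t weighs g against
    u, and d weighs u' against u. *)
Lemma multiplier_bound chi chi' M t d : AC chi chi' ->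
  (forall x, `|chi x| <= 1) -> (forall x, `|chi' x| <= M) -> 0 < t -> 0 < d ->
  2 * I (fun x => V x * chi x * u2 x) <=
  t * E + t^-1 * N + M * (d * D + d^-1 * N).
Proof.
move=> Ac c1 cM t0 d0.
have bc : bounded_mfun chi by split; [exact: AC_meas Ac|exists 1].
have bc' : bounded_mfun chi' by split; [exact: AC_meas' Ac|exists M].
have M0 : 0 <= M by apply: le_trans (cM 0).
rewrite (multiplier_identity Ac bc bc') mulrDr; apply: lerD.
  have i1 : itg (fun x => chi x * (g2 x * a x - g1 x * b x)).
    by apply: itg_bm => //; apply: itgB; exact: L2_mul.
  rewrite /E /N -!IZ// -ID; [|exact: itgZ|exact: itgZ].
  apply: I_le; [exact: itgZ|by apply: itgD; exact: itgZ|move=> x].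
  have s1 : chi x ^+ 2 <= 1 by rewrite -real_normK ?num_real// expr_le1.
  move: (chi x) s1 => s s1.
  have Y1 := young (g2 x) (s * a x) t0.
  have Y2 := young (g1 x) (- (s * b x)) t0.
  have -> : 2 * (s * (g2 x * a x - g1 x * b x)) = 2 * (g2 x * (s * a x)) + 2 * (g1 x * - (s * b x)) by ring.
  apply: le_trans (lerD Y1 Y2) _.
  have ti : 0 < t^-1 by rewrite invr_gt0.
  have k1 : (s * a x) ^+ 2 <= a x ^+ 2 by rewrite exprMn ler_piMl// sqr_ge0.
  have k2 : (- (s * b x)) ^+ 2 <= b x ^+ 2 by rewrite sqrrN exprMn ler_piMl// sqr_ge0.
  have := ler_wpM2l (ltW ti) k1; have := ler_wpM2l (ltW ti) k2.
  rewrite /u2 !mulrDr; lra.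
have i2 : itg (fun x => chi' x * (a1 x * b x - a x * b1 x)).
  by apply: itg_bm => //; apply: itgB; exact: L2_mul.
have i3 : itg (fun x => d * (a1 x ^+ 2 + b1 x ^+ 2) + d^-1 * u2 x).
  by apply: itgD; exact: itgZ.
rewrite /D /N -!IZ// -[X in _ <= _ * X]ID; [|exact: itgZ|exact: itgZ].
rewrite -IZ//; apply: I_le; [exact: itgZ|exact: itgZ|move=> x].
have k : `|2 * (a1 x * b x - a x * b1 x)| <= d * (a1 x ^+ 2 + b1 x ^+ 2) + d^-1 * u2 x.
  have Y1 := young (a1 x) (b x) d0; have Y2 := young (b1 x) (- a x) d0.
  have Y3 := young (a1 x) (- b x) d0; have Y4 := young (b1 x) (a x) d0.
  rewrite /u2 !sqrrN !mulrN in Y1 Y2 Y3 Y4 *.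
  rewrite ler_norml !mulrDr mulrN (mulrC (a x) (b1 x)); apply/andP; split; lra.
rewrite mulrCA; apply: le_trans (ler_norm _) _; rewrite normrM.
by apply: ler_pM.
Qed.

Lemma energy_bound s : 0 < s -> 2 * (D + X) <= s * E + s^-1 * N.
Proof.
move=> s0.
have e := energy b0 bV (fun=> lexx 0) Ha Hb.
have -> : D + X = I (fun x => a1 x ^+ 2) + I (fun x => (x * a x) ^+ 2) +
    (I (fun x => b1 x ^+ 2) + I (fun x => (x * b x) ^+ 2)).
  have xa := L2_sqr (H2w_x Ha); have xb := L2_sqr (H2w_x Hb).
  rewrite /D ID; [|exact: L2_sqr|exact: L2_sqr].
  have -> : X = I (fun x => (x * a x) ^+ 2) + I (fun x => (x * b x) ^+ 2).
    by rewrite -ID//; apply: eqI => x; rewrite /u2; ring.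
  ring.
have ii : itg (fun x => g1 x * a x + g2 x * b x) by apply: itgD; exact: L2_mul.
apply: (@le_trans _ _ (2 * I (fun x => g1 x * a x + g2 x * b x))).
  by apply: ler_wpM2l.
rewrite /E /N -!IZ// -ID; [|exact: itgZ|exact: itgZ].
apply: I_le; [exact: itgZ|by apply: itgD; exact: itgZ|move=> x].
have := young (g1 x) (a x) s0; have := young (g2 x) (b x) s0.
rewrite /u2 !mulrDr; lra.
Qed.

Lemma sup_bound t x : 0 < t -> u2 x <= t * D + t^-1 * N.
Proof.
move=> t0; have [Aa _ _ _ _] := Ha; have [Ab _ _ _ _] := Hb.
have Au : AC u2 (fun x => 2 * (a1 x * a x + b1 x * b x)).
  by apply: eq_AC (ACD (ACM Aa Aa) (ACM Ab Ab)) => y; rewrite /u2; ring.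
have iu : itg (fun x => 2 * (a1 x * a x + b1 x * b x)).
  by apply: itgZ; apply: itgD; exact: L2_mul.
apply: le_trans (AC_le_int Au iu2 iu x) _.
rewrite /D /N -!IZ// -ID; [|exact: itgZ|exact: itgZ].
apply: I_le; [exact: itg_abs|by apply: itgD; exact: itgZ|move=> y].
have Y1 := young (a1 y) (a y) t0; have Y2 := young (b1 y) (b y) t0.
have Y3 := young (a1 y) (- a y) t0; have Y4 := young (b1 y) (- b y) t0.
rewrite /u2 !sqrrN !mulrN in Y3 Y4 *.
rewrite ler_norml !mulrDr; apply/andP; split; lra.
Qed.

Lemma mass_on_intervals (cs : seq R) r t : 0 < r -> 0 < t ->
  itg (fun x => \sum_(c <- cs) ind (c - 2 * r) (c + 2 * r) x * u2 x) /\
  I (fun x => \sum_(c <- cs) ind (c - 2 * r) (c + 2 * r) x * u2 x) <=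
  (size cs)%:R * (4 * r * (t * D + t^-1 * N)).
Proof.
move=> r0 t0; elim: cs => [|c cs [i IH]].
  have -> : (fun x => \sum_(c <- [::]) ind (c - 2 * r) (c + 2 * r) x * u2 x) = fun=> 0.
    by apply/funext => x; rewrite big_nil.
  by rewrite I0 mul0r; split => //; exact: itg0.
have -> : (fun x => \sum_(c0 <- c :: cs) ind (c0 - 2 * r) (c0 + 2 * r) x * u2 x) =
    fun x => ind (c - 2 * r) (c + 2 * r) x * u2 x +
      \sum_(c0 <- cs) ind (c0 - 2 * r) (c0 + 2 * r) x * u2 x.
  by apply/funext => x; rewrite big_cons.
have i1 : itg (fun x => ind (c - 2 * r) (c + 2 * r) x * u2 x).
  apply: itg_bm iu2; split; first exact: meas_indab.
  by exists 1 => x; rewrite ger0_norm ?ind_ge0 ?ind_le1.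
split; first exact: itgD.
rewrite (ID i1 i).
have -> : (size (c :: cs))%:R * (4 * r * (t * D + t^-1 * N)) =
    4 * r * (t * D + t^-1 * N) + (size cs)%:R * (4 * r * (t * D + t^-1 * N)).
  by rewrite (_ : (size (c :: cs))%:R = 1 + (size cs)%:R :> R) ?nat1r//; ring.
apply: lerD => //.
have -> : 4 * r * (t * D + t^-1 * N) = I (fun x => (t * D + t^-1 * N) * ind (c - 2 * r) (c + 2 * r) x).
  rewrite IZ; last exact: itg_indab.
  by rewrite I_indab; [ring|lra].
apply: I_le => //; first by apply: itgZ; exact: itg_indab.
by move=> x; rewrite mulrC; apply: ler_wpM2r; [exact: ind_ge0|exact: sup_bound].
Qed.

(* Off the small intervals around [cs], u is controlled by x^2 |u|^2 for
   |x| > x0 / 2 and by V chi |u|^2 otherwise. *)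
Lemma localized_estimate (cs : seq R) x0 r c1 chi t : 0 < r -> 0 < x0 -> 0 < c1 -> 0 < t ->
  bounded_mfun chi -> (forall x, 0 <= V x * chi x) ->
  (forall x, `|x| <= x0 / 2 -> (forall c, c \in cs -> 2 * r <= `|x - c|) ->
    c1 * x0 ^+ 2 <= V x * chi x) ->
  x0 ^+ 2 * N <= 4 * X + x0 ^+ 2 * ((size cs)%:R * (4 * r * (t * D + t^-1 * N))) +
    c1^-1 * I (fun x => V x * chi x * u2 x).
Proof.
move=> r0 x00 c10 t0 bchi pos far.
have [i1 B1] := mass_on_intervals cs r0 t0.
have bVc : bounded_mfun (fun x => V x * chi x).
  have [mV [M VM]] := bV; have [mc [M' cM]] := bchi.
  split; first exact: measM.
  exists (M * M') => x; rewrite normrM; apply: ler_pM => //.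
have i2 : itg (fun x => V x * chi x * u2 x) by exact: itg_bm.
have u0 x : 0 <= u2 x by apply: addr_ge0; exact: sqr_ge0.
have s0 x : 0 <= \sum_(c <- cs) ind (c - 2 * r) (c + 2 * r) x * u2 x.
  by apply: sumr_ge0 => c _; apply: mulr_ge0 => //; exact: ind_ge0.
apply: le_trans (_ : 4 * X + x0 ^+ 2 * I (fun x => \sum_(c <- cs) ind (c - 2 * r) (c + 2 * r) x * u2 x)
    + c1^-1 * I (fun x => V x * chi x * u2 x) <= _); last first.
  by rewrite lerD2r lerD2l; apply: ler_wpM2l B1; exact: sqr_ge0.
rewrite /X /N -!IZ//.
have j1 := itgZ 4 ixu2; have j2 := itgZ (x0 ^+ 2) i1; have j3 := itgZ c1^-1 i2.
rewrite -(ID j1 j2) -(ID (itgD j1 j2) j3).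
apply: I_le; [exact: itgZ|by apply: itgD => //; exact: itgD|move=> x].
have p1 : 0 <= 4 * (x ^+ 2 * u2 x).
  by apply: mulr_ge0 => //; apply: mulr_ge0 => //; exact: sqr_ge0.
have p2 : 0 <= x0 ^+ 2 * (\sum_(c <- cs) ind (c - 2 * r) (c + 2 * r) x * u2 x).
  by apply: mulr_ge0 => //; exact: sqr_ge0.
have p3 : 0 <= c1^-1 * (V x * chi x * u2 x).
  by apply: mulr_ge0; [rewrite invr_ge0 ltW|apply: mulr_ge0].
have [xl|xs] := ltP (x0 / 2) `|x|.
  suff : x0 ^+ 2 * u2 x <= 4 * (x ^+ 2 * u2 x) by lra.
  rewrite mulrA; apply: ler_wpM2r => //.
  by rewrite -(real_normK (num_real x)); nra.
have [nr|fr] := pselect (exists2 c, c \in cs & `|x - c| < 2 * r).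
  have [c cc xc] := nr.
  suff : u2 x <= \sum_(c <- cs) ind (c - 2 * r) (c + 2 * r) x * u2 x.
    by move=> /(ler_wpM2l (sqr_ge0 x0)); lra.
  rewrite (big_rem c)//=.
  rewrite (ind_near xc) mul1r lerDl; apply: sumr_ge0 => e _; apply: mulr_ge0 => //; exact: ind_ge0.
have := far x xs; have H c : c \in cs -> 2 * r <= `|x - c|.
  by move=> cc; rewrite leNgt; apply/negP => h; apply: fr; exists c.
move=> /(_ H) h.
suff : x0 ^+ 2 * u2 x <= c1^-1 * (V x * chi x * u2 x) by lra.
rewrite mulrA; apply: ler_wpM2r => //.
by rewrite mulrC ler_pdivlMr// mulrC.
Qed.

End Estimates.

Lemma sign_multiplier (n : nat) (C : R) : 0 < C ->
  exists c1 C1 : R, [/\ 0 < c1, 0 < C1 & forall V (cs : seq R) (x0 : R), 1 <= x0 ->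
  continuous V -> (size cs <= n)%N ->
  (forall x, `|x| <= x0 -> `|V x| < x0 ^+ 2 -> exists2 c, c \in cs & `|x - c| < C / x0) ->
  exists chi chi', [/\ AC chi chi', (forall x, `|chi x| <= 1),
    (forall x, `|chi' x| <= C1 * x0), (forall x, 0 <= V x * chi x) &
    (forall x, `|x| <= x0 / 2 -> (forall c, c \in cs -> 2 * (C / x0) <= `|x - c|) ->
      c1 * x0 ^+ 2 <= V x * chi x)]].
Proof.
(* There are at most n notches and one edge cutoff, hence the power n + 1. Notches of radius C / x0
   contribute n (4 / C) x0 to the derivative, the edge 2 / x0 <= 2 x0. *)
move=> C0; exists ((9 / 25) ^+ n.+1), (n%:R * (4 / C) + 2).
have p4 : 0 < 4 / C by rewrite divr_gt0.
split; [by rewrite exprn_gt0|by rewrite ltr_wpDl// mulr_ge0// ltW|].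
move=> V cs x0 x01 cV sn near.
have x00 : 0 < x0 by lra.
have r0 : 0 < C / x0 by rewrite divr_gt0.
have [G [G' [CG G01 Gd Gz Gb]]] := product_notch cs r0.
have [T [T' [CT T01 Td Tz Tb]]] := edge_cutoff x00.
(* An open set on which the cutoff vanishes. Off U one has |V| >= x0^2, so U contains every zero of
   V. *)
pose U : set R := (\bigcup_(c in [set c | c \in cs]) [set x | `|x - c| < C / x0])
  `|` [set x | x0 < `|x|].
have oU : open U.
  apply: openU.
    apply: bigcup_open => c _.
    apply: (@open_comp _ _ (fun x : R => `|x - c|) [set y | y < C / x0]); last exact: open_lt.
    move=> x _; apply: (@continuous_comp _ _ _ (fun x : R => x - c) (fun y : R => `|y|)); last exact: norm_continuous.
    by apply: cvgB; [exact: cvg_id|exact: cvg_cst].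
  apply: (@open_comp _ _ (fun x : R => `|x|) [set y | x0 < y]); last exact: open_gt.
  by move=> x _; exact: norm_continuous.
have CGT := C1_mul CG CT.
have GU x : U x -> G x * T x = 0.
  move=> [[c cc xc]|xx]; first by rewrite (Gz x c)// mul0r.
  by rewrite Tz ?mulr0// ltW.
have cov x : ~ U x -> x0 ^+ 2 <= `|V x|.
  move=> nU; rewrite leNgt; apply/negP => Vx; apply: nU.
  have [xx|xx] := ltP x0 `|x|; first by right.
  by left; have [c cc xc] := near x xx Vx; exists c.
have HU x : U x \/ V x != 0.
  have [?|/cov h] := pselect (U x); [by left|right].
  by rewrite -normr_gt0; apply: lt_le_trans h; rewrite exprn_gt0.
have Cc := sign_cutoff cV CGT oU GU HU.
have GT01 x : 0 <= G x * T x <= 1.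
  have /andP[? ?] := G01 x; have /andP[? ?] := T01 x.
  by rewrite mulr_ge0//= mulr_ile1.
have sg1 x : `|Num.sg (V x)| <= 1 by rewrite normr_sg; case: (_ != _).
have VG x : V x * (Num.sg (V x) * (G x * T x)) = `|V x| * (G x * T x).
  by rewrite mulrA [V x * _]mulrC -normrEsg.
exists (fun x => Num.sg (V x) * (G x * T x)).
exists (fun x => Num.sg (V x) * (G' x * T x + G x * T' x)).
split.
- by apply: C1_AC; [exact: Cc.1|exact: Cc.2].
- move=> x; rewrite normrM; have /andP[h0 h1] := GT01 x.
  by rewrite (ger0_norm h0) mulr_ile1.
- move=> x; rewrite normrM; apply: le_trans (_ : `|G' x * T x + G x * T' x| <= _).
    by rewrite ler_piMl.
  apply: le_trans (ler_normD _ _) _; rewrite mulrDl; apply: lerD.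
    rewrite normrM; have /andP[h0 h1] := T01 x.
    apply: le_trans (_ : `|G' x| <= _); first by rewrite (ger0_norm h0) ler_piMr.
    apply: le_trans (Gd x) _.
    have -> : n%:R * (4 / C) * x0 = n%:R * (4 / (C / x0)) by field; rewrite !gt_eqF.
    apply: ler_wpM2r; first by rewrite divr_ge0// ltW.
    by rewrite ler_nat.
  rewrite normrM; have /andP[h0 h1] := G01 x.
  apply: le_trans (_ : `|T' x| <= _); first by rewrite (ger0_norm h0) ler_piMl.
  apply: le_trans (Td x) _; rewrite ler_pdivrMr//; nra.
- by move=> x; rewrite VG; have /andP[h0 _] := GT01 x; rewrite mulr_ge0.
- move=> x xx far; rewrite VG.
  have nU : ~ U x.
    move=> [[c cc /= xc]|/= xc]; first by have := far c cc; lra.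
    by lra.
  rewrite mulrC; apply: ler_pM; [exact: sqr_ge0|by rewrite exprn_ge0|exact: cov|].
  rewrite exprSr; apply: ler_pM; [by rewrite exprn_ge0|by []| |exact: Tb].
  apply: le_trans (Gb x far); apply: ler_wiXn2l => //; lra.
Qed.

(** Stated in opaque variables to be within reach of linear arithmetic. With hN = x0^2 N, the right
    side retains 1/4 of it from the multiplier, 1/8 from the intervals and 1/8 from the energy: one
    half in all. *)
Lemma absorb (hN cW X w B1 B2 DX Ae ce : R) :
  2 * cW <= 4 * ce + hN / 4 + (2 * B2 + hN / 4) -> hN <= 4 * X + (B1 + w) + cW ->
  w <= hN / 8 -> DX <= 2 * Ae + hN / 8 -> 4 * X + B1 + B2 <= DX ->
  hN <= 4 * Ae + 4 * ce.
Proof. lra. Qed.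

(* All the Young parameters scale with x0 so that every term is homogeneous of
   degree x0^2 N, and the constants are chosen to leave N terms below x0^2 N / 2. *)
Lemma resolvent_estimate (n : nat) (C : R) : 0 < C -> exists2 K : R, 0 < K &
  forall V (cs : seq R) (x0 : R) a a1 a2 b b1 b2, 1 <= x0 ->
  continuous V -> bounded_mfun V -> (size cs <= n)%N ->
  (forall x, `|x| <= x0 -> `|V x| < x0 ^+ 2 -> exists2 c, c \in cs & `|x - c| < C / x0) ->
  H2w a a1 a2 -> H2w b b1 b2 ->
  (x0 ^+ 2) ^+ 2 * I (fun x => a x ^+ 2 + b x ^+ 2) <=
  K * I (fun x => opr (fun=> 0) V a a2 b x ^+ 2 + opr (fun=> 0) (fun x => - V x) b b2 a x ^+ 2).
Proof.
move=> C0; have [c1 [C1 [c10 C10 H]]] := sign_multiplier n C0.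
pose c := c1^-1; have c0 : 0 < c by rewrite invr_gt0.
pose m : R := n%:R; have m0 : 0 <= m by exact: ler0n.
(* Bounds the coefficients of D and X: 4 comes from |x| > x0 / 2, the next term from the short
   intervals, the last from chi'. *)
pose A := 4 + 128 * m * (m + 1) * C ^+ 2 + 2 * c ^+ 2 * C1 ^+ 2.
have q1 : 0 <= 128 * m * (m + 1) * C ^+ 2.
  by apply: mulr_ge0; [apply: mulr_ge0; [apply: mulr_ge0|apply: addr_ge0]|exact: sqr_ge0].
have q2 : 0 <= 2 * c ^+ 2 * C1 ^+ 2.
  by apply: mulr_ge0; [apply: mulr_ge0 => //|]; exact: sqr_ge0.
have A0 : 0 < A by rewrite /A; lra.
exists (4 * A ^+ 2 + 4 * c ^+ 2); first by rewrite addr_gt0// mulr_gt0// exprn_gt0.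
move=> V cs x0 a a1 a2 b b1 b2 x01 cV bV sn near Ha Hb.
have x00 : 0 < x0 by lra.
have [chi [chi' [Ac c1le c'le pos far]]] := H V cs x0 x01 cV sn near.
have r0 : 0 < C / x0 by rewrite divr_gt0.
have m1 : 0 < m + 1 by lra.
(* Young parameters: eta, in the sup bound, leaves m / (m + 1) times x0^2 N / 8, with m + 1 keeping
   it positive when n = 0. For twice the multiplier term, del (on chi') and tau (on g) leave x0^2 N
   / 4 each. The last one leaves x0^2 N / 8 in the bound of A (D + X). *)
have eta0 : 0 < 32 * (m + 1) * C / x0 by rewrite !mulr_gt0// invr_gt0.
have del0 : 0 < 4 * c * C1 / x0 by rewrite !mulr_gt0// invr_gt0.
have tau0 : 0 < 4 * c / x0 ^+ 2 by rewrite !mulr_gt0// invr_gt0 exprn_gt0.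
have s0 : 0 < 4 * A / x0 ^+ 2 by rewrite !mulr_gt0// invr_gt0 exprn_gt0.
have bchi : bounded_mfun chi by split; [exact: AC_meas Ac|exists 1].
have := localized_estimate bV Ha Hb r0 x00 c10 eta0 bchi pos far.
have := multiplier_bound bV Ha Hb Ac c1le c'le tau0 del0.
have := energy_bound bV Ha Hb s0.
have N0 : 0 <= I (fun x => a x ^+ 2 + b x ^+ 2).
  by apply: I_ge0 => x; apply: addr_ge0; exact: sqr_ge0.
have D0 : 0 <= I (fun x => a1 x ^+ 2 + b1 x ^+ 2).
  by apply: I_ge0 => x; apply: addr_ge0; exact: sqr_ge0.
have X0 : 0 <= I (fun x => x ^+ 2 * (a x ^+ 2 + b x ^+ 2)).
  by apply: I_ge0 => x; apply: mulr_ge0; [|apply: addr_ge0]; exact: sqr_ge0.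
have E0 : 0 <= I (fun x => opr (fun=> 0) V a a2 b x ^+ 2 + opr (fun=> 0) (fun x => - V x) b b2 a x ^+ 2).
  by apply: I_ge0 => x; apply: addr_ge0; exact: sqr_ge0.
move: N0 D0 X0 E0.
set N := I _; set D := I _; set X := I _; set E := I _; set W := I _.
move: (N) (D) (X) (E) (W) => {}N {}D {}X {}E {}W N0 D0 X0 E0.
have hpos : 0 < x0 ^+ 2 by rewrite exprn_gt0.
have sm : (size cs)%:R <= m by rewrite ler_nat.
move=> e1 e2 e3.
pose h := x0 ^+ 2.
have [xn An cn C1n [Cn mn]] : [/\ x0 != 0, A != 0, c != 0, C1 != 0 & C != 0 /\ m + 1 != 0].
  by split; [| | | |split]; rewrite gt_eqF.
have f1 : 2 * (D + X) <= 4 * A * (E / h) + h * N / (4 * A).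
  apply: le_trans e1 _; apply: eq_implies_le; rewrite /h; field; by rewrite ?xn ?An.
have f2 : 2 * (c * W) <= 4 * (c ^+ 2 * (E / h)) + h * N / 4 +
    (2 * (2 * c ^+ 2 * C1 ^+ 2 * D) + h * N / 4).
  have := ler_wpM2l (ltW c0) e2; rewrite mulrCA => /le_trans; apply; apply: eq_implies_le.
  by rewrite /h; field; rewrite xn cn C1n.
have P0 : 0 <= 4 * (C / x0) * (32 * (m + 1) * C / x0 * D + (32 * (m + 1) * C / x0)^-1 * N).
  apply: mulr_ge0; first by apply: mulr_ge0 => //; exact: ltW.
  by apply: addr_ge0; apply: mulr_ge0 => //; rewrite ?invr_ge0; exact: ltW.
have f3 : h * N <= 4 * X + (128 * m * (m + 1) * C ^+ 2 * D + m / (m + 1) * (h * N / 8)) + c * W.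
  apply: le_trans e3 _; rewrite lerD2r lerD2l.
  apply: le_trans (ler_wpM2l (ltW hpos) (ler_wpM2r P0 sm)) _.
  apply: eq_implies_le; rewrite /h; field; by rewrite xn Cn mn.
have hN : 0 <= h * N by rewrite mulr_ge0// ltW.
have g3 : m / (m + 1) * (h * N / 8) <= h * N / 8.
  by rewrite ler_piMl ?divr_ge0// ler_pdivrMr//; lra.
have f4 : A * (D + X) <= 2 * (A ^+ 2 * (E / h)) + h * N / 8.
  rewrite -(@ler_pM2l _ 2)//.
  have := ler_wpM2l (ltW A0) f1; rewrite mulrCA => /le_trans; apply; apply: eq_implies_le.
  by rewrite /h; field; rewrite xn An.
have f5 : 4 * X + 128 * m * (m + 1) * C ^+ 2 * D + 2 * c ^+ 2 * C1 ^+ 2 * D <= A * (D + X).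
  rewrite /A; have := mulr_ge0 q1 X0; have := mulr_ge0 q2 X0.
  set q1' := 128 * m * (m + 1) * C ^+ 2; set q2' := 2 * c ^+ 2 * C1 ^+ 2.
  nra.
have f6 := absorb f2 f3 g3 f4 f5.
apply: (@le_trans _ _ (h * (h * N))); first by apply: eq_implies_le; rewrite /h; ring.
apply: le_trans (ler_wpM2l (ltW hpos) f6) _; apply: eq_implies_le.
by rewrite /h; field.
Qed.

End Resolvent.

(** * The quasi-mode *)

Section Quasimode.
Variable R : realType.
Implicit Types (f g h V u : R -> R) (c x y t : R).

Let p y : R := Num.max y 0.

Lemma is_derive_pos_sqr y : is_derive y 1 (fun z => p z * p z) (2 * p y).
Proof.
rewrite /p; have [y0|y0|->] := ltgtP y 0.
- rewrite mulr0; apply: dnear (dcst 0 y); near=> z.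
  by rewrite max_r ?mulr0//; apply: ltW; near: z; exact: lt_nbhsl.
- have d : is_derive y 1 (fun z : R => z * z) (2 * y).
    by apply: is_derive_eq (dM (did y) (did y)) _; ring.
  apply: dnear d; near=> z; rewrite max_l//; apply: ltW; near: z; exact: lt_nbhsr.
- rewrite mulr0; apply: (@dquad _ _ _ 1) => z.
  rewrite maxxx !mulr0 !subr0 mul1r -expr2 ger0_norm ?sqr_ge0//.
  have [z0|z0] := leP z 0; first by rewrite expr0n sqr_ge0.
  by [].
Unshelve. all: by end_near. Qed.

Lemma L2_supported f (a b M : R) : continuous f -> a <= b ->
  (forall x, f x ^+ 2 <= M * ind a b x) ->
  L2r f /\ I (fun x => f x ^+ 2) <= M * (b - a).
Proof.
move=> cf ab H; have mf := meas_cont cf.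
have i : itg (fun x => f x ^+ 2).
  apply: itg_le (itgZ M (itg_indab a b)); first exact: measX.
  by move=> x; rewrite ger0_norm ?sqr_ge0.
split => //; rewrite -(I_indab ab) -IZ; last exact: itg_indab.
by apply: I_le => //; apply: itgZ; exact: itg_indab.
Qed.

Lemma L2_0 : L2r (fun=> 0 : R).
Proof.
split; first exact: meas_cst.
by apply: eq_itg (itg0 R) => x; rewrite expr0n.
Qed.

Lemma H2w_0 : H2w (fun=> 0 : R) (fun=> 0) (fun=> 0).
Proof.
have A0 : AC (fun=> 0 : R) (fun=> 0).
  by apply: C1_AC => // ?; exact: cst_continuous.
split => //; try exact: L2_0.
split; first exact: L2_0.
by apply: eq_L2 L2_0 => x; rewrite mulr0.
Qed.

Lemma quasimode (D : R) : exists2 K : R, 0 < K &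
  forall V (x0 : R), 1 <= x0 -> bounded_mfun V ->
  (forall x, x0 <= x -> x <= x0 + x0^-1 -> `|V x| <= D * x0 ^+ 2) ->
  exists u u1 u2, [/\ H2w u u1 u2, 0 < I (fun x => u x ^+ 2) &
    I (fun x => opr (fun=> 0) V u u2 (fun=> 0) x ^+ 2 +
                opr (fun=> 0) (fun x => - V x) (fun=> 0) (fun=> 0) u x ^+ 2)
    <= K * (x0 ^+ 2) ^+ 2 * I (fun x => u x ^+ 2)].
Proof.
(* On the middle half of the support q >= 3/16 and u^2 = q^6, so the mass is at least c0 / (2
   x0). *)
pose c0 : R := (3 / 16) ^+ 6; have c00 : 0 < c0 by rewrite exprn_gt0.
have kp : 0 < 9 + D ^+ 2 by have := sqr_ge0 D; lra.
(* 9 = (2 + 1)^2 from |u''| <= 2 x0^2 and |x^2 u| <= x0^2, and D^2 from |V u| <= D x0^2; the factor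
   2 / c0 converts the length 1 / x0 of the support into mass. *)
exists (2 * (9 + D ^+ 2) / c0); first by rewrite divr_gt0// mulr_gt0.
move=> V x0 x01 bV HV; have x00 : 0 < x0 by lra.
have xi0 : 0 < x0^-1 by rewrite invr_gt0.
have xi1 : x0^-1 <= 1 by rewrite invf_le1.
have xx : x0^-1 * x0 = 1 by rewrite mulVf// gt_eqF.
pose t x := (x + - x0) * x0.
pose q x := t x * (1 + -1 * t x).
pose q1 x := x0 * (1 - 2 * t x).
pose m x := p (q x).
(* The cube of the positive part m of q is of class C^2. It is written m^2 q since m^2 and q are
   differentiable while m is not; m q = m^2 then simplifies the derivative. *)
pose u x := m x * m x * q x.
pose u1 x := 3 * (m x * m x * q1 x).
pose u2 x := 3 * (2 * m x * q1 x * q1 x + m x * m x * (- 2 * x0 ^+ 2)).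
have dt x : is_derive x 1 t x0.
  by apply: is_derive_eq (dM (dD (did x) (dcst (- x0) x)) (dcst x0 x)) _; ring.
have dq x : is_derive x 1 q (q1 x).
  by apply: is_derive_eq (dM (dt x) (dD (dcst 1 x) (dZ (-1) (dt x)))) _; rewrite /q1; ring.
have dq1 x : is_derive x 1 q1 (- 2 * x0 ^+ 2).
  have E : q1 = fun y => x0 * (1 + -2 * t y) by apply/funext => y; rewrite /q1; ring.
  by rewrite E; apply: is_derive_eq (dZ x0 (dD (dcst 1 x) (dZ (-2) (dt x)))) _; ring.
have dm x : is_derive x 1 (fun y => m y * m y) (2 * m x * q1 x).
  exact: (@dcomp R (fun z => p z * p z) q x _ _ (is_derive_pos_sqr (q x)) (dq x)).
have mq x : m x * q x = m x * m x.
  rewrite /m /p; have [|] := leP (q x) 0; first by rewrite !mul0r.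
  by [].
have du x : is_derive x 1 u (u1 x).
  apply: is_derive_eq (dM (dm x) (dq x)) _.
  have -> : 2 * m x * q1 x * q x + m x * m x * q1 x = 2 * (m x * q x) * q1 x + m x * m x * q1 x by ring.
  by rewrite mq /u1; ring.
have du1 x : is_derive x 1 u1 (u2 x).
  by apply: is_derive_eq (dZ 3 (dM (dm x) (dq1 x))) _; rewrite /u2; ring.
have cq : continuous q by apply: derivable_cont => x; exact: ex_derive.
have cq1 : continuous q1 by apply: derivable_cont => x; exact: ex_derive.
have cm : continuous m.
  by move=> x; apply: (@continuous_max _ _ q (fun=> 0)); [exact: cq|exact: cvg_cst].
have cu : continuous u by apply: derivable_cont => x; exact: ex_derive.
have cu1 : continuous u1 by apply: derivable_cont => x; exact: ex_derive.
have cu2 : continuous u2.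
  move=> x; apply: cvgM; first exact: cvg_cst.
  apply: cvgD.
    apply: cvgM; last exact: cq1.
    apply: cvgM; last exact: cq1.
    by apply: cvgM; [exact: cvg_cst|exact: cm].
  apply: cvgM; last exact: cvg_cst.
  by apply: cvgM; exact: cm.
pose y0 := x0 + x0^-1; have xy : x0 <= y0 by rewrite lerDl ltW.
(* Either m vanishes, or t lies in (0, 1), whence q <= 1/4, |1 - 2 t| <= 1 and x <= x0 + 1 / x0 <= 2
   x0. All pointwise bounds below rest on this alternative. *)
have supp x : m x = 0 \/ [/\ ind x0 y0 x = 1, 0 <= m x <= 1/4, `|q1 x| <= x0,
    x ^+ 2 <= 4 * x0 ^+ 2 & `|V x| <= D * x0 ^+ 2].
  have [h|h] := leP (q x) 0; first by left; rewrite /m /p max_r.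
  right; have [t0 t1] : 0 < t x /\ t x < 1.
    by move: h; rewrite /q; have [|] := leP (t x) 0; have [|] := leP 1 (t x); nra.
  have h1 : x0 < x by move: t0; rewrite /t pmulr_lgt0//; lra.
  have h2 : x <= y0.
    by move: t1; rewrite /t -xx ltr_pM2r// /y0; lra.
  split.
  - by rewrite /ind h1 h2.
  - rewrite /m /p max_l; last exact: ltW.
    by rewrite ltW//= /q; have := sqr_ge0 (t x - 1 / 2); nra.
  - rewrite /q1 normrM (gtr0_norm x00) ler_piMr//; first exact: ltW.
    by rewrite ler_norml; apply/andP; split; lra.
  - have : x <= 2 * x0 by move: h2; rewrite /y0; lra.
    by move: h1 x00; nra.
  - by apply: HV => //; exact: ltW.
have ub x : `|u x| <= ind x0 y0 x.
  have [z|[-> /andP[m0 m1] _ _ _]] := supp x; first by rewrite /u z !mul0r normr0 ind_ge0.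
  rewrite /u -mulrA mq ger0_norm ?mulr_ge0//; nra.
have u1b x : `|u1 x| <= 1 * x0 * ind x0 y0 x.
  have [z|[-> /andP[m0 m1] h _ _]] := supp x; first by rewrite /u1 z !mul0r mulr0 normr0 mulr_ge0 ?ind_ge0// mul1r ltW.
  have h0 := normr_ge0 (q1 x).
  have w1 : m x * m x <= 1 / 16 by nra.
  have w0 : 0 <= m x * m x by rewrite mulr_ge0.
  rewrite /u1 (normrM 3) (normrM (m x * m x)) (ger0_norm w0) (ger0_norm (ler0n _ _)).
  have := ler_pM w0 h0 w1 h; lra.
have u2b x : `|u2 x| <= 2 * x0 ^+ 2 * ind x0 y0 x.
  have [z|[-> /andP[m0 m1] h _ _]] := supp x.
    by rewrite /u2 z !(mul0r,mulr0) addr0 mulr0 normr0 mulr_ge0 ?ind_ge0// mulr_ge0// sqr_ge0.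
  have w1 : m x * m x <= 1 / 16 by nra.
  have w0 : 0 <= m x * m x by rewrite mulr_ge0.
  have s0 : 0 <= q1 x * q1 x by rewrite -expr2 sqr_ge0.
  have s1 : q1 x * q1 x <= x0 ^+ 2.
    by rewrite -expr2 -real_normK ?num_real//; have := normr_ge0 (q1 x); nra.
  have k1 : m x * (q1 x * q1 x) <= 1/4 * x0 ^+ 2 by apply: ler_pM.
  have k0 : 0 <= m x * (q1 x * q1 x) by rewrite mulr_ge0.
  have k2 : m x * m x * x0 ^+ 2 <= 1/16 * x0 ^+ 2 by apply: ler_wpM2r => //; exact: sqr_ge0.
  have k3 : 0 <= m x * m x * x0 ^+ 2 by rewrite mulr_ge0// sqr_ge0.
  have -> : u2 x = 6 * (m x * (q1 x * q1 x)) - 6 * (m x * m x * x0 ^+ 2) by rewrite /u2; ring.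
  by rewrite ler_norml; apply/andP; split; lra.
have i01 x : ind x0 y0 x = 0 \/ ind x0 y0 x = 1.
  by rewrite /ind; case: (_ && _); [right|left].
have sqb f c : 0 <= c -> (forall x, `|f x| <= c * ind x0 y0 x) -> forall x, f x ^+ 2 <= c ^+ 2 * ind x0 y0 x.
  move=> c_0 fb x; rewrite -real_normK ?num_real//; have := fb x; have := normr_ge0 (f x).
  by case: (i01 x) => -> h1 h2; nra.
have xb x : `|x ^+ 2 * u x| <= x0 ^+ 2 * ind x0 y0 x.
  have [z|[-> /andP[m0 m1] _ h _]] := supp x; first by rewrite /u z !mul0r mulr0 normr0 mulr_ge0 ?ind_ge0// sqr_ge0.
  have w1 : m x * m x <= 1 / 16 by nra.
  have w0 : 0 <= m x * m x by rewrite mulr_ge0.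
  have w2 : m x * (m x * m x) <= 1/4 * (1/16) by apply: ler_pM.
  have w3 : 0 <= m x * (m x * m x) by rewrite mulr_ge0.
  rewrite /u -mulrA mq normrM (ger0_norm w3) (ger0_norm (sqr_ge0 x)).
  have := ler_pM (sqr_ge0 x) w3 h w2; have := sqr_ge0 x0; lra.
have Lu : L2r u /\ I (fun x => u x ^+ 2) <= 1 ^+ 2 * (y0 - x0).
  by apply: L2_supported => //; apply: sqb => // x; rewrite mul1r.
have Lu1 : L2r u1.
  by apply: (L2_supported cu1 xy (sqb u1 (1 * x0) _ u1b)).1; rewrite mul1r ltW.
have Lu2 : L2r u2.
  by apply: (L2_supported cu2 xy (sqb u2 (2 * x0 ^+ 2) _ u2b)).1; rewrite mulr_ge0// sqr_ge0.
have cxu : continuous (fun x => x ^+ 2 * u x).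
  by move=> x; apply: cvgM; [apply: exprn_continuous|exact: cu].
have Lxu : L2r (fun x => x ^+ 2 * u x).
  by apply: (L2_supported cxu xy (sqb _ (x0 ^+ 2) _ xb)).1; exact: sqr_ge0.
have Hu : H2w u u1 u2 by split => //; [exact: C1_AC|exact: C1_AC|exact: Lu.1].
have low : c0 * (2^-1 * x0^-1) <= I (fun x => u x ^+ 2).
  have ab : x0 + 4^-1 * x0^-1 <= x0 + 3 / 4 * x0^-1 by lra.
  have -> : 2^-1 * x0^-1 = (x0 + 3 / 4 * x0^-1) - (x0 + 4^-1 * x0^-1) by field; rewrite gt_eqF.
  rewrite -(I_indab ab) -IZ; last exact: itg_indab.
  apply: I_le; [by apply: itgZ; exact: itg_indab|exact: Lu.1.2|move=> x].
  rewrite /ind; case: andP => [[h1 h2]|_]; last by rewrite mulr0 sqr_ge0.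
  have t1 : 1 / 4 <= t x.
    have -> : 1 / 4 = (4^-1 * x0^-1) * x0 by rewrite -mulrA xx; lra.
    by rewrite /t; apply: ler_wpM2r; lra.
  have t2 : t x <= 3 / 4.
    have -> : 3 / 4 = (3 / 4 * x0^-1) * x0 by rewrite -mulrA xx; lra.
    by rewrite /t; apply: ler_wpM2r; lra.
  have qx : 3 / 16 <= q x by rewrite /q; nra.
  have mE : m x = q x by rewrite /m /p max_l//; lra.
  rewrite mulr1 /u mE -!expr2 /c0 -[6%N]/(3 * 2)%N exprM.
  by apply: lerXn2r; rewrite ?nnegrE ?exprn_ge0//; [rewrite -exprSr exprn_ge0//; lra|rewrite -exprSr lerXn2r ?nnegrE//; lra].
exists u, u1, u2; split => //.
  by apply: lt_le_trans low; rewrite !mulr_gt0.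
have Lg1 : L2r (opr (fun=> 0) V u u2 (fun=> 0)).
  by apply: L2_opr bV Hu H2w_0; split; [exact: meas_cst|exists 0 => x; rewrite normr0].
have Lg2 : L2r (opr (fun=> 0) (fun x => - V x) (fun=> 0) (fun=> 0) u).
  by apply: L2_opr (bmN bV) H2w_0 Hu; split; [exact: meas_cst|exists 0 => x; rewrite normr0].
apply: (@le_trans _ _ ((9 + D ^+ 2) * (x0 ^+ 2) ^+ 2 * (y0 - x0))).
  rewrite -(I_indab xy) -IZ; last exact: itg_indab.
  apply: I_le; [by apply: itgD; [exact: Lg1.2|exact: Lg2.2]|by apply: itgZ; exact: itg_indab|move=> x].
  rewrite mulrDl mulrDl; apply: lerD.
    have b x' : `|opr (fun=> 0) V u u2 (fun=> 0) x'| <= 3 * x0 ^+ 2 * ind x0 y0 x'.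
      rewrite /opr mulr0 subr0 addr0; apply: le_trans (ler_normD _ _) _.
      by rewrite normrN; have := u2b x'; have := xb x'; lra.
    apply: le_trans (sqb _ (3 * x0 ^+ 2) _ b x) _; first by rewrite mulr_ge0// sqr_ge0.
    by apply: ler_wpM2r; [exact: ind_ge0|apply: eq_implies_le; ring].
  have -> : opr (fun=> 0) (fun x => - V x) (fun=> 0) (fun=> 0) u x = V x * u x by rewrite /opr; ring.
  have [z|[i1 _ _ _ Vb]] := supp x.
    by rewrite /u z !mul0r mulr0 expr0n mulr_ge0 ?ind_ge0// mulr_ge0// sqr_ge0.
  rewrite i1 mulr1 -exprMn -real_normK ?num_real// lerXn2r ?nnegrE//.
    by apply: le_trans Vb.
  rewrite normrM -[X in _ <= X]mulr1; apply: ler_pM => //.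
  by have := ub x; rewrite i1.
have -> : (9 + D ^+ 2) * (x0 ^+ 2) ^+ 2 * (y0 - x0) =
    2 * (9 + D ^+ 2) / c0 * (x0 ^+ 2) ^+ 2 * (c0 * (2^-1 * x0^-1)).
  by rewrite /y0; field; rewrite !gt_eqF.
apply: ler_wpM2l low; rewrite mulr_ge0 ?sqr_ge0// divr_ge0// ?mulr_ge0// ltW//.
Qed.

End Quasimode.

(** * Norm of the resolvent *)

Section Resolvent_norm.
Variable R : realType.
Implicit Types (f V a b : R -> R) (x y t eps lam K : R).
Local Notation C := R[i].

Lemma L2norm_le (u : R -> C) (K : R) : L2 u -> 0 <= K ->
  I (fun x => re u x ^+ 2 + im u x ^+ 2) <= K -> (L2norm u <= (Num.sqrt K)%:E)%E.
Proof. by move=> Lu K0 h; rewrite L2norm_sqrt// lee_fin; exact: ler_wsqrtr. Qed.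

Lemma I_L2norm_le1 (u : R -> C) : L2 u -> (L2norm u <= 1)%E ->
  I (fun x => re u x ^+ 2 + im u x ^+ 2) <= 1.
Proof.
move=> Lu; rewrite L2norm_sqrt// lee_fin -[X in _ <= X -> _]sqrtr1.
by rewrite ler_sqrt.
Qed.

Lemma I_ae_equal (u v : R -> C) : L2 u -> L2 v -> ae_equal u v ->
  I (fun x => re u x ^+ 2 + im u x ^+ 2) = I (fun x => re v x ^+ 2 + im v x ^+ 2).
Proof.
move=> /L2P[[m1 _] [m2 _]] /L2P[[m3 _] [m4 _]] /aeP[e1 e2].
apply: I_ae; [by apply: measD; exact: measX|by apply: measD; exact: measX|].
by apply: ae_imp2 e1 e2 _ => x -> ->.
Qed.

Lemma ae_equal_sym (u v : R -> C) : ae_equal u v -> ae_equal v u.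
Proof. by move=> h; apply: ae_imp h _ => x ->. Qed.

Lemma ae_equal_trans (u v w : R -> C) : ae_equal u v -> ae_equal v w -> ae_equal u w.
Proof. by move=> h1 h2; apply: ae_imp2 h1 h2 _ => x -> ->. Qed.

Let b0 : bounded_mfun (fun=> 0 : R).
Proof. by split; [exact: meas_cst|exists 0 => x; rewrite normr0]. Qed.

Lemma opr_lin V c d a a2 b a' a2' b' x :
  opr (fun=> 0) V (fun x => c * a x + d * a' x) (fun x => c * a2 x + d * a2' x)
    (fun x => c * b x + d * b' x) x =
  c * opr (fun=> 0) V a a2 b x + d * opr (fun=> 0) V a' a2' b' x.
Proof. by rewrite /opr; ring. Qed.

(** The a priori estimate with P = 0, applied to the difference, whose image vanishes a.e. *)
Lemma inverse_unique f eps lam u v : eps != 0 ->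
  bounded_mfun (fun x => f x / eps - lam) -> Hdom u -> Hdom v ->
  ae_equal (Hshift f eps lam u) (Hshift f eps lam v) -> ae_equal u v.
Proof.
move=> e0 bV /Hdom_repr[a [a1 [a2 [b [b1 [b2 [Ha Hb eu eu2]]]]]]].
move=> /Hdom_repr[a' [a1' [a2' [b' [b1' [b2' [Ha' Hb' ev ev2]]]]]]] e.
have /aeP[e1 e2] := ae_equal_trans (ae_equal_sym (Hshift_comp f lam e0 eu eu2))
  (ae_equal_trans e (Hshift_comp f lam e0 ev ev2)).
have Hda := H2w_lin 1 (-1) Ha Ha'; have Hdb := H2w_lin 1 (-1) Hb Hb'.
have z : I (fun x => (1 * a x + -1 * a' x) ^+ 2 + (1 * b x + -1 * b' x) ^+ 2) <= I (fun=> 0 ^+ 2 + 0 ^+ 2 : R).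
  apply: (apriori_ae b0 bV (fun=> lexx 0) Hda Hdb); try exact: meas_cst.
    by apply: ae_imp e1 _ => x; rewrite opr_lin /re /= => ->; ring.
  by apply: ae_imp e2 _ => x; rewrite opr_lin /im /= => ->; ring.
have {z} : I (fun x => (1 * a x + -1 * a' x) ^+ 2 + (1 * b x + -1 * b' x) ^+ 2) <= 0.
  by apply: le_trans z _; rewrite expr0n addr0 I0.
have [_ _ [_ ia] _ _] := Hda; have [_ _ [_ ib] _ _] := Hdb.
move=> z; have z0 := I_eq0 (fun x => addr_ge0 (sqr_ge0 _) (sqr_ge0 _)) (itgD ia ib).
have {}z0 := z0 (le_anti (introT andP (conj z (I_ge0 (fun x => addr_ge0 (sqr_ge0 _) (sqr_ge0 _)))))).
apply: ae_equal_trans eu _; apply: ae_equal_sym; apply: ae_equal_trans ev _.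
apply: ae_imp z0 _ => x h; rewrite /mkc.
have h1 : (1 * a x + -1 * a' x) ^+ 2 = 0.
  by have := sqr_ge0 (1 * a x + -1 * a' x); have := sqr_ge0 (1 * b x + -1 * b' x); lra.
have h2 : (1 * b x + -1 * b' x) ^+ 2 = 0 by lra.
move/eqP: h1; move/eqP: h2; rewrite !sqrf_eq0 => /eqP h2 /eqP h1.
by congr Complex; lra.
Qed.

(** An inverse has to be exhibited for the infimum to be finite: [solvable_V] gives solutions,
    choice makes them a map S, and [est] bounds its operator norm. *)
Lemma inverse_norm_le f eps lam K : eps != 0 ->
  bounded_mfun (fun x => f x / eps - lam) -> 0 <= K ->
  (forall a a1 a2 b b1 b2, H2w a a1 a2 -> H2w b b1 b2 ->
    I (fun x => a x ^+ 2 + b x ^+ 2) <=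
    K * I (fun x => opr (fun=> 0) (fun x => f x / eps - lam) a a2 b x ^+ 2 +
                opr (fun=> 0) (fun x => - (f x / eps - lam)) b b2 a x ^+ 2)) ->
  (inverse_norm (Hshift f eps lam) <= (Num.sqrt K)%:E)%E.
Proof.
move=> e0 bV K0 est.
have ex (g : R -> C) : exists u, L2 g -> [/\ Hdom u, L2 u, ae_equal (Hshift f eps lam u) g &
    I (fun x => re u x ^+ 2 + im u x ^+ 2) <= K * I (fun x => re g x ^+ 2 + im g x ^+ 2)].
  have [Lg|nL] := pselect (L2 g); last by exists g.
  have [L1 L2'] := (L2P _).1 Lg.
  have [a [a1 [a2 [b [b1 [b2 [Ha Hb e1 e2]]]]]]] := solvable_V bV L1 L2'.
  exists (mkc a b) => _; have [Du D2] := Hdom_intro Ha Hb.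
  have [_ _ La _ _] := Ha; have [_ _ Lb _ _] := Hb.
  split => //; first by apply/L2P.
    apply: ae_equal_trans (Hshift_comp f lam e0 _ D2) _; first exact: ae_all.
    by apply/aeP.
  apply: le_trans (est _ _ _ _ _ _ Ha Hb) _.
  apply: ler_wpM2l => //; apply: eq_implies_le; apply: I_ae.
  - by apply: measD; apply: measX; [exact: (L2_opr b0 bV Ha Hb).1|exact: (L2_opr b0 (bmN bV) Hb Ha).1].
  - by apply: measD; apply: measX; [exact: L1.1|exact: L2'.1].
  - by apply: ae_imp2 e1 e2 _ => x -> ->.
have [S HS] := choice ex.
apply: (@le_trans _ _ (op_norm S)).
  apply: ereal_inf_lbound; exists S => // g Lg.
  have [Du _ Eu _] := HS g Lg; split => // v Dv Ev.
  apply: (inverse_unique e0 bV Dv Du).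
  exact: ae_equal_trans Ev (ae_equal_sym Eu).
apply: ge_ereal_sup => _ [g [Lg g1] <-].
have [_ Lu _ h] := HS g Lg.
apply: L2norm_le => //; apply: le_trans h _.
by rewrite -[X in _ <= X]mulr1; apply: ler_wpM2l => //; exact: I_L2norm_le1.
Qed.

(** Uniqueness, built into [is_inverse], forces every inverse to send the image of a + i b back to
    it a.e., so one test vector bounds all inverses from below. *)
Lemma inverse_norm_ge f eps lam K a a1 a2 b b1 b2 : eps != 0 ->
  bounded_mfun (fun x => f x / eps - lam) -> 0 < K ->
  H2w a a1 a2 -> H2w b b1 b2 -> 0 < I (fun x => a x ^+ 2 + b x ^+ 2) ->
  I (fun x => opr (fun=> 0) (fun x => f x / eps - lam) a a2 b x ^+ 2 +
              opr (fun=> 0) (fun x => - (f x / eps - lam)) b b2 a x ^+ 2) <=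
    K * I (fun x => a x ^+ 2 + b x ^+ 2) ->
  ((Num.sqrt K)^-1%:E <= inverse_norm (Hshift f eps lam))%E.
Proof.
move=> e0 bV K0 Ha Hb N0 est.
apply: le_ereal_inf_tmp => _ [S HS <-].
set N := I _ in N0 est.
(* Normalization: after scaling by s the image has squared norm at most s^2 K N = 1, and the
   preimage has s^2 N = 1 / K. *)
pose s := (Num.sqrt (K * N))^-1.
have KN : 0 < K * N by rewrite mulr_gt0.
have s2 : s ^+ 2 = (K * N)^-1 by rewrite /s exprVn sqr_sqrtr// ltW.
have Hsa := H2w_lin s 0 Ha Ha; have Hsb := H2w_lin s 0 Hb Hb.
have Lg1 := L2_opr b0 bV Hsa Hsb; have Lg2 := L2_opr b0 (bmN bV) Hsb Hsa.
set g1 := opr _ _ _ _ _ in Lg1; set g2 := opr _ _ _ _ _ in Lg2.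
have Lg : L2 (mkc g1 g2) by apply/L2P.
have [Du D2] := Hdom_intro Hsa Hsb.
set u := mkc _ _ in Du D2.
have Eu : ae_equal (Hshift f eps lam u) (mkc g1 g2).
  by apply: ae_equal_trans (Hshift_comp f lam e0 _ D2) _; exact: ae_all.
have [DS ES uniq_S] := HS _ Lg.
have uS := uniq_S u Du Eu.
have [_ _ La _ _] := Hsa; have [_ _ Lb _ _] := Hsb.
have Lu : L2 u by apply/L2P.
have LS : L2 (S (mkc g1 g2)) by case: DS => [[[]]].
have [_ _ [_ ia] _ _] := Ha; have [_ _ [_ ib] _ _] := Hb.
apply: le_ereal_sup_tmp; exists (L2norm (S (mkc g1 g2))).
  exists (mkc g1 g2) => //; split => //.
  rewrite -[1%E]/(1%:E) -[1 in X in (_ <= X)%E]sqrtr1; apply: L2norm_le => //.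
  have -> : I (fun x => re (mkc g1 g2) x ^+ 2 + im (mkc g1 g2) x ^+ 2) = s ^+ 2 *
      I (fun x => opr (fun=> 0) (fun x => f x / eps - lam) a a2 b x ^+ 2 +
              opr (fun=> 0) (fun x => - (f x / eps - lam)) b b2 a x ^+ 2).
    rewrite -IZ; last by apply: itgD; [exact: (L2_opr b0 bV Ha Hb).2|exact: (L2_opr b0 (bmN bV) Hb Ha).2].
    by apply: eqI => x; rewrite /re /im /= /g1 /g2 !opr_lin; ring.
  by rewrite s2 ler_pdivrMl// mulr1.
rewrite L2norm_sqrt// -(I_ae_equal Lu LS uS).
have -> : I (fun x => re u x ^+ 2 + im u x ^+ 2) = K^-1.
  have -> : K^-1 = s ^+ 2 * N by rewrite s2; field; rewrite !gt_eqF.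
  rewrite /N -IZ; last exact: itgD.
  by apply: eqI => x; rewrite /re /im /=; ring.
by rewrite lee_fin sqrtrV// ltW.
Qed.

End Resolvent_norm.

(** * From the resolvent norm to Psi *)

Section Conclusion.
Variable R : realType.
Implicit Types (f V : R -> R) (x y t eps lam K : R).

Lemma bm_shift f eps lam : bounded_mfun f -> bounded_mfun (fun x => f x / eps - lam).
Proof.
move=> bf.
have -> : (fun x => f x / eps - lam) = fun x => eps^-1 * f x + - lam.
  by apply/funext => x; rewrite mulrC.
apply: bmD; first exact: bmZ.
by split; [exact: meas_cst|exists `|- lam|].
Qed.

(* x0 = eps^(-1/(k+4)) balances x0^2 with the size x0^-(k+2) / eps of V near x0. *)
Lemma psi_scale (k eps : R) : 0 < k -> 0 < eps -> eps <= 1 -> exists x0 : R,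
  [/\ 1 <= x0, x0 `^ (- (k + 2)) = eps * x0 ^+ 2 & eps `^ (2 / (k + 4)) = (x0 ^+ 2)^-1].
Proof.
move=> k0 e0 e1; have k4 : 0 < k + 4 by lra.
exists (eps `^ (- (k + 4)^-1)).
have x2 : (eps `^ (- (k + 4)^-1)) ^+ 2 = (eps `^ (2 / (k + 4)))^-1.
  rewrite -powR_mulrn ?powR_ge0// -powRrM -powRN; congr (_ `^ _); ring.
split.
- by rewrite -[X in X <= _](powRr0 eps); apply: ger_powR; rewrite ?e0// oppr_le0 invr_ge0 ltW.
- rewrite x2 -powRrM -powRN.
  have -> : eps * eps `^ (- (2 / (k + 4))) = eps `^ (1 + - (2 / (k + 4))).
    by rewrite powRD ?powRr1// ?ltW// (gt_eqF e0) implybT.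
  by congr (_ `^ _); field; rewrite gt_eqF.
- by rewrite x2 invrK.
Qed.

(** The supremum lies between c and M, so it is finite and positive, and the extended inverse is the
    ordinary decreasing one. *)
Lemma psi_bounds f eps (c M : R) : 0 < c -> 0 < M ->
  (forall lam, inverse_norm (Hshift f eps lam) <= M%:E)%E ->
  (exists lam, c%:E <= inverse_norm (Hshift f eps lam))%E ->
  ((M^-1)%:E <= Psi f eps /\ Psi f eps <= (c^-1)%:E)%E.
Proof.
move=> c0 M0 up [lam lo]; rewrite /Psi.
set s := ereal_sup _.
have sM : (s <= M%:E)%E by apply: ge_ereal_sup => _ [l _ <-].
have sc : (c%:E <= s)%E by apply: le_trans lo _; apply: ereal_sup_ubound; exists lam.
move: s sM sc => [s| |] //=; rewrite ?leye_eq// !lee_fin => sM sc.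
have s0 : 0 < s by exact: lt_le_trans sc.
by rewrite inver gt_eqF// !lee_fin !lef_pV2.
Qed.

End Conclusion.

Section Main.
Variable R : realType.

Lemma psi_estimate (k : R) (f : R -> R) : 0 < k -> Cn 3 f ->
  (forall x : R, derive1 f x = 0 -> f^`(2) x <> 0) ->
  power_tail k f ->
  exists K L : R, [/\ 0 < K, 0 < L & forall eps x0 : R, 0 < eps -> 1 <= x0 ->
    x0 `^ (- (k + 2)) = eps * x0 ^+ 2 ->
    (forall lam, inverse_norm (Hshift f eps lam) <= (Num.sqrt K / x0 ^+ 2)%:E)%E /\
    (exists lam, (Num.sqrt L * x0 ^+ 2)^-1%:E <= inverse_norm (Hshift f eps lam))%E].
Proof.
move=> k0 Cf crit decay.
have [bf [X [c [D [X1 c0 D0 _ dD]]]]] := bounded_decay k0 Cf decay.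
have [n [C [C0 cover]]] := sublevel_cover k0 Cf crit decay.
have [K K0 HK] := resolvent_estimate n C0.
have [L L0 HL] := @quasimode R D.
have cf := Cn_cont Cf.
have df := (Cn_elim Cf).1.
exists K, L; split => // eps x0 e0 x01 ex0.
have x00 : 0 < x0 by lra.
have en : eps != 0 by rewrite gt_eqF.
have xp : 0 < x0 ^+ 2 by rewrite exprn_gt0.
split=> [lam|].
  pose V x := f x / eps - lam.
  have bV : bounded_mfun V by exact: bm_shift.
  have cV : continuous V.
    move=> x; apply: cvgB; last exact: cvg_cst.
    by apply: cvgM; [exact: cf|exact: cvg_cst].
  have -> : Num.sqrt K / x0 ^+ 2 = Num.sqrt (K / (x0 ^+ 2) ^+ 2).
    by rewrite sqrtrM ?(ltW K0)// sqrtrV ?sqr_ge0// sqrtr_sqr ger0_norm ?(ltW xp).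
  apply: inverse_norm_le => //; first by rewrite divr_ge0 ?sqr_ge0// ltW.
  move=> a a1 a2 b b1 b2 Ha Hb.
  (* Since f - eps lam = eps V, the condition |V| < x0^2 is the sublevel condition at level eps lam
     with threshold eps x0^2 = x0^-(k+2). *)
  have [cs [sz cov]] := cover x0 (eps * lam) x01.
  have near x : `|x| <= x0 -> `|V x| < x0 ^+ 2 -> exists2 c, c \in cs & `|x - c| < C / x0.
    move=> xx Vx; apply: cov; split => //.
    have -> : f x - eps * lam = eps * V x by rewrite /V; field.
    by rewrite normrM (gtr0_norm e0) ex0 ltr_pM2l.
  have := HK V cs x0 a a1 a2 b b1 b2 x01 cV bV sz near Ha Hb.
  by rewrite [K / _ * _]mulrAC (ler_pdivlMr (I _)) ?exprn_gt0// [I _ * _]mulrC.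
pose lam := f x0 / eps; exists lam.
pose V x := f x / eps - lam.
have bV : bounded_mfun V by exact: bm_shift.
have HV x : x0 <= x -> x <= x0 + x0^-1 -> `|V x| <= D * x0 ^+ 2.
  rewrite le_eqVlt => /orP[/eqP <- _|xl xr].
    by rewrite /V /lam subrr normr0 mulr_ge0// ltW.
  have [z [z1 z2 fz]] := mvt df xl.
  have z0 : 0 < z by lra.
  have dz : `|derive1 f z| <= D * x0 `^ (- (k + 1)).
    apply: le_trans (dD z _) _; first by rewrite gtr0_norm//; lra.
    apply: ler_wpM2l; first exact: ltW.
    by rewrite gtr0_norm//; apply: powR_decr; [|exact: ltW|lra].
  have -> : V x = (f x - f x0) / eps by rewrite /V /lam; ring.
  rewrite fz normrM normfV (gtr0_norm e0) normrM ler_pdivrMr//.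
  have xd : `|x - x0| <= x0^-1 by rewrite gtr0_norm ?subr_gt0//; lra.
  apply: le_trans (ler_pM (normr_ge0 _) (normr_ge0 _) dz xd) _.
  (* The relation defining x0 closes the estimate: x0^-(k+1) x0^-1 = x0^-(k+2) = eps x0^2. *)
  rewrite -mulrA -mulrA [x0 ^+ 2 * eps]mulrC -ex0; apply: ler_wpM2l; first exact: ltW.
  have -> : - (k + 2) = - (k + 1) + -1 by ring.
  by rewrite powRD ?(gt_eqF x00) ?implybT// (powRN x0 1) (powRr1 (ltW x00)).
have [u [u1 [u2 [Hu N0 est]]]] := HL V x0 x01 bV HV.
have Hz := H2w_0 R.
have E : I (fun x => u x ^+ 2 + 0 ^+ 2) = I (fun x => u x ^+ 2).
  by apply: eqI => x; rewrite expr0n addr0.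
have -> : Num.sqrt L * x0 ^+ 2 = Num.sqrt (L * (x0 ^+ 2) ^+ 2).
  by rewrite sqrtrM ?(ltW L0)// sqrtr_sqr ger0_norm// ltW.
apply: (inverse_norm_ge en bV _ Hu Hz); rewrite ?E//.
by rewrite mulr_gt0// exprn_gt0.
Qed.

End Main.

Theorem theorem1p8 (R : realType) (k : R) (f : R -> R)
  (hk : 0 < k)
  (hf : Cn 3 f)
  (hcrit : forall x : R, f^`() x = 0 -> f^`(2) x <> 0)
  (hinf : exists C : R, 0 < C /\
     forall (x : R) (l : nat), 1 <= `|x| -> (l <= 3)%N ->
       `| (fun y : R => f y - 1 / `|y| `^ k)^`(l) x |
         <= C / `|x| `^ (k + l%:R + 1)) :
  exists M4 : R, 1 <= M4 /\
    forall eps : R, 0 < eps -> eps <= 1 ->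
      let nu := 2 / (k + 4) in
      ((1 / (M4 * eps `^ nu))%:E <= Psi f eps)%E /\
      (Psi f eps <= (M4 / eps `^ nu)%:E)%E.
Proof.
have [K [L [K0 L0 H]]] := psi_estimate hk hf hcrit hinf.
have sK : 0 < Num.sqrt K by rewrite sqrtr_gt0.
have sL : 0 < Num.sqrt L by rewrite sqrtr_gt0.
exists (1 + Num.sqrt K + Num.sqrt L); split; first by lra.
move=> eps e0 e1 nu.
have [x0 [x01 ex0 ->]] := psi_scale hk e0 e1.
have x00 : 0 < x0 ^+ 2 by rewrite exprn_gt0//; lra.
have [up low] := H eps x0 e0 x01 ex0.
have [|| lo hi] := @psi_bounds R f eps (Num.sqrt L * x0 ^+ 2)^-1 (Num.sqrt K / x0 ^+ 2) _ _ up low.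
- by rewrite invr_gt0 mulr_gt0.
- by rewrite divr_gt0.
split.
  apply: le_trans lo; rewrite lee_fin div1r.
  have p1 : 0 < Num.sqrt K / x0 ^+ 2 by rewrite divr_gt0.
  have p2 : 0 < (1 + Num.sqrt K + Num.sqrt L) / x0 ^+ 2 by rewrite divr_gt0//; lra.
  rewrite lef_pV2//.
  by apply: ler_wpM2r; [rewrite invr_ge0 ltW|lra].
apply: le_trans hi _; rewrite lee_fin !invrK; apply: ler_wpM2r; [exact: ltW|lra].
Qed.
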